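(* Let $d\ge1$, $H\in(0,1/2)$, $\alpha\in(0,1]$ with $2H+\alpha>1$, and $\beta\in[0,1)$. Let $Q:\mathbb{R}^d\times\mathbb{R}^d\to\mathbb{R}$ be a covariance function such that: (1) there is $C_0>0$ with $Q(x,x)+Q(y,y)-2Q(x,y)\le C_0|x-y|^{2\alpha}$ for all $x,y\in\mathbb{R}^d$; (2) there is $C_2>0$ such that for all $M>0$, $Q(x,y)\ge C_2M^{2\beta}$ for all $x,y\in\mathbb{R}^d$ with $x_i\ge M$ and $y_i\ge M$ for $i=1,\dots,d$. Let $W$ be the Gaussian field with covariance $R_H(t,s)Q(x,y)$ described in the context, let $u_0:\mathbb{R}^d\to\mathbb{R}$ be bounded and measurable with $\inf_{x\in\mathbb{R}^d}u_0(x)>0$, and let $$u(t,x)=\mathbb{E}^B\left[u_0(B_t^x)\exp\left(\int_0^t W(\mathrm{d}s,B_{t-s}^x)\right)\right].$$ Then there exists a constant $C>0$ (not depending on $x$, $t$, $k$) such that for all $x\in\mathbb{R}^d$, $$\mathbb{E}\left[u(t,x)^k\right]\ge C\exp\left(C\,k^{\frac{2-\beta}{1-\beta}}\,t^{\frac{2H+\beta}{1-\beta}}\right)$$ whenever either $k$ or $t$ is sufficiently large; that is, for every $x\in\mathbb{R}^d$ and every integer $k\ge1$ the bound holds for all sufficiently large $t$, and for every $x\in\mathbb{R}^d$ and every $t>0$ it holds for all sufficiently large integers $k$.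
   Context: For $t,s\in\mathbb{R}$ put $R_H(t,s)=\frac12\left(|t|^{2H}+|s|^{2H}-|t-s|^{2H}\right)$. $W=\{W(t,x): t\in\mathbb{R},x\in\mathbb{R}^d\}$ is a centered Gaussian process (taken with a continuous version) with $\mathbb{E}[W(t,x)W(s,y)]=R_H(t,s)Q(x,y)$. For $\epsilon>0$ let $\dot W^\epsilon(s,x)=(2\epsilon)^{-1}\left(W(s+\epsilon,x)-W(s-\epsilon,x)\right)$. For a continuous function $\phi:[0,T]\to\mathbb{R}^d$ and $0<t\le T$, $\int_0^t W(\mathrm{d}s,\phi_s):=\lim_{\epsilon\to0}\int_0^t\dot W^\epsilon(s,\phi_s)\,\mathrm{d}s$, if the limit exists in $L^2(\Omega)$. $B_t^x=x+B_t$, where $B$ is a standard $d$-dimensional Brownian motion independent of $W$; $\int_0^tW(\mathrm{d}s,B^x_{t-s})$ denotes this integral with $\phi_s=B^x_{t-s}$, the path of $B$ being fixed; $\mathbb{E}^B$ is expectation with respect to $B$ only. Since $u_0>0$, $u(t,x)$ and its moments are well defined in $(0,\infty]$. *)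

(* Defs.v *)
(* Built on MathComp and MathComp-Analysis. *)
From mathcomp Require Import all_boot all_order all_algebra.
From mathcomp Require Import all_classical all_reals all_analysis.
Set Implicit Arguments.
Unset Strict Implicit.
Unset Printing Implicit Defensive.
Import Order.TTheory GRing.Theory Num.Theory.
Import numFieldNormedType.Exports.
Local Open Scope classical_set_scope.
Local Open Scope ring_scope.

(* The library norm on ['rV[R]_d] is the sup norm. *)
Definition enorm (R : realType) (d : nat) (x : 'rV[R]_d) : R :=
  Num.sqrt (\sum_(i < d) x 0 i ^+ 2).

Definition fbm_cov (R : realType) (H t s : R) : R :=
  2^-1 * (`|t| `^ (2 * H) + `|s| `^ (2 * H) - `|t - s| `^ (2 * H)).

Definition covariance_function (R : realType) (T : Type) (Q : T -> T -> R) :=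
  (forall x y, Q x y = Q y x) /\
  (forall (n : nat) (x : 'I_n -> T) (c : 'I_n -> R),
     0 <= \sum_(i < n) \sum_(j < n) c i * c j * Q (x i) (x j)).

(* [m] is the mean and [s] the standard deviation.  The degenerate case is
   separated because the library gives [normal_prob m 0] a junk value. *)
Definition normal_rv (R : realType) (dO : measure_display)
    (Omega : measurableType dO) (P : probability Omega R) (m s : R)
    (X : Omega -> R) :=
  forall A : set R, measurable A ->
    P (X @^-1` A) = if s == 0 then \d_m A else normal_prob m s A.

Definition gaussian_process (R : realType) (dO : measure_display)
    (Omega : measurableType dO) (P : probability Omega R) (T : Type)
    (X : T -> Omega -> R) :=
  forall (n : nat) (i : 'I_n -> T) (c : 'I_n -> R),
    exists m s, normal_rv P m s (fun w => \sum_(j < n) c j * X (i j) w).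

(* It is enough to use the whole index type in the product rule: take
   [A i = setT] off a subfamily. *)
Definition mutually_independent (R : realType) (dO : measure_display)
    (Omega : measurableType dO) (P : probability Omega R) (I : finType)
    (X : I -> Omega -> R) :=
  forall A : I -> set R, (forall i, measurable (A i)) ->
    P (\bigcap_i (X i @^-1` A i)) = (\prod_(i : I) P (X i @^-1` A i))%E.

(* [B i t] is the [i]-th coordinate at time [t]; only [0 <= t] matters.  The
   independence clause runs over all coordinates and all increments at once:
   it gives both the independence of the vector increments and the law
   N(0, (t - s) I_d) of each of them. *)
Record standard_brownian_motion (R : realType) (dB : measure_display)
    (OmegaB : measurableType dB) (PB : probability OmegaB R) (d : nat)
    (B : 'I_d -> R -> {RV PB >-> R}) : Prop := StandardBrownianMotion {
  sbm0 : forall i w, B i 0 w = 0 ;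
  sbm_normal : forall i s t, 0 <= s -> s <= t ->
    normal_rv PB 0 (Num.sqrt (t - s)) (fun w => B i t w - B i s w) ;
  sbm_independent : forall (n : nat) (s : nat -> R),
    0 <= s 0%N -> (forall j, s j <= s j.+1) ->
    mutually_independent PB (fun (ij : 'I_d * 'I_n) w =>
      B ij.1 (s ij.2.+1) w - B ij.1 (s ij.2) w) ;
  sbm_continuous : forall i w,
    {within `[0, +oo[, continuous (fun t => B i t w)} }.

Record gaussian_field (R : realType) (dO : measure_display)
    (Omega : measurableType dO) (P : probability Omega R) (d : nat) (H : R)
    (Q : 'rV[R]_d -> 'rV[R]_d -> R)
    (W : R -> 'rV[R]_d -> {RV P >-> R}) : Prop := GaussianField {
  gf_gaussian : gaussian_process P (fun (z : R * 'rV[R]_d) => W z.1 z.2) ;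
  gf_centered : forall t x, ('E_P[W t x] = 0)%E ;
  gf_cov : forall t s x y,
    ('E_P[fun w => (W t x w * W s y w)%R] = (fbm_cov H t s * Q x y)%:E)%E ;
  gf_continuous : forall w,
    continuous (fun z : R * 'rV[R]_d => W z.1 z.2 w) }.

Section NonlinearIntegral.
Context (R : realType) (dO : measure_display) (Omega : measurableType dO).
Context (P : probability Omega R) (d : nat).
Variable W : R -> 'rV[R]_d -> {RV P >-> R}.

Definition dotW (eps s : R) (x : 'rV[R]_d) (w : Omega) : R :=
  (2 * eps)^-1 * (W (s + eps) x w - W (s - eps) x w).

Definition integral_dotW (eps t : R) (phi : R -> 'rV[R]_d) (w : Omega) : R :=
  \int[lebesgue_measure]_(s in `[0, t]) dotW eps s (phi s) w.

(* [Z] is (a representative of) the integral of W(ds, phi_s) over [0, t]. *)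
Definition is_nonlinear_integral (t : R) (phi : R -> 'rV[R]_d)
    (Z : Omega -> R) :=
  Z \in Lfun P 2%:E /\
  ('N[P]_2%:E[EFin \o (integral_dotW eps t phi \- Z)%R])%E
    @[eps --> 0^'+] --> 0%E.

End NonlinearIntegral.

Section FeynmanKac.
Context (R : realType) (dO dB : measure_display).
Context (Omega : measurableType dO) (OmegaB : measurableType dB).
Context (P : probability Omega R) (PB : probability OmegaB R) (d : nat).
Variables (W : R -> 'rV[R]_d -> {RV P >-> R}).
Variables (B : 'I_d -> R -> {RV PB >-> R}).

(* W lives on [Omega] and B on [OmegaB]: working on the product space makes
   them independent, and E^B is integration over [OmegaB] alone. *)
Definition shiftedB (x : 'rV[R]_d) (t : R) (wB : OmegaB) : 'rV[R]_d :=
  x + \row_i B i t wB.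

(* For each fixed path of B the integral is only defined up to a P-null set,
   so taking E^B requires a version that is jointly measurable. *)
Definition is_integral_version (t : R) (x : 'rV[R]_d)
    (J : Omega * OmegaB -> R) :=
  measurable_fun [set: Omega * OmegaB] J /\
  {ae PB, forall wB, is_nonlinear_integral W t
    (fun s => shiftedB x (t - s) wB) (fun w => J (w, wB))}.

(* Any two versions agree almost everywhere for the product measure, hence
   yield almost surely the same value of [feynman_kac].  Existence of a version
   is not assumed: if there were none, this would be the zero function. *)
Definition integral_version (t : R) (x : 'rV[R]_d) : Omega * OmegaB -> R :=
  xget (cst 0) [set J | is_integral_version t x J].

Definition feynman_kac (u0 : 'rV[R]_d -> R) (t : R) (x : 'rV[R]_d)
    (w : Omega) : \bar R :=
  ('E_PB[fun wB => (u0 (shiftedB x t wB) * expR (integral_version t x (w, wB)))%R])%E.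

End FeynmanKac.

(* Main.v *)
(* For paths b_1, ..., b_k of B the variable X = \sum_i \int_0^t W(ds, b_i(t - s)) is
   Gaussian, so E exp(X) is exponential in its variance; Tonelli's theorem turns E[u^k]
   into an average of E exp(X) over independent copies of the path.  As H < 1/2, disjoint
   increments of fractional Brownian motion are negatively correlated, and the identity
     \sum r_ij q_ij = \sum_i q_ii \sum_j r_ij - 1/2 \sum r_ij (q_ii + q_jj - 2 q_ij)
   for the variance then bounds it below by its diagonal part: if all paths stay in
   [M, oo)^d during the first theta t units of time, the variance is at least
   k^2 C2 M^(2 beta) (theta t)^(2 H) / 2.  Paths do so with probability at least
   exp(-c M^2 / t), and M^(2 - 2 beta) ~ k t^(2 H + 1) balances both effects.
   The same identity bounds the variance from above; this shows that along Hoelder paths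
   the nonlinear integral is the L^2 limit of sums of increments of W over dyadic
   partitions, which reduces everything to finite Gaussian sums. *)
Require Import Defs.
From HB Require Import structures.
From mathcomp Require Import all_boot all_order all_algebra.
From mathcomp Require Import all_classical all_reals all_analysis.
From mathcomp Require Import measurable_realfun.
From mathcomp Require Import ring lra.
Set Implicit Arguments.
Unset Strict Implicit.
Unset Printing Implicit Defensive.
Import Order.TTheory GRing.Theory Num.Theory.
Import numFieldNormedType.Exports.
Local Open Scope classical_set_scope.
Local Open Scope ring_scope.

(** * Quadratic forms with nonpositive off-diagonal weights *)

(** The condition [1 < 2 * H + alpha] enters through convergence along dyadic partitions. Brownian
    paths are Hoelder of every exponent gam < 1/2, so one refinement at mesh h = t 2^-n changes the
    sum by a mean square of order 2^n h^(2 H) h^(2 alpha gam). This decays geometrically when 2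
    alpha gam > 1 - 2 H, and such a gam < 1/2 exists exactly when 2 H + alpha > 1. The estimate has
    to count cells, not pairs of cells; nonnegative row sums of the fractional covariance make this
    possible. Fatou's lemma goes the wrong way for a lower bound on E exp of a limit; bounded
    moments E exp(2 Y_n) of the approximations replace it. The path enters as B(t - s): the first
    theta t units of noise time see the last theta t units of Brownian time. Paths are kept high
    there by asking that every coordinate be at least a at time t - theta t and that the path
    oscillate little afterwards. For a^2 >= t the first condition has probability at least exp(- c
    a^2 / t), with c independent of small theta; for theta small the failure of the second is much
    rarer, and the two probabilities are subtracted. *)

Section Quadratic.
Context (R : realType) (I : finType).
Implicit Types r q : I -> I -> R.

Lemma quad_split r q : (forall i j, r i j = r j i) ->
  \sum_i \sum_j r i j * q i j =
  \sum_i q i i * (\sum_j r i j)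
  - 2^-1 * \sum_i \sum_j r i j * (q i i + q j j - 2 * q i j).
Proof.
move=> rC.
have e1 : \sum_i q i i * (\sum_j r i j) = \sum_i \sum_j r i j * q i i.
  by apply: eq_bigr => i _; rewrite mulr_sumr; apply: eq_bigr => j _; rewrite mulrC.
have e2 : \sum_i \sum_j r i j * q j j = \sum_i \sum_j r i j * q i i.
  by rewrite exchange_big; apply: eq_bigr => i _; apply: eq_bigr => j _; rewrite rC.
have -> : \sum_i \sum_j r i j * (q i i + q j j - 2 * q i j) =
   \sum_i \sum_j r i j * q i i + \sum_i \sum_j r i j * q j j
   - 2 * \sum_i \sum_j r i j * q i j.
  rewrite mulr_sumr -!big_split -sumrB /=; apply: eq_bigr => i _.
  rewrite mulr_sumr -!big_split -sumrB /=; apply: eq_bigr => j _.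
  by rewrite mulrBr mulrDr mulrCA.
by rewrite e2 e1; field.
Qed.

Lemma quad_ge r q : (forall i j, r i j = r j i) ->
  (forall i j, i != j -> r i j <= 0) ->
  (forall i j, 0 <= q i i + q j j - 2 * q i j) ->
  \sum_i q i i * (\sum_j r i j) <= \sum_i \sum_j r i j * q i j.
Proof.
move=> rC rN qD; rewrite quad_split// lerBrDl gerDr pmulr_rle0//.
apply: sumr_le0 => i _; apply: sumr_le0 => j _.
have [->|/rN ij] := eqVneq i j; last by rewrite mulr_le0_ge0.
by rewrite -mulr2n mulr_natl subrr mulr0.
Qed.

(** Here the last term of [quad_split] has to be paid for: the distance is at most 2 (q_ii + q_jj)
    <= 4 G, whence the factor 2 G. The alternative [r i j = 0] admits degenerate cells, on which
    nothing is known about q. *)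
Lemma quad_le r q G : (forall i j, r i j = r j i) ->
  (forall i j, i != j -> r i j <= 0) ->
  (forall i, 0 <= \sum_j r i j) ->
  (forall i j, q i i + q j j - 2 * q i j <= 2 * (q i i + q j j)) ->
  (forall i, q i i <= G \/ forall j, r i j = 0) ->
  \sum_i \sum_j r i j * q i j <=
  G * (\sum_i \sum_j r i j) + 2 * G * (\sum_i \sum_(j | j != i) - r i j).
Proof.
move=> rC rN rho qD qG; rewrite quad_split// lerD//.
  rewrite mulr_sumr ler_sum// => i _.
  by have [/ler_wpM2r->//|r0] := qG i; rewrite big1// !mulr0.
rewrite -mulrN -sumrN -ler_pdivlMl// invrK !mulr_sumr ler_sum// => i _.
rewrite (bigD1 i)//= -mulr2n mulr_natl subrr mulr0 add0r mulr_sumr mulr_sumr.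
rewrite -sumrN ler_sum// => j ji.
have [qi|ri0] := qG i; last by rewrite ri0 mul0r oppr0 !mulr0.
have [qj|rj0] := qG j; last by rewrite rC rj0 mul0r oppr0 !mulr0.
have rij : 0 <= - r i j by rewrite oppr_ge0 rN// eq_sym.
rewrite -mulNr mulrC 2!mulrA ler_wpM2r//.
apply: (le_trans (qD i j)); lra.
Qed.

End Quadratic.

(** * Clipped partitions and telescoping sums *)

Section Telescope.
Context (R : realType).
Implicit Types (w : R -> R) (p q : nat -> R).

Definition clip (a b x : R) : R := Num.max a (Num.min b x).

Lemma clip_ge a b x : a <= clip a b x. Proof. by rewrite le_max lexx. Qed.

Lemma clip_le a b x : a <= b -> clip a b x <= b.
Proof. by move=> ab; rewrite ge_max ab ge_min lexx. Qed.

Lemma clip_mono a b x y : x <= y -> clip a b x <= clip a b y.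
Proof. by move=> xy; rewrite /clip ge_max le_max lexx le_max le_min2// orbT. Qed.

Lemma clip_lo a b x : a <= b -> x <= a -> clip a b x = a.
Proof.
move=> ab xa; rewrite /clip (min_r (le_trans xa ab)).
by rewrite (max_l xa).
Qed.

Lemma clip_hi a b x : a <= b -> b <= x -> clip a b x = b.
Proof. by move=> ab bx; rewrite /clip (min_l bx) (max_r ab). Qed.

Lemma sum_clip_inner w a b q n : a <= b -> q 0%N <= a -> b <= q n ->
  \sum_(l < n) (w (clip a b (q l.+1)) - w (clip a b (q l))) = w b - w a.
Proof.
move=> ab qa bq.
rewrite -(big_mkord xpredT (fun l => w (clip a b (q l.+1)) - w (clip a b (q l)))).
by rewrite telescope_sumr// clip_hi// clip_lo.
Qed.

Lemma sum_clip_outer w p n x y : (forall j, p j <= p j.+1) ->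
  p 0%N <= x -> x <= y -> y <= p n ->
  \sum_(j < n) (w (clip (p j) (p j.+1) y) - w (clip (p j) (p j.+1) x)) =
  w y - w x.
Proof.
move=> pn px xy yp.
(* Up to the base value w (p j), clipping z to a cell gives an increment of the sequence w (min z (p
   j)), so the sum for a single end point telescopes. *)
have E z j : w (clip (p j) (p j.+1) z) - w (p j) =
    w (Num.min z (p j.+1)) - w (Num.min z (p j)).
  have [zp|pz] := lerP z (p j).
    by rewrite clip_lo// (min_l (le_trans zp (pn j))) !subrr.
  rewrite /clip max_r; last by rewrite le_min pn ltW.
  by rewrite minC.
have S z : p 0%N <= z -> z <= p n ->
    \sum_(j < n) (w (clip (p j) (p j.+1) z) - w (p j)) = w z - w (p 0%N).
  move=> z0 zn; under eq_bigr do rewrite E.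
  rewrite -(big_mkord xpredT (fun j => w (Num.min z (p j.+1)) - w (Num.min z (p j)))).
  by rewrite telescope_sumr// (min_l zn) (min_r z0).
rewrite (eq_bigr (fun j : 'I_n => w (clip (p j) (p j.+1) y) - w (p j) -
   (w (clip (p j) (p j.+1) x) - w (p j)))); last first.
  by move=> j _; rewrite opprB addrA subrK.
rewrite sumrB !S//; last 2 first.
- exact: le_trans yp.
- exact: le_trans xy.
by rewrite opprB addrA subrK.
Qed.

End Telescope.

(** * Covariance of fractional Brownian increments for H < 1/2 *)

Section Fbm.
Context (R : realType).

(** Convexity of the power th^-1 >= 1, applied to x^th and y^th. *)
Lemma powR_concave (th l x y : R) : 0 < th -> th <= 1 -> 0 <= l -> l <= 1 ->
  0 <= x -> 0 <= y ->
  l * x `^ th + (1 - l) * y `^ th <= (l * x + (1 - l) * y) `^ th.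
Proof.
move=> th0 th1 l0 l1 x0 y0.
have m0 : 0 <= 1 - l by rewrite subr_ge0.
have s0 : 0 <= l * x `^ th + (1 - l) * y `^ th.
  by rewrite addr_ge0// mulr_ge0// powR_ge0.
have inv1 : 1 <= th^-1 by rewrite invf_ge1.
have D z : z `^ th \in (`[0, +oo[%classic : set R).
  by rewrite inE /= in_itv /= andbT powR_ge0.
have hconv : (l * x `^ th + (1 - l) * y `^ th) `^ th^-1 <=
    l * (x `^ th) `^ th^-1 + (1 - l) * (y `^ th) `^ th^-1.
  exact: (convex_powR inv1 (Itv01 l0 l1) (D x) (D y)).
rewrite -!powRrM divff ?gt_eqF// !powRr1// in hconv.
have := @ge0_ler_powR R th (ltW th0) _ _ _ _ hconv.
rewrite -powRrM mulVf ?gt_eqF// powRr1//; apply.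
- by rewrite nnegrE powR_ge0.
- by rewrite nnegrE addr_ge0// mulr_ge0.
Qed.

(** Both x + p and x + q are convex combinations of x and x + p + q, with complementary weights; the
    two concavity inequalities add up to the claim. *)
Lemma powR_submodular (th x p q : R) : 0 < th -> th <= 1 ->
  0 <= x -> 0 <= p -> 0 <= q ->
  x `^ th + (x + p + q) `^ th <= (x + p) `^ th + (x + q) `^ th.
Proof.
move=> th0 th1 x0 p0 q0.
have [pq0|pq] := eqVneq (p + q) 0.
  have -> : p = 0 by lra.
  have -> : q = 0 by lra.
  by rewrite !addr0.
have pq' : 0 < p + q by rewrite lt_neqAle eq_sym pq addr_ge0.
have y0 : 0 <= x + p + q by rewrite !addr_ge0.
have h a b : 0 <= a -> 0 <= b -> a + b = p + q ->
    b / (p + q) * x `^ th + (1 - b / (p + q)) * (x + p + q) `^ th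
    <= (x + a) `^ th.
  move=> a0 b0 ab.
  have -> : x + a = b / (p + q) * x + (1 - b / (p + q)) * (x + p + q).
    have -> : a = p + q - b by lra.
    by field.
  apply: powR_concave => //; first by rewrite divr_ge0// ltW.
  by rewrite ler_pdivrMr// mul1r -ab lerDr.
have := lerD (h p q p0 q0 erefl) (h q p q0 p0 (addrC _ _)).
apply: le_trans; rewrite le_eqVlt; apply/orP; left; apply/eqP.
by field.
Qed.

(** Covariance of the increments of fractional Brownian motion over [a, b] and [c, d]. *)
Definition fbm_incr (H a b c d : R) : R :=
  fbm_cov H b d - fbm_cov H b c - (fbm_cov H a d - fbm_cov H a c).

Context (H : R) (H0 : 0 < H) (H1 : H < 1 / 2).

Lemma fbm_covC t s : fbm_cov H t s = fbm_cov H s t.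
Proof. by rewrite /fbm_cov distrC [_ `^ _ + _]addrC. Qed.

Lemma fbm_incrC a b c d : fbm_incr H a b c d = fbm_incr H c d a b.
Proof.
rewrite /fbm_incr (fbm_covC b d) (fbm_covC b c) (fbm_covC a d) (fbm_covC a c).
ring.
Qed.

Lemma fbm_incrE a b c d : fbm_incr H a b c d =
  2^-1 * (`|b - c| `^ (2 * H) + `|a - d| `^ (2 * H)
          - `|b - d| `^ (2 * H) - `|a - c| `^ (2 * H)).
Proof. by rewrite /fbm_incr /fbm_cov; ring. Qed.

Lemma fbm_incr_null a c d : fbm_incr H a a c d = 0.
Proof. by rewrite /fbm_incr subrr. Qed.

(** Submodularity of the power 2 H <= 1, with the gap c - b as base point and the two interval
    lengths as increments. *)
Lemma fbm_incr_sep a b c d : a <= b -> b <= c -> c <= d ->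
  fbm_incr H a b c d <= 0.
Proof.
move=> ab bc cd; rewrite fbm_incrE pmulr_rle0// -addrA -opprD subr_le0.
have -> : `|b - c| = c - b by rewrite distrC ger0_norm// subr_ge0.
have -> : `|a - d| = (c - b) + (b - a) + (d - c).
  by rewrite distrC ger0_norm ?subr_ge0 ?(le_trans ab)// ?(le_trans bc)//; ring.
have -> : `|b - d| = (c - b) + (d - c).
  by rewrite distrC ger0_norm ?subr_ge0 ?(le_trans bc)//; ring.
have -> : `|a - c| = (c - b) + (b - a).
  by rewrite distrC ger0_norm ?subr_ge0 ?(le_trans ab)//; ring.
rewrite [leRHS]addrC; apply: powR_submodular; rewrite ?subr_ge0//.
- by rewrite mulr_gt0.
- by move: H1; lra.
Qed.

Lemma fbm_incr_diag a b : a <= b -> fbm_incr H a b a b = (b - a) `^ (2 * H).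
Proof.
move=> ab; rewrite fbm_incrE !subrr normr0.
have -> : 0 `^ (2 * H) = 0 :> R by rewrite powR0// mulf_neq0// gt_eqF.
have ba : 0 <= b - a by rewrite subr_ge0.
by rewrite (distrC a) (ger0_norm ba); field.
Qed.

(** Against the whole interval [0, t] the sign is reversed, by monotonicity of the power alone.
    These are the row sums of the increment matrix of a partition of [0, t]. *)
Lemma fbm_incr_ge0 a b t : 0 <= a -> a <= b -> b <= t ->
  0 <= fbm_incr H a b 0 t.
Proof.
move=> a0 ab bt; have b0 := le_trans a0 ab; have at_ := le_trans ab bt.
rewrite fbm_incrE pmulr_rge0// !subr0 (ger0_norm a0) (ger0_norm b0).
rewrite !(distrC _ t) !ger0_norm ?subr_ge0//.
have H2 : 0 <= 2 * H by rewrite mulr_ge0// ltW.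
have h1 : a `^ (2 * H) <= b `^ (2 * H) by apply: ge0_ler_powR.
have h2 : (t - b) `^ (2 * H) <= (t - a) `^ (2 * H).
  by apply: ge0_ler_powR; rewrite ?nnegrE ?subr_ge0// lerB.
lra.
Qed.

End Fbm.

(** * One-dimensional normal laws *)

Section NormalLaw.
Context (R : realType).
Local Notation mu := (@lebesgue_measure R).
Implicit Types (m s c a : R).

Lemma ge0_integral_normal_prob m s (g : R -> \bar R) :
  measurable_fun setT g -> (forall x, (0 <= g x)%E) ->
  (\int[normal_prob m s]_x g x = \int[mu]_x (g x * (normal_pdf m s x)%:E))%E.
Proof.
move=> mg g0.
have dom := normal_prob_dominates m s.
rewrite -(Radon_Nikodym_SigmaFinite.change_of_variables dom g0 measurableT mg).
have mpdf : measurable_fun setT (fun x => (normal_pdf m s x)%:E).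
  by apply/measurable_EFinP; exact: measurable_normal_pdf.
have fi := Radon_Nikodym_SigmaFinite.f_integrable dom.
apply: ae_eq_integral => //.
- by apply: emeasurable_funM => //; exact: measurable_int fi.
- exact: emeasurable_funM.
- apply: ae_eqe_mul2l; apply: integral_ae_eq => //.
  by move=> E _ mE; rewrite -Radon_Nikodym_SigmaFinite.f_integral.
Qed.

Context (d : measure_display) (T : measurableType d) (P : probability T R).
Implicit Types X : {RV P >-> R}.

Lemma ge0_integral_normal_rv m s X (g : R -> \bar R) : s != 0 ->
  normal_rv P m s X ->
  measurable_fun setT g -> (forall x, (0 <= g x)%E) ->
  (\int[P]_w g (X w) = \int[mu]_x (g x * (normal_pdf m s x)%:E))%E.
Proof.
move=> s0 nX mg g0; rewrite -ge0_integral_normal_prob//.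
have mX : @measurable_fun _ _ T (measurableTypeR R) setT X.
  exact: (@measurable_funPT _ _ _ _ X).
pose X' : {RV P >-> measurableTypeR R} :=
  HB.pack (X : T -> measurableTypeR R) (isMeasurableFun.Build _ _ _ _ _ mX).
rewrite -(ge0_integral_distribution X' mg g0).
apply: eq_measure_integral => A mA _.
by have := nX A mA; rewrite (negbTE s0).
Qed.

(** Completing the square turns exp(c x) times the density into a constant times the density with
    mean m + c s^2. *)
Lemma normal_rv_mgf m s X c : normal_rv P m s X ->
  (\int[P]_w (expR (c * X w))%:E = (expR (c * m + c ^+ 2 * s ^+ 2 / 2))%:E)%E.
Proof.
have mexp : measurable_fun [set: R] (fun x => (expR (c * x))%:E).
  by apply/measurable_EFinP; apply: measurableT_comp => //;
     exact: measurable_funM.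
have exp0 x : (0 <= (expR (c * x))%:E)%E by rewrite lee_fin expR_ge0.
have [->|s0] := eqVneq s 0 => nX.
  rewrite expr0n /= mulr0 mul0r addr0.
  rewrite -(ge0_integral_distribution X mexp exp0).
  rewrite (@eq_measure_integral _ _ _ _ (\d_m)) => [|A mA _].
    by rewrite integral_dirac// diracT mul1e.
  by have := nX A mA; rewrite eqxx.
rewrite (ge0_integral_normal_rv s0 nX mexp exp0).
set K := expR _.
transitivity (\int[mu]_x (K%:E * (normal_pdf (m + c * s ^+ 2) s x)%:E))%E.
  apply: eq_integral => x _; rewrite !normal_pdfE// -!EFinM; congr EFin.
  rewrite mulrCA [RHS]mulrCA; congr (_ * _).
  rewrite /normal_fun /K -!expRD; congr expR.
  by field.
rewrite ge0_integralZl//=.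
- by rewrite integral_normal_pdf mule1.
- by apply/measurable_EFinP; exact: measurable_normal_pdf.
- by move=> x _; rewrite lee_fin normal_pdf_ge0.
- by rewrite lee_fin expR_ge0.
Qed.

Lemma normal_rv_anti m s X (r : R) : s != 0 -> normal_rv P m s X -> 0 <= r ->
  (P (X @^-1` `[(- r)%R, r]) <= (2 * r * normal_peak s)%:E)%E.
Proof.
move=> s0 nX r0.
have mI : measurable (`[(- r), r]%classic : set R) by exact: measurable_itv.
rewrite nX// (negbTE s0) /normal_prob.
apply: (@le_trans _ _ (\int[mu]_(x in `[(- r)%R, r]) (normal_peak s)%:E)%E).
  apply: ge0_le_integral => //=.
  - by move=> x _; rewrite lee_fin normal_pdf_ge0.
  - by apply/measurable_EFinP/measurable_funTS; exact: measurable_normal_pdf.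
  - by move=> x _; rewrite lee_fin normal_pdf_ub.
rewrite integral_cst//= lebesgue_measure_itv /=; case: ifPn => _.
  rewrite -EFinD -EFinM lee_fin le_eqVlt; apply/orP; left; apply/eqP; ring.
by rewrite mule0 lee_fin !mulr_ge0// normal_peak_ge0.
Qed.

(** Whatever the mean, [-|s|/2, |s|/2] has mass at most |s| times the peak of the density, that is 1
    / sqrt(2 pi) <= 1/2. Outside, with mass at least 1/2, the square is at least s^2 / 4. *)
Lemma normal_rv_sqr_ge m s X : normal_rv P m s X ->
  ((s ^+ 2 / 8)%:E <= \int[P]_w (X w ^+ 2)%:E)%E.
Proof.
have [->|s0] := eqVneq s 0 => nX.
  rewrite expr0n /= mul0r; apply: integral_ge0 => w _.
  by rewrite lee_fin sqr_ge0.
pose r := `|s| / 2.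
have r0 : 0 <= r by rewrite divr_ge0.
pose A := X @^-1` `[(- r), r].
have mA : measurable A.
  by rewrite -[A]setTI; apply: measurable_funP => //; exact: measurable_itv.
have PA : (P A <= (2^-1)%:E)%E.
  apply: (le_trans (normal_rv_anti s0 nX r0)); rewrite lee_fin.
  have -> : 2 * r = `|s| by rewrite /r; field.
  rewrite /normal_peak -mulr_natr -mulrA sqrtrM ?sqr_ge0// sqrtr_sqr invfM.
  rewrite mulrA divff ?normr_eq0// mul1r lef_pV2 ?posrE ?sqrtr_gt0//; last first.
    by rewrite mulr_gt0// pi_gt0.
  rewrite -[X in X <= _]ger0_norm// -sqrtr_sqr ler_wsqrtr//.
  by have := pi_ge2 R; lra.
have PcA : ((2^-1)%:E <= P (~` A))%E.
  rewrite probability_setC// leeBrDr//; last first.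
    by rewrite ge0_fin_numE// (le_lt_trans PA) ?ltry.
  apply: (le_trans (leeD2l _ PA)); rewrite -EFinD lee_fin; lra.
apply: (@le_trans _ _ (\int[P]_(w in ~` A) (r ^+ 2)%:E)%E).
  rewrite integral_cst//=; last exact: measurableC.
  apply: (@le_trans _ _ ((r ^+ 2)%:E * (2^-1)%:E)%E).
    rewrite -EFinM lee_fin /r exprMn real_normK ?num_real//.
    by rewrite le_eqVlt; apply/orP; left; apply/eqP; field.
  by rewrite lee_pmul2l// lte_fin exprn_gt0// divr_gt0// normr_gt0.
have mX2 : measurable_fun setT (fun w => (X w ^+ 2)%:E).
  by apply/measurable_EFinP; exact: measurable_funX.
apply: (@le_trans _ _ (\int[P]_(w in ~` A) (X w ^+ 2)%:E)%E).
  apply: ge0_le_integral => //=.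
  - exact: measurableC.
  - by move=> w _; rewrite lee_fin sqr_ge0.
  - exact: measurable_funTS.
  - move=> w; rewrite /A /= in_itv /= => /negP; rewrite -ler_norml -ltNge => rw.
    by rewrite lee_fin -[leRHS]real_normK ?num_real// lerXn2r// ?nnegrE// ltW.
apply: ge0_subset_integral => //.
- exact: measurableC.
- by move=> w _; rewrite lee_fin sqr_ge0.
Qed.

(** Only [a, a + s] is kept, where the density is at least its value at a + s. *)
Lemma normal_rv_tail s X a : 0 < s -> 0 <= a -> normal_rv P 0 s X ->
  ((expR (- ((a + s) ^+ 2 / (s ^+ 2 *+ 2))) / Num.sqrt (pi *+ 2))%:E
   <= P (X @^-1` `[a, +oo[))%E.
Proof.
move=> s0 a0 nX; have sn0 : s != 0 by rewrite gt_eqF.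
have mI : measurable (`[a, +oo[%classic : set R) by exact: measurable_itv.
rewrite nX// (negbTE sn0).
set K := expR _.
have mpdf : measurable_fun setT (fun x => (normal_pdf 0 s x)%:E).
  by apply/measurable_EFinP; exact: measurable_normal_pdf.
apply: (@le_trans _ _ (\int[mu]_(x in `[a, (a + s)%R]) (normal_pdf 0 s x)%:E)%E).
  apply: (@le_trans _ _ (\int[mu]_(x in `[a, (a + s)%R]) (normal_peak s * K)%:E)%E).
    rewrite integral_cst//= lebesgue_measure_itv /= lte_fin ltrDl s0.
    rewrite -EFinD -EFinM lee_fin addrAC subrr add0r /normal_peak.
    rewrite -mulrnAr sqrtrM ?sqr_ge0// sqrtr_sqr gtr0_norm// invfM.
    rewrite le_eqVlt; apply/orP; left; apply/eqP; field.
    by rewrite sn0 sqrtr_eq0 -ltNge pmulrn_lgt0// pi_gt0.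
  apply: ge0_le_integral => //=.
  - by move=> x _; rewrite lee_fin mulr_ge0 ?normal_peak_ge0 ?expR_ge0.
  - exact: measurable_funTS.
  - move=> x; rewrite in_itv /= => /andP[ax xa].
    rewrite lee_fin normal_pdfE// ler_pM2l ?normal_peak_gt0// /K /normal_fun.
    rewrite ler_expR subr0 mulNr lerN2 ler_pM2r; last first.
      by rewrite invr_gt0 pmulrn_lgt0// exprn_gt0.
    by rewrite lerXn2r// nnegrE ?addr_ge0 ?(ltW s0)// (le_trans a0).
apply: ge0_subset_integral => //=.
- exact: measurable_funTS.
- by move=> x _; rewrite lee_fin normal_pdf_ge0.
- by move=> x; rewrite /= !in_itv /= => /andP[->].
Qed.

End NormalLaw.

(* No measurability is required, which spares proving that [u0] composed with the
   Brownian path is measurable. *)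
Lemma le_integral_nonneg (d : measure_display) (T : measurableType d)
    (R : realType) (mu : {measure set T -> \bar R}) (f g : T -> \bar R) :
  (forall x, (0 <= f x)%E) -> (forall x, (f x <= g x)%E) ->
  (\int[mu]_x f x <= \int[mu]_x g x)%E.
Proof.
move=> f0 fg; rewrite !ge0_integralTE//; last first.
  by move=> x; exact: le_trans (fg x).
apply: ge_ereal_sup => _ /= [h hf <-]; apply: ereal_sup_ubound.
by exists h => // x; exact: le_trans (hf x) (fg x).
Qed.

(** * Mean squares and almost sure limits *)

Section SecondMoment.
Context (R : realType) (d : measure_display) (T : measurableType d).
Context (P : probability T R).
Implicit Types X Y Z : T -> R.

(** Valued in the extended reals, so that mean-square bounds can be chained before integrability is
    known. *)
Definition msq X : \bar R := (\int[P]_w (X w ^+ 2)%:E)%E.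

Lemma measurable_sqr X : measurable_fun setT X ->
  measurable_fun setT (fun w => (X w ^+ 2)%:E).
Proof. by move=> mX; apply/measurable_EFinP; exact: measurable_funX. Qed.

Lemma msq_ge0 X : (0 <= msq X)%E.
Proof. by apply: integral_ge0 => w _; rewrite lee_fin sqr_ge0. Qed.

Lemma msqN X : msq (fun w => - X w) = msq X.
Proof. by apply: eq_integral => w _; rewrite sqrrN. Qed.

Lemma msqBC X Y : msq (fun w => X w - Y w) = msq (fun w => Y w - X w).
Proof. by rewrite -msqN; apply: eq_integral => w _; rewrite opprB. Qed.

Lemma msqD X Y : measurable_fun setT X -> measurable_fun setT Y ->
  (msq (fun w => (X w + Y w)%R) <= 2%:E * msq X + 2%:E * msq Y)%E.
Proof.
move=> mX mY.
have m2 := measurable_sqr.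
have m2X : measurable_fun setT (fun w => (2%:E * (X w ^+ 2)%:E)%E).
  by apply: emeasurable_funM => //; exact: m2.
have m2Y : measurable_fun setT (fun w => (2%:E * (Y w ^+ 2)%:E)%E).
  by apply: emeasurable_funM => //; exact: m2.
rewrite /msq -!ge0_integralZl//; try exact: m2;
  try by move=> w _; rewrite lee_fin sqr_ge0.
rewrite -ge0_integralD//; try by move=> w _; rewrite -EFinM lee_fin mulr_ge0// sqr_ge0.
apply: le_integral_nonneg => w; first by rewrite lee_fin sqr_ge0.
rewrite -!EFinM -EFinD lee_fin -subr_ge0.
have -> : 2 * X w ^+ 2 + 2 * Y w ^+ 2 - (X w + Y w) ^+ 2 = (X w - Y w) ^+ 2.
  by ring.
exact: sqr_ge0.
Qed.

Lemma msqB_trans X Y Z (a b : R) : measurable_fun setT X -> measurable_fun setT Y ->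
  measurable_fun setT Z ->
  (msq (fun w => X w - Y w)%R <= a%:E)%E -> (msq (fun w => Y w - Z w)%R <= b%:E)%E ->
  (msq (fun w => X w - Z w)%R <= (2 * a + 2 * b)%:E)%E.
Proof.
move=> mX mY mZ XY YZ.
have -> : (fun w => X w - Z w) = (fun w => (X w - Y w) + (Y w - Z w)).
  by apply/funext => w; rewrite addrA subrK.
apply: (le_trans (msqD _ _)); [exact: measurable_funB..|].
rewrite (_ : (2 * a + 2 * b)%:E = (2%:E * a%:E + 2%:E * b%:E)%E)//.
by rewrite leeD// lee_pmul2l.
Qed.

Lemma msq_mean (m : nat) (X : nat -> T -> R) (e : \bar R) : (0 < m)%N ->
  (forall c, measurable_fun setT (X c)) ->
  (forall c, (c < m)%N -> (msq (X c) <= e)%E) ->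
  (msq (fun w => (\sum_(c < m) X c w) / m%:R)%R <= e)%E.
Proof.
move=> m0 mX Xe.
have mr : 0 < m%:R :> R by rewrite ltr0n.
apply: (@le_trans _ _ (\int[P]_w (m%:R^-1%:E * \sum_(c < m) (X c w ^+ 2)%:E))%E).
  apply: le_integral_nonneg => w; first by rewrite lee_fin sqr_ge0.
  rewrite sumEFin -EFinM lee_fin.
  set M := (\sum_(c < m) X c w) / m%:R.
  (* The empirical variance around the mean M is nonnegative: the square of the mean is at most the
     mean of the squares. *)
  have : 0 <= \sum_(c < m) (X c w - M) ^+ 2 by apply: sumr_ge0 => c _; rewrite sqr_ge0.
  have -> : \sum_(c < m) (X c w - M) ^+ 2 =
      \sum_(c < m) X c w ^+ 2 - 2 * M * (\sum_(c < m) X c w) + m%:R * M ^+ 2.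
    rewrite (eq_bigr (fun c : 'I_m => X c w ^+ 2 - 2 * M * X c w + M ^+ 2)).
      by rewrite big_split /= sumrB -mulr_sumr sumr_const card_ord -[_ *+ m]mulr_natl.
    by move=> c _; ring.
  have -> : \sum_(c < m) X c w = m%:R * M by rewrite /M mulrC divfK// gt_eqF.
  rewrite ler_pdivlMl//; lra.
rewrite ge0_integralZl//.
- rewrite ge0_integral_sum//; last 2 first.
  - by move=> c; exact: measurable_sqr.
  - by move=> c w _; rewrite lee_fin sqr_ge0.
  rewrite lee_pdivrMl//.
  apply: (@le_trans _ _ (\sum_(c < m) e)%E); first by apply: lee_sum => c _; exact: Xe.
  by rewrite sumr_const card_ord mule_natl.
- by apply: emeasurable_sum => c; exact: measurable_sqr.
- by move=> w _; apply: sume_ge0 => c _; rewrite lee_fin sqr_ge0.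
Qed.

Lemma msq_fatou (X : nat -> T -> R) Y (e : \bar R) N :
  (forall n, measurable_fun setT (X n)) -> measurable_fun setT Y ->
  {ae P, forall w, (X n w @[n --> \oo]) --> Y w} ->
  (forall n, (N <= n)%N -> (msq (X n) <= e)%E) -> (msq Y <= e)%E.
Proof.
move=> mX mY XY Xe.
pose f n w := (X n w ^+ 2)%:E.
have mf n : measurable_fun setT (f n) by exact: measurable_sqr.
have f0 n w : setT w -> (0 <= f n w)%E by rewrite lee_fin sqr_ge0.
have mlim : measurable_fun setT (fun w => limn_einf (f ^~ w)).
  rewrite (_ : (fun _ => _) = (fun w => - limn_esup (fun n => - f n w))%E).
    by apply: measurableT_comp => //; apply: measurable_fun_limn_esup => n;
       apply: measurableT_comp.
  by apply/funext => w; have := limn_esupN (f ^~ w); rewrite /comp => ->; rewrite oppeK.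
have lim0 w : (0 <= limn_einf (f ^~ w))%E.
  rewrite limn_einf_lim; apply: lime_ge; first exact: is_cvg_einfs.
  by near=> n; apply: le_ereal_inf_tmp => _ [k /= _ <-]; exact: f0.
apply: (@le_trans _ _ (\int[P]_w limn_einf (f ^~ w))%E).
  apply: ae_ge0_le_integral => //.
  - by move=> w _; rewrite lee_fin sqr_ge0.
  - exact: measurable_sqr.
  - apply: filterS XY => w XYw _.
    have [|-> _] := @cvg_limn_einf_sup _ (f ^~ w) (Y w ^+ 2)%:E; last by [].
    apply: cvg_EFin; first exact: nearW.
    by rewrite expr2; under eq_fun do rewrite /f /= expr2; exact: cvgM.
apply: (le_trans (fatou P measurableT mf f0)).
rewrite limn_einf_lim; apply: lime_le; first exact: is_cvg_einfs.
near=> n; apply: ereal_inf_le.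
exists (msq (X (maxn n N))); last by apply: Xe; exact: leq_maxr.
by exists (maxn n N) => //=; exact: leq_maxl.
Unshelve. all: by end_near. Qed.

Lemma geometric_nneseries_le (C s : R) : 0 <= C -> 0 < s -> s < 1 ->
  (\sum_(k <oo) (C * s ^+ k)%:E <= (C * (1 - s)^-1)%:E)%E.
Proof.
move=> C0 s0 s1.
apply: lime_le; first by apply: is_cvg_nneseries => n _ _;
  rewrite lee_fin mulr_ge0// exprn_ge0// ltW.
apply: nearW => n; rewrite sumEFin lee_fin.
apply: (@geometric_le_lim _ n C s C0 s0).
by rewrite ger0_norm// ltW.
Qed.

(** The series of s^-n D_n^2 has finite expectation, hence is almost surely finite. Since |D_n| <=
    s^-n D_n^2 + s^n, the increments D_n are then absolutely summable. *)
Lemma ae_cvg_of_msq (X : nat -> T -> R) (C s : R) :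
  0 <= C -> 0 < s -> s < 1 -> (forall n, measurable_fun setT (X n)) ->
  (forall n, (msq (fun w => X n.+1 w - X n w)%R <= (C * s ^+ n * s ^+ n)%:E)%E) ->
  {ae P, forall w, cvgn (X ^~ w)}.
Proof.
move=> C0 s0 s1 mX Xe.
pose D n w := X n.+1 w - X n w.
pose f n w := (s ^- n * D n w ^+ 2)%:E.
have sn n : 0 < s ^+ n by rewrite exprn_gt0.
have mD n : measurable_fun setT (D n) by exact: measurable_funB.
have mf n : measurable_fun setT (f n).
  by apply/measurable_EFinP; apply: measurable_funM => //; exact: measurable_funX.
have f0 n w : (0 <= f n w)%E.
  by rewrite lee_fin mulr_ge0 ?sqr_ge0// invr_ge0 ltW.
have If : (\int[P]_w (\sum_(n <oo) f n w) < +oo)%E.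
  rewrite integral_nneseries//.
  apply: (@le_lt_trans _ _ (\sum_(n <oo) (C * s ^+ n)%:E)%E); last first.
    exact: le_lt_trans (geometric_nneseries_le C0 s0 s1) (ltry _).
  apply: lee_nneseries => n; first by move=> *; apply: integral_ge0.
  move=> _.
  rewrite /f; under eq_integral do rewrite EFinM.
  rewrite ge0_integralZl//.
  - rewrite lee_pdivrMl// -EFinM; apply: (le_trans (Xe n)).
    by rewrite lee_fin le_eqVlt; apply/orP; left; apply/eqP; ring.
  - exact: measurable_sqr.
  - by move=> w _; rewrite lee_fin sqr_ge0.
  - by rewrite lee_fin invr_ge0 ltW.
have mS : measurable_fun setT (fun w => \sum_(n <oo) f n w)%E.
  exact: ge0_emeasurable_sum.
have S0 w : (0 <= \sum_(n <oo) f n w)%E by apply: nneseries_ge0.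
have iS : P.-integrable setT (fun w => \sum_(n <oo) f n w)%E.
  by apply/integrableP; split => //; under eq_integral do rewrite gee0_abs//.
have := integrable_ae measurableT iS.
apply: filterS => w /(_ Logic.I); rewrite ge0_fin_numE// => Sw.
have cf : cvgn (series (fun n => s ^- n * D n w ^+ 2)).
  apply: nnseries_is_cvg => // n.
  by have := f0 n w; rewrite lee_fin.
have cD : cvgn [normed series (D ^~ w)].
  apply: (@series_le_cvg _ _ (fun n => s ^- n * D n w ^+ 2 + geometric 1 s n)).
  - by move=> n; rewrite normr_ge0.
  - move=> n; have := f0 n w; rewrite lee_fin => fn0.
    by rewrite addr_ge0//= mulr_ge0// exprn_ge0// ltW.
  - move=> n /=; rewrite mul1r.
    rewrite -[D n w ^+ 2]real_normK ?num_real//.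
    rewrite -(ler_pM2l (sn n)) mulrDr mulrA mulfV ?gt_eqF// mul1r.
    have := sqr_ge0 (`|D n w| - s ^+ n); have := normr_ge0 (D n w); have := sn n.
    nra.
  - apply: is_cvg_seriesD => //; apply: is_cvg_geometric_series.
    by rewrite ger0_norm// ltW.
have cS := normed_cvg cD.
have -> : X ^~ w = (fun n => X 0%N w + series (D ^~ w) n).
  by apply/funext => n; rewrite {1}(eq_sum_telescope (X ^~ w) n).
by apply: is_cvgD => //; exact: is_cvg_cst.
Qed.

End SecondMoment.

Section L2Norm.
Context (R : realType) (d : measure_display) (T : measurableType d).
Context (P : probability T R).
Implicit Types X : T -> R.

Lemma Lnorm2E X : ('N[P]_2%:E[EFin \o X] = msq P X `^ 2^-1)%E.
Proof.
rewrite unlock /msq; congr (_ `^ _)%E; apply: eq_integral => w _ /=.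
by rewrite powR_mulrn// real_normK// num_real.
Qed.

Lemma Lfun2P X : X \in Lfun P 2%:E <->
  measurable_fun setT X /\ (msq P X < +oo)%E.
Proof.
split=> [|[mX fX]].
  rewrite inE => /andP[]; rewrite inE /= => mX; rewrite inE /= /finite_norm.
  by rewrite Lnorm2E => /lty_poweRy lX; split=> //; apply: lX; rewrite invr_eq0 pnatr_eq0.
rewrite inE; apply/andP; split; rewrite inE //= /finite_norm Lnorm2E.
exact: poweR_lty.
Qed.

(** Trades the norm, a root of an integral in the extended reals, for real bounds on [msq]. *)
Lemma Lnorm2_cvg0 (I : Type) (F : set_system I) (X : I -> T -> R) :
  Filter F ->
  (('N[P]_2%:E[EFin \o X i])%E @[i --> F] --> 0%E) <->
  (forall e : R, 0 < e -> \forall i \near F, (msq P (X i) <= e%:E)%E).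
Proof.
move=> FF; split.
  move=> /fine_cvgP[hfin /cvgrPdist_le h] e e0.
  have : \forall i \near F, ('N[P]_2%:E[EFin \o X i] <= (Num.sqrt e)%:E)%E.
    have se : 0 < Num.sqrt e by rewrite sqrtr_gt0.
    apply: filterS2 hfin (h _ se) => i fi /=.
    by rewrite sub0r normrN ger0_norm ?fine_ge0 ?Lnorm_ge0// -lee_fin fineK.
  apply: filterS => i; rewrite Lnorm2E => hi.
  rewrite -[msq _ _]poweRe1 ?msq_ge0// -[1%R](@mulVf _ 2%R) ?pnatr_eq0//.
  rewrite poweRrM.
  apply: (@le_trans _ _ ((Num.sqrt e)%:E `^ 2)%E).
    by apply: gt0_ler_poweR; rewrite // in_itv /= ?leey ?poweR_ge0// lee_fin sqrtr_ge0.
  by rewrite poweR_EFin powR_mulrn ?sqrtr_ge0// sqr_sqrtr// ltW.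
move=> h; apply/fine_cvgP; split.
  apply: filterS (h 1 ltr01) => i hi; rewrite Lnorm2E ge0_fin_numE ?poweR_ge0//.
  by apply: poweR_lty; exact: le_lt_trans hi (ltry _).
apply/cvgrPdist_le => e e0.
have e20 : 0 < e ^+ 2 by rewrite exprn_gt0.
apply: filterS (h _ e20) => i hi /=.
rewrite sub0r normrN Lnorm2E ger0_norm ?fine_ge0 ?poweR_ge0//.
have fi : (msq P (X i) `^ 2^-1 \is a fin_num)%E.
  rewrite ge0_fin_numE ?poweR_ge0//.
  by apply: poweR_lty; exact: le_lt_trans hi (ltry _).
rewrite -lee_fin fineK//.
apply: (@le_trans _ _ ((e ^+ 2)%:E `^ 2^-1)%E).
  by apply: gt0_ler_poweR; rewrite // in_itv /= ?leey ?msq_ge0// lee_fin ltW.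
by rewrite poweR_EFin powR12_sqrt ?sqr_ge0// sqrtr_sqr gtr0_norm.
Qed.

End L2Norm.

(** * Finite linear combinations of the field *)

Section BilinearForm.
Context (R : realType) (T : Type).
Implicit Types (K : T -> T -> R) (l m : seq (R * T)).

(** A list of pairs (coefficient, point) stands for a formal linear combination of points; K extends
    to a bilinear form on these. *)
Definition bil K l m : R := \sum_(a <- l) \sum_(b <- m) a.1 * b.1 * K a.2 b.2.

Lemma bil_catl K l1 l2 m : bil K (l1 ++ l2) m = bil K l1 m + bil K l2 m.
Proof. by rewrite /bil big_cat. Qed.

Lemma bil_catr K l m1 m2 : bil K l (m1 ++ m2) = bil K l m1 + bil K l m2.
Proof. by rewrite /bil -big_split; apply: eq_bigr => a _; rewrite big_cat. Qed.

Lemma bil_flattenl K (ls : seq (seq (R * T))) m :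
  bil K (flatten ls) m = \sum_(l <- ls) bil K l m.
Proof.
elim: ls => [|l ls IH] /=; first by rewrite /bil !big_nil.
by rewrite bil_catl IH big_cons.
Qed.

Lemma bil_flattenr K l (ms : seq (seq (R * T))) :
  bil K l (flatten ms) = \sum_(m <- ms) bil K l m.
Proof.
elim: ms => [|m ms IH] /=.
  by rewrite /bil big_nil big1// => a _; rewrite big_nil.
by rewrite bil_catr IH big_cons.
Qed.

Definition opp_comb l := [seq (- a.1, a.2) | a <- l].

Lemma bil_oppl K l m : bil K (opp_comb l) m = - bil K l m.
Proof.
rewrite /bil big_map -sumrN; apply: eq_bigr => a _.
by rewrite -sumrN; apply: eq_bigr => b _ /=; rewrite !mulNr.
Qed.

Lemma bil_oppr K l m : bil K l (opp_comb m) = - bil K l m.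
Proof.
rewrite /bil -sumrN; apply: eq_bigr => a _.
by rewrite big_map -sumrN; apply: eq_bigr => b _ /=; rewrite mulrN mulNr.
Qed.

Lemma bilC K l m : (forall x y, K x y = K y x) -> bil K l m = bil K m l.
Proof.
move=> KC; rewrite /bil exchange_big; apply: eq_bigr => a _.
by apply: eq_bigr => b _; rewrite KC [_.1 * _]mulrC.
Qed.

Lemma bil_ge0 K l : covariance_function K -> 0 <= bil K l l.
Proof.
move=> [_ K0].
rewrite /bil big_tnth; under eq_bigr do rewrite big_tnth.
exact: (K0 _ (fun j => (tnth (in_tuple l) j).2) (fun j => (tnth (in_tuple l) j).1)).
Qed.

Lemma bil_distE K l m : covariance_function K ->
  bil K l l + bil K m m - 2 * bil K l m =
  bil K (l ++ opp_comb m) (l ++ opp_comb m).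
Proof.
move=> [KC _].
rewrite bil_catl !bil_catr !bil_oppl !bil_oppr (bilC m l KC); ring.
Qed.

Lemma bil_dist_ge0 K l m : covariance_function K ->
  0 <= bil K l l + bil K m m - 2 * bil K l m.
Proof. by move=> KK; rewrite bil_distE//; exact: bil_ge0. Qed.

(** Positivity of the form at l + m, just as [bil_dist_ge0] is positivity at l - m. *)
Lemma bil_dist_le K l m : covariance_function K ->
  bil K l l + bil K m m - 2 * bil K l m <= 2 * (bil K l l + bil K m m).
Proof.
move=> KK; have := bil_ge0 (l ++ m) KK; case: KK => KC _.
rewrite bil_catl !bil_catr (bilC m l KC); lra.
Qed.

End BilinearForm.

Section GaussianField.
Context (R : realType) (dO : measure_display) (Omega : measurableType dO).
Context (P : probability Omega R) (d : nat) (H : R).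
Context (Q : 'rV[R]_d -> 'rV[R]_d -> R) (W : R -> 'rV[R]_d -> {RV P >-> R}).
Hypothesis HW : gaussian_field H Q W.
Local Notation V := 'rV[R]_d.
Implicit Types (l : seq (R * (R * V))) (F G : seq (R * V)).

Definition comb l (w : Omega) : R := \sum_(z <- l) z.1 * W z.2.1 z.2.2 w.

Definition field_cov (z z' : R * V) : R := fbm_cov H z.1 z'.1 * Q z.2 z'.2.

Lemma measurable_comb l : measurable_fun setT (comb l).
Proof. by apply: measurable_sum => z; exact: measurable_funM. Qed.

HB.instance Definition _ l :=
  isMeasurableFun.Build _ _ _ _ (comb l) (measurable_comb l).

Lemma Lfun2_field t x : (W t x : Omega -> R) \in Lfun P 2%:E.
Proof.
apply/Lfun2P; split; first exact: measurable_funPT.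
have := gf_cov HW t t x x; rewrite unlock => E.
by rewrite /msq; under eq_integral do rewrite expr2; rewrite E ltry.
Qed.

Lemma integral_prob_cst (c : R) : (\int[P]_w c%:E = c%:E)%E.
Proof. by have := expectation_cst P c; rewrite unlock. Qed.

Lemma msq_comb l : msq P (comb l) = (bil field_cov l l)%:E.
Proof.
have int_prod (c : R) z z' : P.-integrable setT
    (fun w => (c * (W z.1 z.2 w * W z'.1 z'.2 w))%:E).
  under eq_fun do rewrite EFinM.
  apply: integrableZl => //.
  apply: (proj1 (Lfun1_integrable P (fun w => W z.1 z.2 w * W z'.1 z'.2 w))).
  by apply: Lfun2_mul_Lfun1; exact: Lfun2_field.
transitivity (\int[P]_w (\sum_(a <- l) \sum_(b <- l)
    (a.1 * b.1 * (W a.2.1 a.2.2 w * W b.2.1 b.2.2 w))%:E))%E.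
  apply: eq_integral => w _.
  under eq_bigr do rewrite sumEFin.
  rewrite sumEFin expr2 /comb big_distrlr /=; congr EFin.
  apply: eq_bigr => a _; apply: eq_bigr => b _; ring.
rewrite integral_sum//; last first.
  by move=> a; apply: integrable_sum => // b _; exact: int_prod.
rewrite /bil -sumEFin; apply: eq_bigr => a _.
rewrite integral_sum//.
rewrite -sumEFin; apply: eq_bigr => b _.
under eq_integral do rewrite EFinM.
rewrite integralZl//; last first.
  by have := int_prod 1 a.2 b.2; under eq_fun do rewrite mul1r.
rewrite [RHS]EFinM; congr (_ * _)%E.
by have := gf_cov HW a.2.1 b.2.1 a.2.2 b.2.2; rewrite unlock.
Qed.

(** The kernel is a product of two covariances; reading the form as a second moment replaces the
    Schur product theorem. *)
Lemma bil_field_cov_ge0 l : 0 <= bil field_cov l l.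
Proof. by rewrite -lee_fin -msq_comb msq_ge0. Qed.

Lemma integrable_comb l : P.-integrable setT (EFin \o comb l).
Proof.
apply: (proj1 (Lfun1_integrable P (comb l))).
apply: Lfun_subset12; first by rewrite fin_num_measure.
by apply/Lfun2P; rewrite msq_comb ltry; split => //; exact: measurable_comb.
Qed.

Lemma mean_comb l : (\int[P]_w (comb l w)%:E = 0)%E.
Proof.
have i1 z : P.-integrable setT (fun w => (W z.1 z.2 w)%:E).
  have := integrable_comb [:: (1, z)].
  by apply: eq_integrable => // w _; rewrite /comb /= big_seq1 mul1r.
transitivity (\int[P]_w (\sum_(a <- l) a.1%:E * (W a.2.1 a.2.2 w)%:E))%E.
  by apply: eq_integral => w _; rewrite /comb -sumEFin.
rewrite integral_sum//; last by move=> a; exact: integrableZl.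
rewrite big1// => a _; rewrite integralZl//.
by have := gf_centered HW a.2.1 a.2.2; rewrite unlock => ->; rewrite mule0.
Qed.

Lemma comb_normal l : exists m s, normal_rv P m s (comb l).
Proof.
have [m [s ms]] := gf_gaussian HW (fun j => (tnth (in_tuple l) j).2)
  (fun j => (tnth (in_tuple l) j).1).
by exists m, s; move: ms; rewrite /comb; under [in X in _ -> X]eq_fun do rewrite big_tnth.
Qed.

(** For y >= 0 the bounds exp(y / 2) >= 1 + y / 2 and exp(- y) >= 1 - y suffice. The factor 4 lost
    against the Taylor coefficient is the one in the lower bound of [comb_law]. *)
Lemma cosh_ge (y : R) : 2 + y ^+ 2 / 4 <= expR y + expR (- y).
Proof.
wlog y0 : y / 0 <= y.
  move=> h; have [/h//|/ltW yn] := leP 0 y.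
  have := h (- y); rewrite oppr_ge0 sqrrN opprK [_ + expR y]addrC; exact.
have e1 : (1 + y / 2) ^+ 2 <= expR y.
  have -> : expR y = expR (y / 2) ^+ 2.
    by rewrite expr2 -expRD; congr expR; field.
  rewrite lerXn2r ?nnegrE ?expR_ge0 ?addr_ge0 ?divr_ge0//.
  exact: expR_ge1Dx.
have e2 := expR_ge1Dx (- y).
apply: le_trans (lerD e1 e2); rewrite le_eqVlt; apply/orP; left; apply/eqP.
by field.
Qed.

(* The process is known to be Gaussian only through unspecified parameters.  The weak
   anti-concentration bound [normal_rv_sqr_ge] and a second-order expansion of the moment
   generating function tie them to the covariance up to constants, which is enough. *)
Lemma comb_law l : exists2 s2 : R, bil field_cov l l / 4 <= s2 <= 8 * bil field_cov l l &
  forall c : R, (\int[P]_w (expR (c * comb l w))%:E = (expR (c ^+ 2 * s2 / 2))%:E)%E.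
Proof.
have [m [s nl]] := comb_normal l; set v := bil _ _ _.
have v0 : 0 <= v by exact: bil_field_cov_ge0.
have mgf c := @normal_rv_mgf _ _ _ _ _ _ (comb l) c nl.
have mexp c : measurable_fun setT (fun w => (expR (c * comb l w))%:E).
  apply/measurable_EFinP; apply: measurableT_comp => //.
  by apply: measurable_funM => //; exact: measurable_comb.
have iexp c : P.-integrable setT (fun w => (expR (c * comb l w))%:E).
  apply/integrableP; split => //.
  under eq_integral do rewrite gee0_abs ?lee_fin ?expR_ge0//.
  by rewrite mgf ltry.
have i1 : P.-integrable setT (cst 1%E : Omega -> \bar R).
  exact: finite_measure_integrable_cst.
(* As the mean of the combination vanishes, exp z >= 1 + z gives E exp(c X) >= 1 for all real c, so
   c m + c^2 s^2 / 2 >= 0; the choice c = - m / (s^2 + 1) then forces m = 0. *)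
have m0 : m = 0.
  have h c : 0 <= c * m + c ^+ 2 * s ^+ 2 / 2.
    rewrite -ler_expR expR0 -lee_fin -mgf.
    apply: (@le_trans _ _ (\int[P]_w (1 + (c * comb l w)%:E))%E).
      rewrite integralD//; last first.
        by under eq_fun do rewrite EFinM; apply: integrableZl => //; exact: integrable_comb.
      under [X in (_ + X)%E]eq_integral do rewrite EFinM.
      rewrite integralZl//; last exact: integrable_comb.
      by rewrite mean_comb mule0 adde0 integral_prob_cst.
    apply: le_integral => //.
    - apply: integrableD => //.
      by under eq_fun do rewrite EFinM; apply: integrableZl => //; exact: integrable_comb.
    - by move=> w _; rewrite -EFinD lee_fin; exact: expR_ge1Dx.
  have := h (- m / (s ^+ 2 + 1)).
  set t := s ^+ 2; have t0 : 0 <= t by exact: sqr_ge0.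
  have t1 : 0 < t + 1 by rewrite ltr_wpDl.
  have -> : - m / (t + 1) * m + (- m / (t + 1)) ^+ 2 * t / 2 =
      - (m ^+ 2 * ((t + 2) / (2 * (t + 1) ^+ 2))).
    by field; rewrite gt_eqF.
  rewrite oppr_ge0 pmulr_lle0; last by rewrite divr_gt0 ?mulr_gt0 ?exprn_gt0// ltr_wpDl.
  by move=> h2; apply/eqP; rewrite -sqrf_eq0 eq_le h2 sqr_ge0.
exists (s ^+ 2); last first.
  by move=> c; rewrite mgf m0 mulr0 add0r.
apply/andP; split; last first.
  have := normal_rv_sqr_ge (X := comb l) nl.
  rewrite -/(msq P (comb l)) msq_comb lee_fin -/v; lra.
have m2 : P.-integrable setT (fun w => (comb l w ^+ 2)%:E).
  apply/integrableP; split; first exact: measurable_sqr (measurable_comb l).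
  under eq_integral do rewrite gee0_abs ?lee_fin ?sqr_ge0//.
  by rewrite -/(msq P (comb l)) msq_comb ltry.
(* Sum of the moment generating functions at c and - c, with u = c^2. To first order in u it says v
   / 4 <= s^2. *)
have h u : 0 <= u -> 2 + u * v / 4 <= 2 * expR (u * s ^+ 2 / 2).
  move=> u0; pose c := Num.sqrt u.
  have c2 : c ^+ 2 = u by rewrite sqr_sqrtr.
  rewrite -lee_fin.
  apply: (@le_trans _ _ (\int[P]_w (2%:E + (u / 4)%:E * (comb l w ^+ 2)%:E))%E).
    rewrite integralD//.
    - rewrite integralZl// -/(msq P (comb l)) msq_comb integral_prob_cst.
      by rewrite -EFinM -EFinD lee_fin -/v mulrAC.
    - exact: finite_measure_integrable_cst.
    - exact: integrableZl.
  apply: (@le_trans _ _ (\int[P]_w ((expR (c * comb l w))%:E +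
      (expR ((- c) * comb l w))%:E))%E).
    apply: le_integral => //.
    - apply: integrableD => //; first exact: finite_measure_integrable_cst.
      exact: integrableZl.
    - exact: integrableD.
    - move=> w _; rewrite -EFinM -!EFinD lee_fin mulNr.
      by have := cosh_ge (c * comb l w); rewrite exprMn c2 mulrAC.
  rewrite integralD// !mgf m0 !mulr0 !add0r sqrrN c2 -EFinD lee_fin; lra.
rewrite leNgt; apply/negP => vs.
set t := s ^+ 2 in h vs; have t0 : 0 <= t by exact: sqr_ge0.
have vt : 0 < v / 4 - t by rewrite subr_gt0.
(* If v / 4 > t, the value u = (v / 4 - t) / D is small enough for the second-order term to be
   harmless: the inequality h leads to D <= t v / 8, against the choice of D. *)
pose D := v * t + v + 1.
have D0 : 0 < D by rewrite ltr_wpDl// addr_ge0// mulr_ge0.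
pose u := (v / 4 - t) / D.
have u0 : 0 < u by rewrite divr_gt0.
have uD : u * D = v / 4 - t by rewrite /u divfK// gt_eqF.
have ut : u * t / 2 < 1.
  have : u * t < 1 by rewrite -(ltr_pM2r D0) mulrAC uD mul1r /D; nra.
  lra.
have e1 : (1 - u * t / 2) * expR (u * t / 2) <= 1.
  have := expR_ge1Dx (- (u * t / 2)).
  rewrite -(ler_pM2r (expR_gt0 (u * t / 2))) -expRD addNr expR0; apply.
have := h u (ltW u0).
have p1 : 0 < 1 - u * t / 2 by rewrite subr_gt0.
rewrite -(ler_pM2l p1) => h3.
have h4 : (1 - u * t / 2) * (2 + u * v / 4) <= 2 by apply: (le_trans h3); lra.
have h5 : u * (v / 4 - t) <= u * (u * t * v / 8) by nra.
rewrite ler_pM2l// in h5.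
have : u * D <= u * (t * v / 8) by rewrite uD; lra.
rewrite ler_pM2l// /D; nra.
Qed.

Lemma comb_exp_ge l : ((expR (bil field_cov l l / 8))%:E <=
  \int[P]_w (expR (comb l w))%:E)%E.
Proof.
have [s2 /andP[s2l _] mgf] := comb_law l.
under eq_integral do rewrite -[comb l _]mul1r.
by rewrite mgf lee_fin ler_expR expr1n mul1r; lra.
Qed.

Lemma comb_exp2_le l : (\int[P]_w (expR (2 * comb l w))%:E <=
  (expR (16 * bil field_cov l l))%:E)%E.
Proof.
have [s2 /andP[_ s2l] mgf] := comb_law l.
by rewrite mgf lee_fin ler_expR; lra.
Qed.

Definition incr_comb (a b : R) F : seq (R * (R * V)) :=
  [seq (f.1, (b, f.2)) | f <- F] ++ [seq (- f.1, (a, f.2)) | f <- F].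

Lemma comb_cat l l' w : comb (l ++ l') w = comb l w + comb l' w.
Proof. by rewrite /comb big_cat. Qed.

Lemma comb_flatten (ls : seq (seq (R * (R * V)))) w :
  comb (flatten ls) w = \sum_(l <- ls) comb l w.
Proof.
elim: ls => [|l ls IH] /=; first by rewrite /comb !big_nil.
by rewrite comb_cat IH big_cons.
Qed.

Lemma comb_incr a b F w :
  comb (incr_comb a b F) w = \sum_(f <- F) f.1 * (W b f.2 w - W a f.2 w).
Proof.
rewrite comb_cat /comb !big_map -big_split; apply: eq_bigr => f _ /=.
by rewrite mulNr mulrBr.
Qed.

(** The product form of the covariance splits off the time increments. This supplies the r_ij
    ([fbm_incr]) and the q_ij ([bil Q]) of [quad_split]. *)
Lemma bil_incr a b a' b' F G :
  bil field_cov (incr_comb a b F) (incr_comb a' b' G) =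
  fbm_incr H a b a' b' * bil Q F G.
Proof.
rewrite bil_catl !bil_catr /bil !big_map.
rewrite mulr_sumr -!big_split; apply: eq_bigr => f _ /=.
rewrite mulr_sumr !big_map -!big_split; apply: eq_bigr => g _ /=.
by rewrite /field_cov /fbm_incr /=; ring.
Qed.

Section Steps.
Context (I : finType) (a b : I -> R) (F : I -> seq (R * V)).

Definition steps := flatten [seq incr_comb (a i) (b i) (F i) | i <- index_enum I].

Lemma comb_steps w : comb steps w =
  \sum_i \sum_(f <- F i) f.1 * (W (b i) f.2 w - W (a i) f.2 w).
Proof.
rewrite comb_flatten big_map; apply: eq_bigr => i _; exact: comb_incr.
Qed.

Lemma bil_steps : bil field_cov steps steps =
  \sum_i \sum_j fbm_incr H (a i) (b i) (a j) (b j) * bil Q (F i) (F j).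
Proof.
rewrite bil_flattenl big_map; apply: eq_bigr => i _.
rewrite bil_flattenr big_map; apply: eq_bigr => j _; exact: bil_incr.
Qed.

End Steps.

End GaussianField.

(** * Sums of increments of the field over partitions *)

Section Partitions.
Context (R : realType) (dO : measure_display) (Omega : measurableType dO).
Context (P : probability Omega R) (d : nat) (H : R).
Context (Q : 'rV[R]_d -> 'rV[R]_d -> R) (W : R -> 'rV[R]_d -> {RV P >-> R}).
Hypotheses (H0 : 0 < H) (H1 : H < 1 / 2).
Hypotheses (HQ : covariance_function Q) (HW : gaussian_field H Q W).
Local Notation V := 'rV[R]_d.
Implicit Types (p q : nat -> R) (y z : nat -> V).

Definition cov_dist (x x' : V) : R := Q x x + Q x' x' - 2 * Q x x'.

Definition psum (N : nat) p y (w : Omega) : R :=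
  \sum_(j < N) (W (p j.+1) (y j) w - W (p j) (y j) w).

Lemma measurable_psum N p y : measurable_fun setT (psum N p y).
Proof. by apply: measurable_sum => j; exact: measurable_funB. Qed.

Lemma nondecreasing_upto p m n : (forall j, p j <= p j.+1) -> (m <= n)%N ->
  p m <= p n.
Proof. by move=> pm mn; exact: (nondecreasing_seqP p).1. Qed.

Lemma fbm_incr_telescope p n a b : 
  \sum_(j < n) fbm_incr H a b (p j) (p j.+1) = fbm_incr H a b (p 0%N) (p n).
Proof.
pose w x := fbm_cov H b x - fbm_cov H a x.
have E c e : fbm_incr H a b c e = w e - w c by rewrite /fbm_incr /w; ring.
under eq_bigr do rewrite E.
by rewrite -(big_mkord xpredT (fun j => w (p j.+1) - w (p j))) telescope_sumr// E.
Qed.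

(** Each row has a nonnegative sum, so its off-diagonal mass is at most its diagonal entry: a double
    sum over cells costs only a single one. *)
Lemma fbm_incr_offdiag p n T : (forall j, p j <= p j.+1) -> p 0%N = 0 -> p n = T ->
  \sum_(j < n) \sum_(j' < n | j' != j)
     - fbm_incr H (p j) (p j.+1) (p j') (p j'.+1) <=
  \sum_(j < n) (p j.+1 - p j) `^ (2 * H).
Proof.
move=> pm p0 pn; apply: ler_sum => j _; rewrite sumrN.
have := fbm_incr_telescope p n (p j) (p j.+1).
rewrite (bigD1 j)//= fbm_incr_diag// p0 pn => e.
have : 0 <= fbm_incr H (p j) (p j.+1) 0 T.
  apply: fbm_incr_ge0 => //; first by rewrite -p0; exact: nondecreasing_upto.
  by rewrite -pn; exact: nondecreasing_upto.
lra.
Qed.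

(* Both sums are refined to the cells [p_j, p_{j+1}] /\ [q_l, q_{l+1}] of the common
   partition, indexed by all pairs (j, l): clipping makes the empty cells degenerate, and
   these contribute nothing. *)
Section Compare.
Variables (N N' : nat) (p q : nat -> R) (y z : nat -> V) (T G : R).
Hypotheses (pm : forall j, p j <= p j.+1) (qm : forall j, q j <= q j.+1).
Hypotheses (p0 : p 0%N = 0) (q0 : q 0%N = 0) (pN : p N = T) (qN : q N' = T).
Hypothesis (G0 : 0 <= G).
Hypothesis yz : forall j l, (j < N)%N -> (l < N')%N ->
  p j < q l.+1 -> q l < p j.+1 -> cov_dist (y j) (z l) <= G.

Local Notation I := ('I_N * 'I_N')%type.

Let lo (c : I) := clip (p c.1) (p c.1.+1) (q c.2).
Let hi (c : I) := clip (p c.1) (p c.1.+1) (q c.2.+1).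
Let F (c : I) : seq (R * V) := [:: (1, y c.1); (- 1, z c.2)].
Let r (c c' : I) := fbm_incr H (lo c) (hi c) (lo c') (hi c').

Let lohi c : lo c <= hi c. Proof. exact: clip_mono. Qed.

Let p_bnd j : (j < N)%N -> 0 <= p j /\ p j.+1 <= T.
Proof. by move=> jN; rewrite -{1}p0 -pN; split; exact: nondecreasing_upto. Qed.

Let q_bnd l : (l < N')%N -> 0 <= q l /\ q l.+1 <= T.
Proof. by move=> lN; rewrite -{1}q0 -qN; split; exact: nondecreasing_upto. Qed.

Let sum_l (w : R -> R) (j : 'I_N) :
  \sum_(l < N') (w (hi (j, l)) - w (lo (j, l))) = w (p j.+1) - w (p j).
Proof.
have [pj pj'] := p_bnd (ltn_ord j).
by rewrite -(sum_clip_inner w (q := q) (n := N') (pm j)) ?q0 ?qN.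
Qed.

Let sum_j (w : R -> R) (l : 'I_N') :
  \sum_(j < N) (w (hi (j, l)) - w (lo (j, l))) = w (q l.+1) - w (q l).
Proof.
have [ql ql'] := q_bnd (ltn_ord l).
by rewrite -(sum_clip_outer w (n := N) pm (x := q l)) ?p0 ?pN.
Qed.

Let cells w : psum N p y w - psum N' q z w = comb W (steps lo hi F) w.
Proof.
rewrite comb_steps /psum.
under [in RHS]eq_bigr do
  rewrite !big_cons big_nil /= addr0 mul1r mulN1r.
rewrite [in RHS]sumrB; congr (_ - _).
  rewrite -(pair_bigA _ (fun j l => W (hi (j, l)) (y j) w - W (lo (j, l)) (y j) w)).
  by apply: eq_bigr => j _; rewrite (sum_l (fun x => W x (y j) w)).
rewrite -(pair_bigA _ (fun j l => W (hi (j, l)) (z l) w - W (lo (j, l)) (z l) w)).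
rewrite exchange_big; apply: eq_bigr => l _.
by rewrite (sum_j (fun x => W x (z l) w)).
Qed.

Let rE a b c : fbm_incr H a b (lo c) (hi c) =
  (fbm_cov H b (hi c) - fbm_cov H a (hi c)) -
  (fbm_cov H b (lo c) - fbm_cov H a (lo c)).
Proof. by rewrite /fbm_incr; ring. Qed.

Let r_sum_l a b (j : 'I_N) :
  \sum_(l < N') fbm_incr H a b (lo (j, l)) (hi (j, l)) =
  fbm_incr H a b (p j) (p j.+1).
Proof.
under eq_bigr do rewrite rE.
by rewrite (sum_l (fun x => fbm_cov H b x - fbm_cov H a x)) /fbm_incr; ring.
Qed.

Let r_sum_j a b (l : 'I_N') :
  \sum_(j < N) fbm_incr H a b (lo (j, l)) (hi (j, l)) =
  fbm_incr H a b (q l) (q l.+1).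
Proof.
under eq_bigr do rewrite rE.
by rewrite (sum_j (fun x => fbm_cov H b x - fbm_cov H a x)) /fbm_incr; ring.
Qed.

Let r_row a b : \sum_c fbm_incr H a b (lo c) (hi c) = fbm_incr H a b 0 T.
Proof.
rewrite -(pair_bigA _ (fun j l => fbm_incr H a b (lo (j, l)) (hi (j, l)))) /=.
by under eq_bigr do rewrite r_sum_l; rewrite fbm_incr_telescope p0 pN.
Qed.

Let lo_ge0 c : 0 <= lo c.
Proof.
by have [h _] := p_bnd (ltn_ord c.1); apply: (le_trans h); exact: clip_ge.
Qed.

Let hi_leT c : hi c <= T.
Proof.
by have [_ h] := p_bnd (ltn_ord c.1); apply: (le_trans _ h); exact: clip_le.
Qed.

Let hi_lo (c c' : I) : (c.1 < c'.1)%N \/ (c.1 = c'.1 /\ (c.2 < c'.2)%N) -> hi c <= lo c'.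
Proof.
move=> [cc|[cc1 cc2]].
  apply: (@le_trans _ _ (p c.1.+1)); first exact: clip_le.
  by apply: (@le_trans _ _ (p c'.1)); [exact: nondecreasing_upto|exact: clip_ge].
by rewrite /hi /lo cc1; apply: clip_mono; exact: nondecreasing_upto.
Qed.

Let r_off c c' : c != c' -> r c c' <= 0.
Proof.
have sep (a b : I) : (a.1 < b.1)%N \/ (a.1 = b.1 /\ (a.2 < b.2)%N) -> r a b <= 0.
  by move=> /hi_lo ab; apply: fbm_incr_sep.
case: c c' => [j l] [j' l'] ne.
have [jj|jj|/val_inj jj] := ltngtP j j'.
- by apply: sep; left.
- by rewrite /r fbm_incrC; apply: sep; left.
- subst j'; have ll : l != l' by apply: contra ne => /eqP ->.
  have [ll'|ll'|/val_inj ll'] := ltngtP l l'.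
  + by apply: sep; right.
  + by rewrite /r fbm_incrC; apply: sep; right.
  + by rewrite ll' eqxx in ll.
Qed.

(** Summing over the second index of both cells merges the small cells back into those of p. *)
Let sum_off1 : \sum_c \sum_(c' | c'.1 != c.1) - r c c' =
  \sum_(j < N) \sum_(j' < N | j' != j) - fbm_incr H (p j) (p j.+1) (p j') (p j'.+1).
Proof.
rewrite -(pair_bigA _ (fun j l => \sum_(c' : I | c'.1 != j) - r (j, l) c')) /=.
apply: eq_bigr => j _.
transitivity (\sum_(l < N') \sum_(j' < N | j' != j) - fbm_incr H (p j') (p j'.+1) (lo (j, l)) (hi (j, l))).
  apply: eq_bigr => l _.
  rewrite (eq_bigl (fun c' : I => (c'.1 != j) && true)); last by move=> c; rewrite andbT.
  rewrite (eq_bigr (fun c' : I => - r (j, l) (c'.1, c'.2))); last by case.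
  rewrite -(pair_big (fun j' => j' != j) xpredT (fun j' l' => - r (j, l) (j', l'))) /=.
  apply: eq_bigr => j' _; rewrite sumrN /r; congr (- _).
  by rewrite r_sum_l fbm_incrC.
rewrite exchange_big /=; apply: eq_bigr => j' _; rewrite sumrN; congr (- _).
by rewrite r_sum_l fbm_incrC.
Qed.

Let sum_off2 : \sum_c \sum_(c' | c'.2 != c.2) - r c c' =
  \sum_(l < N') \sum_(l' < N' | l' != l) - fbm_incr H (q l) (q l.+1) (q l') (q l'.+1).
Proof.
rewrite -(pair_bigA _ (fun j l => \sum_(c' : I | c'.2 != l) - r (j, l) c')) /=.
rewrite exchange_big; apply: eq_bigr => l _.
transitivity (\sum_(j < N) \sum_(l' < N' | l' != l) - fbm_incr H (q l') (q l'.+1) (lo (j, l)) (hi (j, l))).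
  apply: eq_bigr => j _.
  rewrite (eq_bigr (fun c' : I => - r (j, l) (c'.1, c'.2))); last by case.
  rewrite -(pair_big xpredT (fun l' => l' != l) (fun j' l' => - r (j, l) (j', l'))) /=.
  rewrite exchange_big /=; apply: eq_bigr => l' _; rewrite sumrN /r; congr (- _).
  by rewrite r_sum_j fbm_incrC.
rewrite exchange_big /=; apply: eq_bigr => l' _; rewrite sumrN; congr (- _).
by rewrite r_sum_j fbm_incrC.
Qed.

(** Distinct cells differ in the first index or in the second, and each case is summed by coarsening
    to p or to q. As - r >= 0 off the diagonal, counting some pairs twice does no harm. *)
Let sum_off : \sum_c \sum_(c' | c' != c) - r c c' <=
  \sum_(j < N) (p j.+1 - p j) `^ (2 * H) + \sum_(l < N') (q l.+1 - q l) `^ (2 * H).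
Proof.
apply: (le_trans _ (lerD (fbm_incr_offdiag pm p0 pN) (fbm_incr_offdiag qm q0 qN))).
rewrite -sum_off1 -sum_off2 -big_split; apply: ler_sum => c _ /=.
rewrite [leLHS]big_mkcond [X in _ <= X + _]big_mkcond [X in _ <= _ + X]big_mkcond.
rewrite -big_split; apply: ler_sum => c' _ /=.
have [->|cc'] := eqVneq c' c; first by rewrite !eqxx addr0.
have r0 : 0 <= - r c c' by rewrite oppr_ge0 r_off// eq_sym.
have [c1|c1] := eqVneq c'.1 c.1; have [c2|c2] := eqVneq c'.2 c.2.
- by case/eqP: cc'; case: c' c c1 c2 {r0} => [? ?] [? ?] /= -> ->.
- by rewrite add0r.
- by rewrite addr0.
- by rewrite lerDl.
Qed.

Let bilF c : bil Q (F c) (F c) = cov_dist (y c.1) (z c.2).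
Proof.
by rewrite /bil !big_cons !big_nil /= /cov_dist (HQ.1 (z c.2) (y c.1)); ring.
Qed.

Lemma msq_psumB :
  (msq P (fun w => psum N p y w - psum N' q z w)%R <=
   (G * (T `^ (2 * H) + 2 * (\sum_(j < N) (p j.+1 - p j) `^ (2 * H)
                      + \sum_(l < N') (q l.+1 - q l) `^ (2 * H))))%:E)%E.
Proof.
have -> : (fun w => psum N p y w - psum N' q z w) = comb W (steps lo hi F).
  by apply/funext => w; exact: cells.
rewrite (msq_comb HW) bil_steps lee_fin.
have rho c : \sum_c' r c c' = fbm_incr H (lo c) (hi c) 0 T by exact: r_row.
apply: (le_trans (@quad_le _ _ r (fun c c' => bil Q (F c) (F c')) G _ _ _ _ _)).
- by move=> c c'; rewrite /r fbm_incrC.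
- exact: r_off.
- by move=> c; rewrite rho fbm_incr_ge0.
- by move=> c c'; exact: bil_dist_le.
- move=> c; rewrite bilF.
  (* The bound G is only known when the cells of p and q overlap; otherwise the clipped cell is a
     point and its row of r vanishes. *)
  have [pq|pq] := ltP (p c.1) (q c.2.+1); last first.
    right=> c'; have e : lo c = hi c.
      by rewrite /lo /hi !clip_lo// (le_trans _ pq).
    by rewrite /r e fbm_incr_null.
  have [qp|qp] := ltP (q c.2) (p c.1.+1); last first.
    right=> c'; have e : lo c = hi c.
      by rewrite /lo /hi !clip_hi// (le_trans qp).
    by rewrite /r e fbm_incr_null.
  by left; apply: yz.
have T0 : 0 <= T by rewrite -p0 -pN; exact: nondecreasing_upto.
have -> : \sum_c \sum_c' r c c' = T `^ (2 * H).
  under eq_bigr do rewrite rho fbm_incrC.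
  by rewrite r_row fbm_incr_diag// subr0.
by rewrite mulrDr lerD2l [leRHS]mulrCA -mulrA ler_pM2l// ler_wpM2l.
Qed.

End Compare.

(** Only the first n rows are kept. Their sums telescope to the fractional covariance of the times p
    n and T, (p_n^(2 H) + T^(2 H) - (T - p_n)^(2 H)) / 2, which is at least p_n^(2 H) / 2. *)
Lemma bil_steps_ge (N n : nat) p (F : 'I_N -> seq (R * V)) (g T : R) :
  (forall j, p j <= p j.+1) -> p 0%N = 0 -> p N = T -> (n <= N)%N -> 0 <= g ->
  (forall j : 'I_N, (j < n)%N -> g <= bil Q (F j) (F j)) ->
  g * (2^-1 * p n `^ (2 * H)) <=
  bil (field_cov H Q) (steps (fun j : 'I_N => p j) (fun j : 'I_N => p j.+1) F)
    (steps (fun j : 'I_N => p j) (fun j : 'I_N => p j.+1) F).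
Proof.
move=> pm p0 pN nN g0 gF; rewrite bil_steps.
pose r (j j' : 'I_N) := fbm_incr H (p j) (p j.+1) (p j') (p j'.+1).
have bnd (j : 'I_N) : 0 <= p j /\ p j.+1 <= T.
  by rewrite -{1}p0 -pN; split; exact: nondecreasing_upto.
have rho (j : 'I_N) : 0 <= fbm_incr H (p j) (p j.+1) 0 T.
  by have [? ?] := bnd j; apply: fbm_incr_ge0.
apply: (le_trans _ (@quad_ge _ _ r (fun j j' => bil Q (F j) (F j')) _ _ _)).
- under eq_bigr do rewrite /r fbm_incr_telescope p0 pN.
  apply: (@le_trans _ _ (\sum_(j < N | (j < n)%N) g * fbm_incr H (p j) (p j.+1) 0 T)).
    rewrite -mulr_sumr ler_wpM2l//.
    rewrite (eq_bigr (fun j : 'I_N => fbm_incr H 0 T (p j) (p j.+1))); last first.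
      by move=> j _; rewrite fbm_incrC.
    rewrite -(big_ord_widen _ (fun j => fbm_incr H 0 T (p j) (p j.+1)) nN).
    rewrite fbm_incr_telescope p0 fbm_incrE !subr0 !sub0r normrN normr0.
    have pn0 : 0 <= p n by rewrite -p0; exact: nondecreasing_upto.
    have pnT : p n <= T by rewrite -pN; exact: nondecreasing_upto.
    have T0 := le_trans pn0 pnT.
    have Tp : 0 <= T - p n by rewrite subr_ge0.
    have z0 : 0 `^ (2 * H) = 0 :> R by rewrite powR0// mulf_neq0// gt_eqF.
    rewrite z0 (ger0_norm pn0) (ger0_norm T0) (ger0_norm Tp).
    suff : (T - p n) `^ (2 * H) <= T `^ (2 * H) by lra.
    apply: ge0_ler_powR; rewrite ?nnegrE//; first by rewrite mulr_ge0// ltW.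
    by rewrite gerBl.
  rewrite big_mkcond; apply: ler_sum => j _; case: ifPn => jn.
    by rewrite ler_wpM2r// gF.
  by rewrite mulr_ge0// bil_ge0.
- by move=> j j'; rewrite /r fbm_incrC.
- have sep (j j' : 'I_N) : (j < j')%N -> r j j' <= 0.
    by move=> jj; apply: fbm_incr_sep => //; exact: nondecreasing_upto.
  move=> j j' ne; have [jj|jj|/val_inj jj] := ltngtP j j'; first exact: sep.
    by rewrite /r fbm_incrC; exact: sep.
  by rewrite jj eqxx in ne.
- by move=> j j'; exact: bil_dist_ge0.
Qed.

End Partitions.

(** * Riemann sums of continuous functions *)

Section RiemannSums.
Context (R : realType).
Local Notation mu := (@lebesgue_measure R).
Implicit Types (f : R -> R) (t e x : R).

Lemma continuous_unif_itv f t e : continuous f -> 0 < e ->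
  exists2 d : R, 0 < d &
    forall x y, 0 <= x <= t -> `|y - x| < d -> `|f y - f x| <= e.
Proof.
move=> cf e0.
pose P (d : R) x := forall y, `|y - x| < d -> `|f y - f x| <= e.
have /compact_near_coveringP K : compact (`[0, t]%classic : set R).
  exact: segment_compact.
have hP : \forall d \near (0 : R)^'+, (`[0, t]%classic : set R) `<=` P d.
  apply: K => x _.
  have e2 : 0 < e / 2 by rewrite divr_gt0.
  have /cvgrPdist_lt /(_ _ e2) /nbhs_ballP[r /= r0 hr] := cf x.
  have r2 : 0 < r / 2 by rewrite divr_gt0.
  exists (ball x (r / 2), [set d | 0 < d < r / 2]).
    split; first exact: nbhsx_ballx.
    by near=> d => /=; apply/andP; split; near: d;
      [exact: nbhs_right_gt|exact: nbhs_right_lt].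
  move=> [x' d] /= [xx' /andP[d0 dr]] y yx'.
  have hx' : `|f x - f x'| < e / 2.
    apply: hr => /=; apply: (lt_trans xx').
    by rewrite ltr_pdivrMr// mulr_natr mulr2n ltrDl.
  have hy : `|f x - f y| < e / 2.
    apply: hr; rewrite /ball /= -(subrKA x') (le_lt_trans (ler_normD _ _))//.
    rewrite (splitr r) ltrD// distrC; exact: lt_trans dr.
  rewrite -(subrKA (f x)) (le_trans (ler_normD _ _))// (splitr e).
  by rewrite lerD// ltW// distrC.
have : \forall d \near (0 : R)^'+, 0 < d /\ `[0, t]%classic `<=` P d.
  by near=> d; split; near: d; [exact: nbhs_right_gt|exact: hP].
move=> /filter_ex[d [d0 hd]]; exists d => // x y xt.
by apply: hd; rewrite /= in_itv.
Unshelve. all: by end_near. Qed.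

Lemma integrable_continuous_itv f (a b : R) : continuous f ->
  mu.-integrable `[a, b] (EFin \o f).
Proof.
move=> cf; apply: continuous_compact_integrable; first exact: segment_compact.
exact: continuous_subspaceT.
Qed.

Lemma riemann_cell f (a b e : R) : continuous f -> 0 <= a -> a <= b ->
  (forall x, a <= x <= b -> `|f x - f a| <= e) ->
  `|\int[mu]_(x in `[0, b]) f x - \int[mu]_(x in `[0, a]) f x - (b - a) * f a|
  <= (b - a) * e.
Proof.
move=> cf a0 ab fe.
rewrite Rintegral_itvB//; last by exact: integrable_continuous_itv.
have iab : mu.-integrable `]a, b] (EFin \o f).
  apply: (integrableS _ _ _ (integrable_continuous_itv a b cf)) => //.
  exact: subset_itv_oc_cc.
have lab : (mu `]a, b] = (b - a)%:E)%E.
  rewrite lebesgue_measure_itv /= lte_fin; case: ltP => // ba.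
  have -> : a = b by apply/le_anti; rewrite ab ba.
  by rewrite subrr.
have icst (c : R) : mu.-integrable `]a, b] (EFin \o cst c).
  apply: (integrableS _ _ _ (integrable_continuous_itv a b (@cst_continuous _ _ c))) => //.
  exact: subset_itv_oc_cc.
have cstE (c : R) : \int[mu]_(x in `]a, b]) (cst c x) = (b - a) * c.
  by rewrite Rintegral_cst//= lab /= mulrC.
rewrite -(cstE (f a)) -RintegralB//.
have iB : mu.-integrable `]a, b] (EFin \o (fun x => f x - f a)).
  have -> : EFin \o (fun x => f x - f a) = ((EFin \o f) \- (EFin \o cst (f a)))%E by [].
  by apply: integrableB => //; exact: icst.
apply: (le_trans (le_normr_Rintegral _ _)) => //.
rewrite -(cstE e); apply: le_Rintegral => //.
- exact: integrable_norm iB.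
- by move=> x /=; rewrite in_itv /= => /andP[ax xb]; apply: fe; rewrite (ltW ax).
Qed.

(** The step d need not divide t: the last node carries the full weight d although its cell is cut
    off at t. The number K merely has to be large enough for all nodes in [0, t] to be listed. *)
Lemma riemann_sum_cvg f t e : continuous f -> 0 < t -> 0 < e ->
  exists2 d0 : R, 0 < d0 & forall (d : R) (K : nat), 0 < d -> d < d0 ->
    t < K%:R * d ->
    `|\sum_(i < K | i%:R * d <= t) d * f (i%:R * d)
      - \int[mu]_(x in `[0, t]) f x| <= e.
Proof.
move=> cf t0 e0.
pose e' := e / (t + 2).
have t2 : 0 < t + 2 by rewrite addr_gt0.
have e'0 : 0 < e' by rewrite divr_gt0.
have [d1 d10 hd1] := @continuous_unif_itv f t e' cf e'0.
have [M M0 hM] : exists2 M : R, 0 < M & forall x, 0 <= x <= t -> `|f x| <= M.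
  have /compact_bounded[M [_ hM]] : compact (f @` `[0, t]%classic).
    apply: continuous_compact; last exact: segment_compact.
    exact: continuous_subspaceT.
  exists (`|M| + 1); first by rewrite ltr_wpDl.
  move=> x xt; apply: (hM (`|M| + 1)).
    by rewrite (le_lt_trans (ler_norm M))// ltrDl.
  by exists x => //=; rewrite in_itv.
(* [d1] is the modulus of continuity for e'; d < 1 keeps the error of the cut-off cell below e', and
   d M < e' bounds the excess weight of the last node. With t e' from the full cells the total is (t
   + 2) e' = e. *)
exists (Num.min (Num.min d1 1) (e' / M)).
  by rewrite !lt_min d10 ltr01 divr_gt0.
move=> d K d0; rewrite !lt_min => /andP[/andP[dd1 d1'] dM] tK.
pose n := Num.truncn (t / d).
have td0 : 0 <= t / d by rewrite divr_ge0// ltW.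
have /andP[nd nd'] := truncn_itv td0.
rewrite -/n ler_pdivlMr// in nd; rewrite -/n ltr_pdivrMr// in nd'.
have nK : (n < K)%N.
  by rewrite -(ltr_nat R) -(ltr_pM2r d0); apply: le_lt_trans tK.
have id (i : nat) : (i%:R * d <= t) = (i < n.+1)%N.
  apply/idP/idP => [h|].
    by rewrite -(ltr_nat R) -(ltr_pM2r d0); apply: le_lt_trans nd'.
  rewrite ltnS => h; apply: le_trans nd.
  by rewrite ler_pM2r// ler_nat.
under eq_bigl do rewrite id.
rewrite -(big_ord_widen _ (fun i : nat => d * f (i%:R * d)) nK).
pose F x := \int[mu]_(y in `[0, x]) f y.
have F0 : F 0 = 0.
  rewrite /F set_itv1 Rintegral_set1//.
rewrite big_ord_recr /= -/(F t).
have -> : F t = \sum_(i < n) (F (i.+1%:R * d) - F (i%:R * d)) + (F t - F (n%:R * d)).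
  rewrite -(big_mkord xpredT (fun i => F (i.+1%:R * d) - F (i%:R * d))).
  by rewrite telescope_sumr// mul0r F0 subr0 addrC subrK.
have pos (i : nat) : 0 <= i%:R * d by rewrite mulr_ge0// ltW.
rewrite opprD addrACA -sumrB.
apply: (le_trans (ler_normD _ _)).
have s1 : `|\sum_(i < n) (d * f (i%:R * d) - (F (i.+1%:R * d) - F (i%:R * d)))| <= t * e'.
  apply: (le_trans (ler_norm_sum _ _ _)).
  apply: (@le_trans _ _ (\sum_(i < n) d * e')); last first.
    rewrite sumr_const card_ord -[X in X <= _]mulr_natl mulrA ler_pM2r//.
  apply: ler_sum => i _; rewrite distrC.
  have := @riemann_cell f (i%:R * d) (i.+1%:R * d) e' cf (pos i).
  have -> : i.+1%:R * d - i%:R * d = d by rewrite -natr1 mulrDl mul1r addrAC subrr add0r.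
  apply; first by rewrite ler_pM2r// ler_nat.
  move=> x /andP[ix xi]; apply: hd1.
    rewrite pos /= (le_trans _ nd)// ler_pM2r// ler_nat; exact: ltnW.
  rewrite ger0_norm ?subr_ge0//; apply: le_lt_trans dd1.
  by rewrite lerBlDl; move: xi; rewrite -natr1 mulrDl mul1r.
have s2 : `|d * f (n%:R * d) - (F t - F (n%:R * d))| <= 2 * e'.
  have nt : `|F t - F (n%:R * d) - (t - n%:R * d) * f (n%:R * d)| <= (t - n%:R * d) * e'.
    apply: riemann_cell => // x /andP[nx xt]; apply: hd1; first by rewrite pos nd.
    rewrite ger0_norm ?subr_ge0//; apply: le_lt_trans dd1.
    by rewrite lerBlDl (le_trans xt)// ltW//; move: nd'; rewrite -natr1 mulrDl mul1r.
  have dt : 0 <= d - (t - n%:R * d).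
    by move: nd'; rewrite -natr1 mulrDl mul1r; lra.
  have fM : `|(d - (t - n%:R * d)) * f (n%:R * d)| <= e'.
    rewrite normrM ger0_norm//.
    apply: (@le_trans _ _ (d * M)).
      apply: ler_pM => //; first by move: nd; lra.
      by apply: hM; rewrite pos nd.
    by move: dM; rewrite ltr_pdivlMr// => /ltW.
  have -> : d * f (n%:R * d) - (F t - F (n%:R * d)) =
    (d - (t - n%:R * d)) * f (n%:R * d) -
    (F t - F (n%:R * d) - (t - n%:R * d) * f (n%:R * d)) by ring.
  apply: (le_trans (ler_normB _ _)).
  have -> : 2 * e' = e' + e' by ring.
  rewrite lerD// (le_trans nt)// ler_piMl ?(ltW e'0)//.
  by move: dt d1'; lra.
have -> : e = t * e' + 2 * e' by rewrite -mulrDl /e' mulrC divfK// gt_eqF.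
exact: lerD.
Qed.

Lemma sum_residues (N m : nat) (P : pred nat) (f : nat -> R) :
  \sum_(i < N * m | P i) f i =
  \sum_(c < m) \sum_(j < N | P (c + j * m)%N) f (c + j * m)%N.
Proof.
pose g i := if P i then f i else 0.
transitivity (\sum_(0 <= i < N * m) g i); first by rewrite big_mkord -big_mkcond.
rewrite big_nat_mul big_mkord.
transitivity (\sum_(j < N) \sum_(c < m) g (c + j * m)%N).
  apply: eq_bigr => j _; rewrite -{1}[(j * m)%N]add0n big_addn mulSn addnK.
  by rewrite big_mkord.
by rewrite exchange_big; apply: eq_bigr => c _; rewrite [RHS]big_mkcond.
Qed.

End RiemannSums.

(** * Dyadic sums along a path *)

Section PathIntegral.
Context (R : realType) (dO : measure_display) (Omega : measurableType dO).
Context (P : probability Omega R) (d : nat) (H : R).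
Context (Q : 'rV[R]_d -> 'rV[R]_d -> R) (W : R -> 'rV[R]_d -> {RV P >-> R}).
Hypotheses (H0 : 0 < H) (H1 : H < 1 / 2).
Hypotheses (HQ : covariance_function Q) (HW : gaussian_field H Q W).
Local Notation V := 'rV[R]_d.

Lemma msq_incr (a b : R) (y : V) :
  (msq P (fun w => W b y w - W a y w)%R = (`|b - a| `^ (2 * H) * Q y y)%:E)%E.
Proof.
have -> : (fun w => W b y w - W a y w) = comb W (incr_comb a b [:: (1, y)]).
  by apply/funext => w; rewrite comb_incr big_seq1 /= mul1r.
rewrite (msq_comb HW) bil_incr fbm_incrE /bil !big_seq1 /= !mul1r !subrr normr0.
have -> : 0 `^ (2 * H) = 0 :> R by rewrite powR0// mulf_neq0// gt_eqF.
by rewrite (distrC a b); congr EFin; field.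
Qed.

Definition mesh (t : R) (n : nat) : R := t * 2^-1 ^+ n.

Definition dyadic_sum (t : R) (phi : R -> V) (n : nat) : Omega -> R :=
  psum W (2 ^ n) (fun j => j%:R * mesh t n) (fun j => phi (j%:R * mesh t n)).

(** Halving the mesh multiplies the variance of one increment by this number, and the sum of the
    variances over a partition by twice it. *)
Definition half_pow : R := 2^-1 `^ (2 * H).

Lemma half_pow_bounds : 2^-1 <= half_pow < 1.
Proof.
apply/andP; split.
  apply: ger1_powR; last by move: H1; lra.
  by apply/andP; split; [rewrite invr_gt0|rewrite invf_le1// ler1n].
have e : 1 `^ (2 * H) = 1 :> R by rewrite powR1.
rewrite -[ltRHS]e.
by apply: gt0_ltr_powR; rewrite ?nnegrE ?mulr_gt0// invf_lt1// ltr1n.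
Qed.

Section OnePath.
Variables (t : R) (phi : R -> V) (L kap : R).
Hypotheses (t0 : 0 < t) (L0 : 0 <= L) (kap0 : 0 < kap).
Hypothesis kapH : kap * (2 * half_pow) < 1.
Hypothesis modulus : forall n s r, 0 <= s <= t -> 0 <= r <= t ->
  `|s - r| <= 2 * mesh t n -> cov_dist Q (phi s) (phi r) <= L * kap ^+ n.

Local Notation h := (mesh t).
Local Notation A := (2 * half_pow).
Local Notation T2 := (t `^ (2 * H)).

Let hp_gt0 : 0 < half_pow.
Proof. by have /andP[+ _] := half_pow_bounds; apply: lt_le_trans; rewrite invr_gt0. Qed.

Let A_ge1 : 1 <= A.
Proof. by have /andP[+ _] := half_pow_bounds; lra. Qed.

Let A_le2 : A <= 2.
Proof. by have /andP[_ +] := half_pow_bounds; lra. Qed.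

Let h_gt0 n : 0 < h n. Proof. by rewrite mulr_gt0// exprn_gt0// invr_gt0. Qed.

Let h_pow n : (h n) `^ (2 * H) = T2 * half_pow ^+ n.
Proof.
rewrite /mesh powRM ?(ltW t0) ?exprn_ge0 ?invr_ge0//; congr (_ * _).
have i0 : 0 <= 2^-1 :> R by rewrite invr_ge0.
by rewrite -(powR_mulrn n i0) powRAC powR_mulrn// powR_ge0.
Qed.

Let hS n : h n = 2 * h n.+1.
Proof. by rewrite /mesh exprS; set x := _ ^+ n; field. Qed.

Let h_full n : (2 ^ n)%:R * h n = t.
Proof. by rewrite /mesh natrX mulrCA -exprMn mulfV// expr1n mulr1. Qed.

Let T2_ge0 : 0 <= T2. Proof. exact: powR_ge0. Qed.

Lemma measurable_dyadic_sum n : measurable_fun setT (dyadic_sum t phi n).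
Proof. exact: measurable_psum. Qed.

Let grid_mono n j : j%:R * h n <= j.+1%:R * h n.
Proof. by rewrite ler_pM2r// ler_nat. Qed.

Let grid_step n j : j.+1%:R * h n - j%:R * h n = h n.
Proof. by rewrite -natr1 mulrDl mul1r addrAC subrr add0r. Qed.

Let grid_sum n : \sum_(j < 2 ^ n) (j.+1%:R * h n - j%:R * h n) `^ (2 * H) = T2 * A ^+ n.
Proof.
under eq_bigr do rewrite grid_step.
by rewrite sumr_const card_ord -[_ *+ _]mulr_natl h_pow natrX exprMn mulrCA.
Qed.

Let grid_in n j : (j < 2 ^ n)%N -> 0 <= j%:R * h n <= t.
Proof.
move=> jn; rewrite mulr_ge0 ?(ltW (h_gt0 n))//= -[leRHS](h_full n).
by rewrite ler_pM2r// ler_nat ltnW.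
Qed.

(** The cells of level n contribute A^n = (2 [half_pow])^n and the oscillation of the path kap^n. As
    1 <= A <= 2, the constant is 1 + 2 (A + 1) <= 7. *)
Lemma dyadic_sum_step n :
  (msq P (fun w => dyadic_sum t phi n.+1 w - dyadic_sum t phi n w)%R
   <= (7 * L * T2 * (kap * A) ^+ n)%:E)%E.
Proof.
apply: le_trans.
  apply: (@msq_psumB _ _ _ _ _ _ _ _ H0 H1 HQ HW _ _ _ _ _ _ t (L * kap ^+ n)).
  - by move=> j; exact: grid_mono.
  - by move=> j; exact: grid_mono.
  - by rewrite mul0r.
  - by rewrite mul0r.
  - exact: h_full.
  - exact: h_full.
  - by rewrite mulr_ge0// exprn_ge0// ltW.
  - move=> j l jn ln jl lj; apply: modulus; [exact: grid_in..|].
    have e1 := grid_step n l; have e2 := grid_step n.+1 j.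
    have := h_gt0 n.+1; have := hS n; move: e1 e2 jl lj.
    set a := j%:R * _; set b := l%:R * _; set a' := _ * h n.+1; set b' := _ * h n.
    by move=> e1 e2 jl lj e3 e4; rewrite ler_norml; lra.
rewrite !grid_sum lee_fin.
have An : 1 <= A ^+ n by rewrite exprn_ege1.
rewrite [(kap * _) ^+ n]exprMn (_ : 7 * L * T2 * (kap ^+ n * A ^+ n) =
  (L * kap ^+ n) * (7 * (T2 * A ^+ n))); last by ring.
rewrite ler_wpM2l ?mulr_ge0 ?exprn_ge0 ?(ltW kap0)// exprS.
have h1 : T2 * (A * A ^+ n) <= T2 * (2 * A ^+ n).
  by rewrite ler_wpM2l// ler_wpM2r// (le_trans _ An).
have h2 : T2 * 1 <= T2 * A ^+ n by rewrite ler_wpM2l.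
by move: h1 h2; set X := T2 * _; lra.
Qed.

Definition path_bound : R := 2 * Q (phi 0) (phi 0) + 2 * L.

Lemma path_boundP s : 0 <= s <= t -> Q (phi s) (phi s) <= path_bound.
Proof.
move=> st; rewrite /path_bound.
have s0 : 0 <= (0 : R) <= t by rewrite lexx ltW.
have := @modulus 0 s 0 st s0; rewrite subr0 expr0 mulr1 /mesh expr0 mulr1 => hm.
have {}hm : cov_dist Q (phi s) (phi 0) <= L.
  by apply: hm; case/andP: st => s0' st; rewrite ger0_norm//; move: t0; lra.
(* The form is nonnegative at phi s - 2 phi 0; with the bound on the distance this gives Q(phi s,
   phi s) <= 2 Q(phi 0, phi 0) + 2 L. *)
have := bil_ge0 [:: (1, phi s); (- 2, phi 0)] HQ.
rewrite /bil !big_cons !big_nil /= (HQ.1 (phi 0) (phi s)).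
move: hm; rewrite /cov_dist; lra.
Qed.

(** The first term bounds the two end increments of a shifted sum, each of length at most eps; the
    second compares the remaining partition with the dyadic one. Both carry a factor 2 from (x +
    y)^2 <= 2 x^2 + 2 y^2. *)
Definition path_err (n : nat) : R :=
  8 * path_bound * T2 * half_pow ^+ n + 30 * L * T2 * (kap * A) ^+ n.

(* Grouping the Riemann sums of the regularized integral by residues makes it a limit of
   averages over v0 in [0, 2 eps) of the sums of W(v_j + eps) - W(v_j - eps), where
   v_j = v0 + 2 j eps.  Up to the two ends these are sums over the partition q of mesh
   2 eps, comparable to a dyadic one. *)
Section Shifted.
Variables (eps v0 : R) (n : nat).
Hypotheses (eps0 : 0 < eps) (v00 : 0 <= v0) (v0e : v0 < 2 * eps).
Hypotheses (hn1 : h n.+1 < 2 * eps) (hn : 2 * eps <= h n).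

Let v (j : nat) := v0 + j%:R * (2 * eps).
Let m := Num.truncn ((t - v0) / (2 * eps)).

Let e2 : 0 < 2 * eps. Proof. by rewrite mulr_gt0. Qed.

Let h_le_t : h n <= t.
Proof.
rewrite /mesh ger_pMr// exprn_ile1 ?invr_ge0//.
by rewrite invf_le1// ler1n.
Qed.

Let v0t : v0 <= t. Proof. by move: h_le_t hn v0e; lra. Qed.

Let mP : v m <= t /\ t < v m + 2 * eps.
Proof.
have q0 : 0 <= (t - v0) / (2 * eps) by rewrite divr_ge0 ?subr_ge0// ltW.
have /andP[a b] := truncn_itv q0.
rewrite -/m ler_pdivlMr// in a; rewrite -/m ltr_pdivrMr// in b.
by move: b; rewrite /v -natr1 mulrDl mul1r; split; lra.
Qed.

Let vS j : v j.+1 = v j + 2 * eps.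
Proof. by rewrite /v -natr1 mulrDl mul1r addrA. Qed.

Let v_mono j l : (j <= l)%N -> v j <= v l.
Proof. by move=> jl; rewrite lerD2l ler_pM2r// ler_nat. Qed.

(** The windows [v_j - eps, v_j + eps] abut, so their end points form a partition; only the two
    extreme ones are moved, to 0 and to t. *)
Let q (l : nat) := if l == 0%N then 0 else if (l <= m)%N then v l - eps else t.

Let q_lo l : (l <= m)%N -> v l - 2 * eps <= q l.
Proof.
rewrite /q; case: eqP => [-> _|_ ->]; first by rewrite /v mul0r addr0; move: v0e; lra.
by move: eps0; lra.
Qed.

Let q_hi l : (l <= m)%N -> q l.+1 <= v l + 2 * eps.
Proof.
move=> lm; rewrite /q /=; case: ifPn => l1; first by rewrite vS; move: eps0; lra.
have -> : l = m by apply/eqP; rewrite eqn_leq lm leqNgt.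
by have [_ /ltW] := mP.
Qed.

Let q_mono l : q l <= q l.+1.
Proof.
rewrite /q /=; case: eqP => [->|_].
  case: ifPn => _; last exact: ltW.
  by rewrite vS /v mul0r addr0; move: v00 eps0; lra.
case: ifPn => lm; case: ifPn => lm' //.
- by rewrite vS; move: eps0; lra.
- have := v_mono lm; have [] := mP; move: eps0; lra.
- by rewrite (ltnW lm') in lm.
Qed.

Let q0E : q 0%N = 0. Proof. by []. Qed.
Let qmE : q m.+1 = t. Proof. by rewrite /q /= ltnn. Qed.

Let m_le : m.+1%:R <= 3 * (2 ^ n)%:R :> R.
Proof.
have [vm _] := mP.
have : m%:R <= (2 ^ n.+1)%:R :> R.
  rewrite -(ler_pM2r (h_gt0 n.+1)) h_full.
  apply: (@le_trans _ _ (m%:R * (2 * eps))); first by rewrite ler_wpM2l// ltW.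
  by move: vm v00; rewrite /v; lra.
rewrite expnS natrM -natr1.
have : 1 <= (2 ^ n)%:R :> R by rewrite ler1n expn_gt0.
lra.
Qed.

(** There are m + 1 <= 3 * 2^n cells, each of length at most 2 [mesh t n], and 2^(2 H) <= 2. *)
Let q_sum : \sum_(l < m.+1) (q l.+1 - q l) `^ (2 * H) <= 6 * (T2 * A ^+ n).
Proof.
have H2 : 0 <= 2 * H by rewrite mulr_ge0// ltW.
have hh : 0 <= 2 * h n by rewrite mulr_ge0// ltW.
apply: (@le_trans _ _ (\sum_(l < m.+1) 2 * (h n) `^ (2 * H))).
  apply: ler_sum => l _; have lm : (l <= m)%N by rewrite -ltnS.
  have a1 := q_lo lm; have a2 := q_hi lm; have a3 := q_mono l.
  apply: (@le_trans _ _ ((2 * h n) `^ (2 * H))).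
    apply: ge0_ler_powR; rewrite ?nnegrE ?subr_ge0//.
    by move: a1 a2 hn; lra.
  rewrite powRM ?(ltW (h_gt0 n))// ler_wpM2r ?powR_ge0//.
  rewrite -[leRHS](@powRr1 _ 2)//; apply: ler_powR; first by rewrite ler1n.
  by move: H1; lra.
rewrite sumr_const card_ord -[_ *+ _]mulr_natl h_pow exprMn -natrX.
set X := T2 * _; have X0 : 0 <= X by rewrite mulr_ge0// exprn_ge0// ltW.
have := m_le; set N := (2 ^ n)%:R => mN.
have -> : 6 * (T2 * (N * half_pow ^+ n)) = (3 * N) * (2 * X) by rewrite /X; ring.
by rewrite ler_wpM2r// mulr_ge0.
Qed.

Definition shifted_sum (w : Omega) : R :=
  \sum_(j < m.+1) (W (v j + eps) (phi (v j)) w - W (v j - eps) (phi (v j)) w).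

Let v_in j : (j <= m)%N -> 0 <= v j <= t.
Proof.
move=> jm; rewrite /v addr_ge0 ?mulr_ge0 ?(ltW eps0)//=.
by apply: (le_trans (v_mono jm)); have [] := mP.
Qed.

Let shifted_sumE w : shifted_sum w =
  (W 0 (phi v0) w - W (v0 - eps) (phi v0) w) +
  (W (v m + eps) (phi (v m)) w - W t (phi (v m)) w) +
  psum W m.+1 q (fun l => phi (v l)) w.
Proof.
apply/eqP; rewrite -subr_eq /shifted_sum /psum -sumrB; apply/eqP.
transitivity (\sum_(j < m.+1) ((W (v j + eps) (phi (v j)) w - W (q j.+1) (phi (v j)) w)
   - (W (v j - eps) (phi (v j)) w - W (q j) (phi (v j)) w))).
  by apply: eq_bigr => j _; ring.
rewrite sumrB big_ord_recr big1 /= => [|j _]; last first.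
  have jm : (j.+1 <= m)%N := ltn_ord j.
  rewrite /q /= jm vS (_ : v j + 2 * eps - eps = v j + eps) ?subrr//; ring.
rewrite add0r big_ord_recl big1 /= => [|j _]; last first.
  by rewrite /q /bump /= add1n ltn_ord subrr.
rewrite addr0 qmE /= q0E /v mul0r addr0; ring.
Qed.

Lemma measurable_shifted_sum : measurable_fun setT shifted_sum.
Proof. by apply: measurable_sum => j; exact: measurable_funB. Qed.

Lemma shifted_sum_dyadic :
  (msq P (fun w => shifted_sum w - dyadic_sum t phi n w)%R <= (path_err n)%:E)%E.
Proof.
have mW a b y y' : measurable_fun setT (fun w => W a y w - W b y' w).
  exact: measurable_funB.
have end_le a b s : 0 <= s <= t -> `|b - a| <= eps ->
    (msq P (fun w => W b (phi s) w - W a (phi s) w)%R <=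
     (path_bound * (T2 * half_pow ^+ n))%:E)%E.
  move=> st ab; rewrite msq_incr lee_fin mulrC.
  apply: ler_pM; rewrite ?powR_ge0//.
  - by have := bil_ge0 [:: (1, phi s)] HQ; rewrite /bil !big_seq1 /= !mul1r.
  - exact: path_boundP.
  - rewrite -h_pow; apply: ge0_ler_powR; rewrite ?nnegrE ?mulr_ge0 ?(ltW H0)//.
      exact: ltW.
    by apply: (le_trans ab); move: hn eps0; lra.
have mm := mP.
have d1 : (msq P (fun w => W 0 (phi v0) w - W (v0 - eps) (phi v0) w)%R <=
     (path_bound * (T2 * half_pow ^+ n))%:E)%E.
  apply: end_le; first by rewrite v00 v0t.
  by rewrite ler_norml; move: v0e v00; lra.
have d2 : (msq P (fun w => W (v m + eps) (phi (v m)) w - W t (phi (v m)) w)%R <=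
     (path_bound * (T2 * half_pow ^+ n))%:E)%E.
  apply: end_le; first exact: v_in.
  by rewrite ler_norml; case: mm => m1 m2; apply/andP; split; lra.
have d3 : (msq P (fun w => psum W m.+1 q (fun l => phi (v l)) w - dyadic_sum t phi n w)%R
    <= (15 * L * T2 * (kap * A) ^+ n)%:E)%E.
  rewrite msqBC; apply: le_trans.
    apply: (@msq_psumB _ _ _ _ _ _ _ _ H0 H1 HQ HW _ _ _ _ _ _ t (L * kap ^+ n)) => //.
    - by rewrite mul0r.
    - by rewrite mulr_ge0// exprn_ge0// ltW.
    - move=> j l jn lm jl lj; apply: modulus; [exact: grid_in|exact: v_in|].
      have a1 := q_lo (lm : (l <= m)%N); have a2 := q_hi (lm : (l <= m)%N).
      have e1 := grid_step n j.
      rewrite ler_norml; move: a1 a2 e1 jl lj hn.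
      set a := j%:R * _; set a' := _ * h n.
      by move=> a1 a2 e1 jl lj hn'; apply/andP; split; lra.
  rewrite grid_sum lee_fin.
  have An : 1 <= A ^+ n by rewrite exprn_ege1.
  have h2 : T2 * 1 <= T2 * A ^+ n by rewrite ler_wpM2l.
  rewrite [(kap * _) ^+ n]exprMn (_ : 15 * L * T2 * (kap ^+ n * A ^+ n) =
    (L * kap ^+ n) * (15 * (T2 * A ^+ n))); last by ring.
  rewrite ler_wpM2l ?mulr_ge0 ?exprn_ge0 ?(ltW kap0)//.
  by have := q_sum; move: h2; lra.
have d12 : (msq P (fun w => (W 0 (phi v0) w - W (v0 - eps) (phi v0) w) +
    (W (v m + eps) (phi (v m)) w - W t (phi (v m)) w))%R <=
    (4 * (path_bound * (T2 * half_pow ^+ n)))%:E)%E.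
  apply: (le_trans (msqD _ _ _)) => //.
  rewrite (_ : (4 * _)%:E = 2%:E * (path_bound * (T2 * half_pow ^+ n))%:E +
     2%:E * (path_bound * (T2 * half_pow ^+ n))%:E)%E; last first.
    rewrite -!EFinM -EFinD; congr EFin. ring.
  apply: leeD; rewrite lee_pmul2l//.
have -> : (fun w => shifted_sum w - dyadic_sum t phi n w) =
   (fun w => ((W 0 (phi v0) w - W (v0 - eps) (phi v0) w) +
    (W (v m + eps) (phi (v m)) w - W t (phi (v m)) w)) +
    (psum W m.+1 q (fun l => phi (v l)) w - dyadic_sum t phi n w)).
  by apply/funext => w; rewrite shifted_sumE; ring.
apply: (le_trans (msqD _ _ _)).
- exact: measurable_funD.
- by apply: measurable_funB; [exact: measurable_psum|exact: measurable_dyadic_sum].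
apply: (@le_trans _ _ (2%:E * (4 * (path_bound * (T2 * half_pow ^+ n)))%:E +
  2%:E * (15 * L * T2 * (kap * A) ^+ n)%:E)%E).
  by apply: leeD; rewrite lee_pmul2l.
by rewrite -!EFinM -EFinD lee_fin /path_err; lra.
Qed.

End Shifted.

Lemma path_err_cvg0 : path_err n @[n --> \oo] --> 0.
Proof.
rewrite -[X in _ --> X](addr0 0) /path_err; apply: cvgD.
  rewrite -[X in _ --> X](mulr0 (8 * path_bound * T2)); apply: cvgZl_tmp.
  apply: cvg_expr; have /andP[_ +] := half_pow_bounds.
  by rewrite ger0_norm// ltW.
rewrite -[X in _ --> X](mulr0 (30 * L * T2)); apply: cvgZl_tmp.
by apply: cvg_expr; rewrite ger0_norm// mulr_ge0// ?(ltW kap0)// (le_trans _ A_ge1).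
Qed.

End OnePath.
End PathIntegral.

Lemma sum_le_truncn (R : realType) (N : nat) (a : R) (f : nat -> R) :
  0 <= a -> a < N%:R ->
  \sum_(j < N | j%:R <= a) f j = \sum_(j < (Num.truncn a).+1) f j.
Proof.
move=> a0 aN.
have aj (j : nat) : (j%:R <= a) = (j < (Num.truncn a).+1)%N.
  by rewrite ltnS truncn_ge_nat.
have nN : ((Num.truncn a).+1 <= N)%N.
  have /andP[h _] := truncn_itv a0.
  by rewrite -(ltr_nat R); exact: le_lt_trans aN.
under eq_bigl do rewrite aj.
by rewrite -(big_ord_widen _ f nN).
Qed.

(** * Regularized integrals compared with dyadic sums *)

Section IntegralApproximation.
Context (R : realType) (dO : measure_display) (Omega : measurableType dO).
Context (P : probability Omega R) (d : nat) (H : R).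
Context (Q : 'rV[R]_d -> 'rV[R]_d -> R) (W : R -> 'rV[R]_d -> {RV P >-> R}).
Hypotheses (H0 : 0 < H) (H1 : H < 1 / 2).
Hypotheses (HQ : covariance_function Q) (HW : gaussian_field H Q W).
Local Notation V := 'rV[R]_d.
Variables (t : R) (phi : R -> V) (L kap : R).
Hypotheses (t0 : 0 < t) (L0 : 0 <= L) (kap0 : 0 < kap).
Hypothesis kapH : kap * (2 * half_pow H) < 1.
Hypothesis modulus : forall n s r, 0 <= s <= t -> 0 <= r <= t ->
  `|s - r| <= 2 * mesh t n -> cov_dist Q (phi s) (phi r) <= L * kap ^+ n.
Hypothesis cphi : continuous phi.

Local Notation h := (mesh t).
Local Notation err := (path_err H Q t phi L kap).

Lemma continuous_dotW eps w : continuous (fun s => dotW W eps s (phi s) w).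
Proof.
have cW c : continuous (fun s => W (s + c) (phi s) w).
  move=> s; have c1 : (fun s => s + c) @ s --> s + c.
    by apply: cvgD; [exact: cvg_id|exact: cvg_cst].
  exact: (@continuous2_cvg _ _ _ _ _ _ (fun s => s + c) phi
    (fun r y => W r y w) _ _ (@gf_continuous _ _ _ _ _ _ _ _ HW w (s + c, phi s)) c1 (@cphi s)).
move=> s; apply: cvgM; first exact: cvg_cst.
by apply: cvgB; [exact: (cW eps)|exact: (cW (- eps))].
Qed.

Section FixedWidth.
Variables (eps : R) (n : nat).
Hypotheses (eps0 : 0 < eps) (hn1 : h n.+1 < 2 * eps) (hn : 2 * eps <= h n).

Let N := (Num.truncn (t / (2 * eps))).+1.
Let step k : R := 2 * eps / k.+1%:R.

Let e2 : 0 < 2 * eps. Proof. by rewrite mulr_gt0. Qed.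

Let tN : t < N%:R * (2 * eps).
Proof.
have q0 : 0 <= t / (2 * eps) by rewrite divr_ge0// ltW.
by have /andP[_ +] := truncn_itv q0; rewrite ltr_pdivrMr.
Qed.

Let step_gt0 k : 0 < step k. Proof. by rewrite divr_gt0. Qed.

Let e2t : 2 * eps <= t.
Proof.
apply: (le_trans hn); rewrite /mesh ger_pMr// exprn_ile1 ?invr_ge0//.
by rewrite invf_le1// ler1n.
Qed.

Let v0_lt k c : (c < k.+1)%N -> c%:R * step k < 2 * eps.
Proof.
move=> ck; rewrite /step mulrCA gtr_pMr// ltr_pdivrMr// mul1r.
by rewrite ltr_nat.
Qed.

Let riem k w : R :=
  \sum_(i < N * k.+1 | i%:R * step k <= t)
    step k * dotW W eps (i%:R * step k) (phi (i%:R * step k)) w.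

Let riem_cvg w : riem k w @[k --> \oo] --> integral_dotW W eps t phi w.
Proof.
apply/cvgrPdist_le => e e0.
have [d0 d00 hd0] := riemann_sum_cvg (@continuous_dotW eps w) t0 e0.
near=> k; rewrite distrC /riem /integral_dotW; apply: hd0 => //; last first.
  rewrite natrM -mulrA /step [_ / _]mulrC mulrA; rewrite mulrA.
  by rewrite mulfK ?pnatr_eq0.
rewrite /step ltr_pdivrMr// -ltr_pdivrMl//.
near: k.
exists (Num.truncn (d0^-1 * (2 * eps))) => // k /= hk.
have q0 : 0 <= d0^-1 * (2 * eps) by rewrite mulr_ge0 ?invr_ge0 ?(ltW d00)// ltW.
have /andP[_ h2] := truncn_itv q0.
by apply: (lt_le_trans h2); rewrite ler_nat.
Unshelve. all: by end_near. Qed.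

(** With step 2 eps / (k + 1), nodes whose indices agree modulo k + 1 are spaced by multiples of 2
    eps: each residue class is one shifted sum, and the step cancels the factor (2 eps)^-1 of [dotW]
    up to 1 / (k + 1). *)
Let riemE k w : riem k w =
  (\sum_(c < k.+1) shifted_sum W t phi eps (c%:R * step k) w) / k.+1%:R.
Proof.
rewrite /riem (sum_residues N k.+1 (fun i => i%:R * step k <= t)
  (fun i => step k * dotW W eps (i%:R * step k) (phi (i%:R * step k)) w)).
rewrite mulr_suml; apply: eq_bigr => c _.
have vE j : (c + j * k.+1)%:R * step k = c%:R * step k + j%:R * (2 * eps).
  rewrite natrD natrM mulrDl; congr (_ + _).
  by rewrite /step -mulrA; congr (_ * _); rewrite mulrC divfK.
set v0 := c%:R * step k.
have v00 : 0 <= v0 by rewrite mulr_ge0// ltW.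
have v0e := v0_lt (ltn_ord c).
transitivity (\sum_(j < N | j%:R <= (t - v0) / (2 * eps))
    (W (v0 + j%:R * (2 * eps) + eps) (phi (v0 + j%:R * (2 * eps))) w -
     W (v0 + j%:R * (2 * eps) - eps) (phi (v0 + j%:R * (2 * eps))) w) / k.+1%:R).
  apply: eq_big => [j|j _]; first by rewrite vE -/v0 ler_pdivlMr// lerBrDl.
  rewrite vE -/v0 /dotW /step; set X := _ - _; field.
  by rewrite nat1r pnatr_eq0 /= gt_eqF.
rewrite (sum_le_truncn (fun j =>
   (W (v0 + j%:R * (2 * eps) + eps) (phi (v0 + j%:R * (2 * eps))) w -
    W (v0 + j%:R * (2 * eps) - eps) (phi (v0 + j%:R * (2 * eps))) w) / k.+1%:R)).
- by rewrite /shifted_sum mulr_suml.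
- rewrite divr_ge0 ?subr_ge0 ?(ltW e2)// (le_trans _ e2t)//; exact: ltW v0e.
- by rewrite ltr_pdivrMr//; apply: le_lt_trans tN; rewrite gerBl.
Qed.

Let mriem k : measurable_fun setT (riem k).
Proof.
rewrite (_ : riem k = fun w => (\sum_(c < k.+1) shifted_sum W t phi eps (c%:R * step k) w) / k.+1%:R).
  apply: measurable_funM => //; apply: measurable_sum => c.
  exact: (measurable_shifted_sum W t phi eps).
by apply/funext => w; exact: riemE.
Qed.

Lemma measurable_integral_dotW : measurable_fun setT (integral_dotW W eps t phi).
Proof.
apply: (@measurable_fun_cvg _ _ _ setT riem); first by move=> k; exact: mriem.
by move=> w _; exact: riem_cvg.
Qed.

(** The bound of [shifted_sum_dyadic] does not depend on the starting point, so it survives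
    averaging and then, by Fatou's lemma, the limit of the Riemann sums. *)
Lemma integral_dotW_dyadic :
  (msq P (fun w => integral_dotW W eps t phi w - dyadic_sum W t phi n w)%R
   <= (err n)%:E)%E.
Proof.
have mJ := measurable_dyadic_sum W t phi n.
apply: (@msq_fatou _ _ _ P (fun k w => riem k w - dyadic_sum W t phi n w) _ _ 0%N).
- by move=> k; exact: measurable_funB.
- by apply: measurable_funB => //; exact: measurable_integral_dotW.
- by apply: nearW => w; apply: cvgB; [exact: riem_cvg|exact: cvg_cst].
- move=> k _.
  rewrite (_ : (fun w => riem k w - dyadic_sum W t phi n w) = (fun w =>
    (\sum_(c < k.+1) (shifted_sum W t phi eps (c%:R * step k) w
                      - dyadic_sum W t phi n w)) / k.+1%:R)).
    apply: (@msq_mean _ _ _ _ k.+1 (fun c w =>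
      shifted_sum W t phi eps (c%:R * step k) w - dyadic_sum W t phi n w)) => // [c|c ck].
      by apply: measurable_funB => //; exact: (measurable_shifted_sum W t phi eps).
    apply: shifted_sum_dyadic => //; first by rewrite mulr_ge0// ltW.
    exact: v0_lt.
  apply/funext => w; rewrite riemE sumrB mulrBl sumr_const card_ord.
  by rewrite -[dyadic_sum W t phi n w *+ _]mulr_natr mulfK// pnatr_eq0.
Qed.

End FixedWidth.

Let h_gt0 n : 0 < h n. Proof. by rewrite mulr_gt0// exprn_gt0// invr_gt0. Qed.

Lemma mesh_cvg0 : h n @[n --> \oo] --> 0.
Proof.
rewrite -[X in _ --> X](mulr0 t); apply: cvgZl_tmp; apply: cvg_expr.
by rewrite ger0_norm ?invr_ge0// invf_lt1// ltr1n.
Qed.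

Lemma mesh_scale (x : R) n0 : 0 < x -> x <= h n0 ->
  exists2 n, (n0 <= n)%N & h n.+1 < x <= h n.
Proof.
move=> x0 xn0.
have ex : exists k, h k < x.
  have [k _ hk] : \forall k \near \oo, h k < x.
    have /cvgrPdist_lt /(_ _ x0) := mesh_cvg0; apply: filterS => k.
    by rewrite sub0r normrN gtr0_norm.
  by exists k; apply: hk => /=.
case: (ex_minnP ex) => -[|k] hk kmin.
  have : h n0 <= h 0%N.
    by rewrite ler_pM2l// expr0 exprn_ile1 ?invr_ge0// invf_le1// ler1n.
  by move=> h0; move: (lt_le_trans hk (le_trans xn0 h0)); rewrite ltxx.
exists k; last first.
  rewrite hk /= leNgt; apply/negP => /kmin; by rewrite ltnn.
rewrite leqNgt; apply/negP => kn.
have : h n0 <= h k.+1.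
  rewrite ler_pM2l// -(subnK kn) exprD ler_piMl ?exprn_ge0 ?invr_ge0//.
  by rewrite exprn_ile1 ?invr_ge0// invf_le1// ler1n.
by move=> h0; move: (lt_le_trans hk (le_trans xn0 h0)); rewrite ltxx.
Qed.

Let err_ev e : 0 < e -> exists n0, forall n, (n0 <= n)%N -> err n <= e.
Proof.
move=> e0; have /cvgrPdist_le /(_ _ e0) [n0 _ hn0] :=
  path_err_cvg0 Q H0 H1 t phi L kap0 kapH.
exists n0 => n nn; have := hn0 n nn; rewrite /= sub0r normrN.
by apply: le_trans; exact: ler_norm.
Qed.

(** Each small eps belongs to a dyadic scale, at which the regularized integral is within [path_err]
    of the dyadic sum. *)
Lemma dyadic_nonlinear_integral (Z : Omega -> R) (b : nat -> R) :
  measurable_fun setT Z -> b n @[n --> \oo] --> 0 ->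
  (forall n, (msq P (fun w => dyadic_sum W t phi n w - Z w)%R <= (b n)%:E)%E) ->
  is_nonlinear_integral W t phi Z.
Proof.
move=> mZ b0 hZ.
have mJ n := measurable_dyadic_sum W t phi n.
split.
  apply/Lfun2P; split => //.
  have -> : Z = (fun w => dyadic_sum W t phi 0 w + (- (dyadic_sum W t phi 0 w - Z w))).
    by apply/funext => w; rewrite opprB addrC subrK.
  apply: (le_lt_trans (msqD _ _ _)) => //.
    by apply: measurableT_comp => //; exact: measurable_funB.
  rewrite msqN; apply: lte_add_pinfty; apply: lte_mul_pinfty => //.
    have -> : dyadic_sum W t phi 0 = comb W (steps
      (fun j : 'I_(2 ^ 0) => j%:R * h 0) (fun j => j.+1%:R * h 0)
      (fun j => [:: (1, phi (j%:R * h 0))])).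
      apply/funext => w; rewrite comb_steps; apply: eq_bigr => j _.
      by rewrite big_seq1 /= mul1r.
    by rewrite (msq_comb HW) ltry.
  by apply: (le_lt_trans (hZ 0%N)); rewrite ltry.
apply: (proj2 (@Lnorm2_cvg0 _ _ _ _ _ _ (fun eps => integral_dotW W eps t phi \- Z) _)).
move=> e e0.
have e4 : 0 < e / 4 by rewrite divr_gt0.
have [n1 hn1] := err_ev e4.
have [n2 hn2] : exists n2, forall n, (n2 <= n)%N -> b n <= e / 4.
  have /cvgrPdist_le /(_ _ e4) [n2 _ hn2] := b0.
  exists n2 => n nn; have := hn2 n nn; rewrite /= sub0r normrN.
  by apply: le_trans; exact: ler_norm.
near=> eps.
have eps0 : 0 < eps by near: eps; exact: nbhs_right_gt.
have epsn : 2 * eps <= h (maxn n1 n2).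
  rewrite mulrC -ler_pdivlMr//; near: eps; apply: nbhs_right_le.
  by rewrite divr_gt0.
have [n nn /andP[a1 a2]] := mesh_scale (mulr_gt0 (ltr0n _ 2) eps0) epsn.
move: nn; rewrite geq_max => /andP[nn1 nn2].
have mI := measurable_integral_dotW eps0 a2.
apply: (le_trans (msqB_trans mI (mJ n) mZ (integral_dotW_dyadic eps0 a1 a2) (hZ n))).
by rewrite lee_fin; have := hn1 n nn1; have := hn2 n nn2; lra.
Unshelve. all: by end_near. Qed.

(** Converse of the preceding lemma, along eps = [mesh t n] / 2. It applies to any representative Z,
    in particular to one picked by choice. *)
Lemma nonlinear_integral_dyadic (Z : Omega -> R) (e : R) :
  is_nonlinear_integral W t phi Z -> 0 < e ->
  \forall n \near \oo,
    (msq P (fun w => dyadic_sum W t phi n w - Z w)%R <= e%:E)%E.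
Proof.
move=> [/Lfun2P[mZ _] hZ] e0.
have e4 : 0 < e / 4 by rewrite divr_gt0.
have [n1 hn1] := err_ev e4.
have {}hZ := proj1 (@Lnorm2_cvg0 _ _ _ _ _ _ (fun eps => integral_dotW W eps t phi \- Z) _) hZ _ e4.
have [r /= r0 hr] := hZ.
have /cvgrPdist_lt /(_ _ r0) [n2 _ hn2] := mesh_cvg0.
exists (maxn n1 n2) => // n /=; rewrite geq_max => /andP[nn1 nn2].
pose eps := h n / 2.
have eps0 : 0 < eps by rewrite divr_gt0.
have e2h : 2 * eps = h n by rewrite /eps mulrC divfK.
have a1 : h n.+1 < 2 * eps.
  by rewrite e2h /mesh ltr_pM2l// exprS gtr_pMl ?exprn_gt0 ?invr_gt0// invf_lt1// ltr1n.
have a2 : 2 * eps <= h n by rewrite e2h.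
have Iz : (msq P (integral_dotW W eps t phi \- Z)%R <= (e / 4)%:E)%E.
  apply: hr => //=; rewrite sub0r normrN gtr0_norm//.
  have := hn2 n nn2; rewrite /= sub0r normrN gtr0_norm// => hnr.
  by apply: lt_trans hnr; rewrite -e2h; lra.
have mI := measurable_integral_dotW eps0 a2.
have mJ := measurable_dyadic_sum W t phi n.
have := integral_dotW_dyadic eps0 a1 a2; rewrite msqBC => JI.
apply: (le_trans (msqB_trans mJ mI mZ JI Iz)).
by rewrite lee_fin; have := hn1 n nn1; lra.
Qed.

End IntegralApproximation.

(** * Regularity of Brownian paths *)

Section Chaining.
Context (R : realType).
Variables (g : R -> R) (K rho : R).
Hypotheses (cg : continuous g) (K0 : 0 <= K) (rho0 : 0 < rho) (rho1 : rho < 1).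
Hypothesis incr : forall n j, (j < 2 ^ n)%N ->
  `|g (j.+1%:R * 2^-1 ^+ n) - g (j%:R * 2^-1 ^+ n)| <= K * rho ^+ n.

Let k (n : nat) (u : R) : nat := Num.truncn (u * 2 ^+ n).
Let p n u : R := (k n u)%:R * 2^-1 ^+ n.

Let two_n n : 0 < 2 ^+ n :> R. Proof. by rewrite exprn_gt0. Qed.

Let kP n u : 0 <= u -> (k n u)%:R <= u * 2 ^+ n < (k n u)%:R + 1.
Proof.
by move=> u0; rewrite natr1; apply: truncn_itv; rewrite mulr_ge0// ltW.
Qed.

Let kS n u : 0 <= u -> k n.+1 u = (2 * k n u)%N \/ k n.+1 u = (2 * k n u).+1.
Proof.
move=> u0; have /andP[a1 a2] := kP n u0; have /andP[b1 b2] := kP n.+1 u0.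
rewrite exprS in b1 b2.
have l1 : (2 * k n u < (k n.+1 u).+1)%N.
  by rewrite -(ltr_nat R) natrM -natr1; lra.
have l2 : (k n.+1 u < 2 * k n u + 2)%N.
  by rewrite -(ltr_nat R) natrD natrM; lra.
have [e|ne] := eqVneq (k n.+1 u) (2 * k n u)%N; [by left|right].
by apply/eqP; rewrite eqn_leq; move: l1 l2; rewrite !ltnS addn2 ltnS => l1 ->;
   rewrite ltn_neqAle eq_sym ne.
Qed.

Let k_le n u : 0 <= u <= 1 -> (k n u <= 2 ^ n)%N.
Proof.
move=> /andP[u0 u1]; have /andP[a1 _] := kP n u0.
rewrite -(ler_nat R) natrX (le_trans a1)// ler_piMl//; exact: ltW.
Qed.

Let p_step n u : 0 <= u <= 1 -> `|g (p n.+1 u) - g (p n u)| <= K * rho ^+ n.+1.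
Proof.
move=> u01; have u0 : 0 <= u by case/andP: u01.
have pE : p n u = (2 * k n u)%:R * 2^-1 ^+ n.+1.
  by rewrite /p exprS natrM; field.
rewrite pE /p; have [->|e] := kS n u0.
  by rewrite subrr normr0 mulr_ge0// exprn_ge0// ltW.
by rewrite e; apply: incr; rewrite -e; exact: k_le.
Qed.

Let tail n m u : 0 <= u <= 1 ->
  `|g (p (n + m) u) - g (p n u)| <= K * rho ^+ n * (1 - rho)^-1.
Proof.
move=> u01.
have rr : 0 < 1 - rho by rewrite subr_gt0.
(* The exact partial sum of the geometric series is what makes the induction on m close. *)
suff h : `|g (p (n + m) u) - g (p n u)| <= K * rho ^+ n * ((1 - rho ^+ m.+1) / (1 - rho)).
  apply: (le_trans h); rewrite ler_wpM2l ?mulr_ge0 ?exprn_ge0 ?(ltW rho0)//.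
  by rewrite ler_pdivrMr// mulVf ?gt_eqF// gerBl exprn_ge0// ltW.
elim: m => [|m IH].
  rewrite addn0 subrr normr0 expr1 divff ?gt_eqF// mulr1.
  by rewrite mulr_ge0// exprn_ge0// ltW.
rewrite addnS -(subrKA (g (p (n + m) u))) (le_trans (ler_normD _ _))//.
have := p_step (n + m) u01 => h1.
apply: (le_trans (lerD h1 IH)).
rewrite -addnS exprD [rho ^+ m.+2]exprS le_eqVlt; apply/orP; left; apply/eqP.
by field; rewrite gt_eqF.
Qed.

Let near_grid n u : 0 <= u <= 1 -> `|g u - g (p n u)| <= K * rho ^+ n * (1 - rho)^-1.
Proof.
move=> u01; have u0 : 0 <= u by case/andP: u01.
have pc : p (n + m)%N u @[m --> \oo] --> u.
  apply/cvgrPdist_le => e e0.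
  have : 2^-1 ^+ m @[m --> \oo] --> (0 : R).
    by apply: cvg_expr; rewrite ger0_norm ?invr_ge0// invf_lt1// ltr1n.
  move=> /cvgrPdist_le /(_ _ e0) [m0 _ hm0]; exists m0 => // m mm.
  have := hm0 (n + m)%N (leq_trans mm (leq_addl n m)).
  rewrite /= sub0r normrN ger0_norm ?exprn_ge0 ?invr_ge0// => h.
  apply: le_trans h; have /andP[a1 a2] := kP (n + m) u0.
  have pe : 2 ^+ (n + m) * 2^-1 ^+ (n + m) = 1 :> R by rewrite -exprMn mulfV// expr1n.
  have pp : 0 < 2^-1 ^+ (n + m) :> R by rewrite exprn_gt0// invr_gt0.
  have uE : u = u * 2 ^+ (n + m) * 2^-1 ^+ (n + m) by rewrite -mulrA pe mulr1.
  rewrite /p {1}uE -mulrBl normrM (ger0_norm (ltW pp)) ler_piMl ?(ltW pp)//.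
  by rewrite ger0_norm ?subr_ge0// lerBlDl ltW.
have gc : g (p (n + m)%N u) @[m --> \oo] --> g u.
  exact: (continuous_cvg _ (@cg u) pc).
have nc : `|g (p (n + m)%N u) - g (p n u)| @[m --> \oo] --> `|g u - g (p n u)|.
  by apply: cvg_norm; apply: cvgB => //; exact: cvg_cst.
rewrite -(cvg_lim _ nc)//; apply: limr_le; first exact: cvgP nc.
by apply: nearW => m; exact: tail.
Qed.

Let grid_adj n u v : 0 <= u <= 1 -> 0 <= v <= 1 -> u <= v -> v - u <= 2^-1 ^+ n ->
  `|g (p n v) - g (p n u)| <= K * rho ^+ n.
Proof.
move=> u01 v01 uv vu.
have u0 : 0 <= u by case/andP: u01.
have v0 : 0 <= v by case/andP: v01.
have /andP[a1 a2] := kP n u0; have /andP[b1 b2] := kP n v0.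
have vu2 : v * 2 ^+ n <= u * 2 ^+ n + 1.
  rewrite -lerBlDl -mulrBl; apply: (le_trans (ler_wpM2r (ltW (two_n n)) vu)).
  by rewrite -exprMn mulVf// expr1n.
have uv2 : u * 2 ^+ n <= v * 2 ^+ n by rewrite ler_pM2r.
have l1 : (k n u <= k n v)%N.
  by rewrite -ltnS -(ltr_nat R) -natr1; lra.
have l2 : (k n v < k n u + 2)%N by rewrite -(ltr_nat R) natrD; lra.
rewrite /p; have [->|ne] := eqVneq (k n v) (k n u).
  by rewrite subrr normr0 mulr_ge0// exprn_ge0// ltW.
have e : k n v = (k n u).+1.
  apply/eqP; rewrite eqn_leq; move: l2; rewrite addn2 ltnS => ->.
  by rewrite ltn_neqAle eq_sym ne.
by rewrite e; apply: incr; rewrite -e; exact: k_le.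
Qed.

(** Passing from u and v to the dyadic points of level n below them costs K rho^n / (1 - rho) each,
    and these points are equal or adjacent: three terms in all. *)
Lemma chaining n u v : 0 <= u <= 1 -> 0 <= v <= 1 -> `|v - u| <= 2^-1 ^+ n ->
  `|g v - g u| <= 3 * K * (1 - rho)^-1 * rho ^+ n.
Proof.
wlog uv : u v / u <= v.
  move=> h u01 v01 vu; have [uv|/ltW vu'] := leP u v; first exact: h.
  by rewrite distrC; apply: h => //; rewrite distrC.
move=> u01 v01; rewrite ger0_norm ?subr_ge0// => vu.
have a1 := near_grid n u01; have a2 := near_grid n v01.
have a3 := grid_adj u01 v01 uv vu.
have -> : g v - g u = (g v - g (p n v)) + (g (p n v) - g (p n u)) - (g u - g (p n u)).
  by ring.
apply: (le_trans (ler_normB _ _)).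
apply: (le_trans (lerD (ler_normD _ _) (lexx _))).
apply: (le_trans (lerD (lerD a2 a3) a1)).
have rr : 1 <= (1 - rho)^-1.
  by rewrite invf_ge1 ?subr_gt0// gerBl ltW.
have Kr : 0 <= K * rho ^+ n by rewrite mulr_ge0// exprn_ge0// ltW.
have := ler_wpM2l Kr rr; rewrite mulr1.
have -> : 3 * K * (1 - rho)^-1 * rho ^+ n = 3 * (K * rho ^+ n * (1 - rho)^-1) by ring.
lra.
Qed.

End Chaining.

Lemma fin_union_bound (R : realType) (dT : measure_display)
    (T : measurableType dT) (P : probability T R) (I : finType)
    (F : I -> set T) (A : set T) :
  (forall i, measurable (F i)) -> measurable A -> A `<=` \bigcup_i F i ->
  (P A <= \sum_i P (F i))%E.
Proof.
move=> mF mA AF.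
pose G n := if insub n is Some k then F (@enum_val I predT k) else set0.
apply: (@le_trans _ _ (\sum_(k < #|I|) P (G k))%E).
  apply: content_subadditive => //.
    by move=> n _; rewrite /G; case: insubP.
  move=> w /AF[i _ Fi]; rewrite -bigcup_mkord; exists (enum_rank i) => //=.
  by rewrite /G valK enum_rankK.
have -> : (\sum_i P (F i) = \sum_(i in I) P (F i))%E by apply: eq_bigl.
rewrite [leRHS]big_enum_val.
by apply: lee_sum => k _; rewrite /G valK.
Qed.

Section BrownianModulus.
Context (R : realType) (dB : measure_display) (OmegaB : measurableType dB).
Context (PB : probability OmegaB R).

(** Chernoff's bound with the optimal parameter a / s^2, applied to X and to - X. *)
Lemma normal_rv_tail_le (X : {RV PB >-> R}) (s a : R) : 0 < s -> 0 < a ->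
  normal_rv PB 0 s X ->
  (PB [set w | (a < `|X w|)%R] <= (2 * expR (- (a ^+ 2 / (2 * s ^+ 2))))%:E)%E.
Proof.
move=> s0 a0 nX; pose r := a / s ^+ 2.
have r0 : 0 < r by rewrite divr_gt0// exprn_gt0.
have half (Y : {RV PB >-> R}) (c : R) : c ^+ 2 = 1 -> (forall w, Y w = c * X w) ->
    (PB [set w | (a <= Y w)%R] <= (expR (- (a ^+ 2 / (2 * s ^+ 2))))%:E)%E.
  move=> c2 YX; apply: (le_trans (chernoff Y a r0)).
  rewrite /mmt_gen_fun unlock /=.
  under eq_integral do rewrite /= YX mulrC mulrA.
  rewrite (normal_rv_mgf (r * c) nX) -EFinM lee_fin -expRD mulr0 add0r.
  rewrite exprMn c2 mulr1 ler_expR le_eqVlt; apply/orP; left; apply/eqP.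
  by rewrite /r; field; rewrite gt_eqF.
have mX : measurable_fun setT X by exact: measurable_funPT.
have mge (Y : {RV PB >-> R}) : measurable [set w | (a <= Y w)%R].
  rewrite (_ : [set w | _] = Y @^-1` `[a, +oo[); last first.
    by apply/seteqP; split=> w /=; rewrite in_itv /= andbT.
  by rewrite -[X in measurable X]setTI; apply: measurable_funP => //; exact: measurable_itv.
apply: (@le_trans _ _ (PB ([set w | (a <= X w)%R] `|` [set w | (a <= (\- X) w)%R]))).
  apply: le_measure; rewrite ?inE.
  - rewrite (_ : [set w | _] = (fun w => `|X w|) @^-1` `]a, +oo[); last first.
      by apply/seteqP; split=> w /=; rewrite in_itv /= andbT.
    have mN : measurable_fun setT (fun w => `|X w|) by exact: measurableT_comp.
    have mI : measurable (`]a, +oo[%classic : set R) by exact: measurable_itv.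
    by rewrite -[X in measurable X]setTI; apply: mN.
  - by apply: measurableU; exact: mge.
  - move=> w /=; rewrite ltr_normr => /orP[/ltW h|/ltW h]; [left|right]; exact: h.
apply: (le_trans (measureU2 _ _ _)); [exact: mge..|].
rewrite mulr2n mulrDl !mul1r EFinD.
apply: leeD; first by apply: (half X 1); rewrite ?expr1n// => w; rewrite mul1r.
by apply: (half _ (-1)); rewrite ?sqrrN ?expr1n// => w; rewrite mulN1r.
Qed.

End BrownianModulus.

Lemma continuous_max0 (R : realType) (f : R -> R) :
  {within `[0, +oo[, continuous f} -> continuous (fun s : R => f (Num.max 0 s)).
Proof.
move=> /subspace_continuousP cf.
have main (s : R) : (fun r => f (Num.max 0 r)) @ s --> f (Num.max 0 s).
  have A0 : (`[0, +oo[%classic : set R) (Num.max 0 s).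
    by rewrite /= in_itv /= andbT le_max lexx.
  have cm : (fun r : R => Num.max 0 r) @ s --> Num.max 0 s.
    apply: (@continuous_max R R (cst 0) id s); first exact: cvg_cst.
    exact: cvg_id.
  move=> U hU; have h := cm _ (cf _ A0 U hU).
  apply: (@filterS _ (nbhs s) _ _ _ _ h) => r /=; apply.
  by rewrite /= in_itv /= andbT le_max lexx.
exact: main.
Qed.

Section BrownianPaths.
Context (R : realType) (dB : measure_display) (OmegaB : measurableType dB).
Context (PB : probability OmegaB R) (d : nat) (B : 'I_d -> R -> {RV PB >-> R}).
Hypothesis HB : standard_brownian_motion B.

Definition bm_step (a tau : R) (n : nat) (ji : 'I_(2 ^ n) * 'I_d) : OmegaB -> R :=
  B ji.2 (a + tau * (ji.1.+1%:R * 2^-1 ^+ n)) \-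
  B ji.2 (a + tau * (ji.1%:R * 2^-1 ^+ n)).

Definition rough_level (a tau K rho : R) (n : nat) (ji : 'I_(2 ^ n) * 'I_d) :=
  [set w | K * rho ^+ n < `|bm_step a tau ji w|].

(* Brownian paths outside [rough] are Hoelder on [a, a + tau] of exponent
   - log2 rho, with constant proportional to [K] ([smooth_modulus]). *)
Definition rough (a tau K rho : R) : set OmegaB :=
  \bigcup_n \bigcup_ji rough_level a tau K rho (n := n) ji.

Lemma measurable_rough_level a tau K rho n (ji : 'I_(2 ^ n) * 'I_d) :
  measurable (rough_level a tau K rho ji).
Proof.
rewrite (_ : rough_level _ _ _ _ _ =
  (fun w => `|bm_step a tau ji w|) @^-1` `]K * rho ^+ n, +oo[); last first.
  by apply/seteqP; split=> w /=; rewrite in_itv /= andbT.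
have mS : measurable_fun setT (bm_step a tau ji) by exact: measurable_funB.
have mN : measurable_fun setT (fun w => `|bm_step a tau ji w|) by exact: measurableT_comp.
have mI : measurable (`]K * rho ^+ n, +oo[%classic : set R) by exact: measurable_itv.
by rewrite -[X in measurable X]setTI; apply: mN.
Qed.

Lemma measurable_rough_fin a tau K rho n :
  measurable (\bigcup_ji rough_level a tau K rho (n := n) ji).
Proof. by apply: fin_bigcup_measurable => // ji _; exact: measurable_rough_level. Qed.

Lemma measurable_rough a tau K rho : measurable (rough a tau K rho).
Proof. by apply: bigcup_measurable => n _; exact: measurable_rough_fin. Qed.

Lemma bernoulli_ineq (x : R) n : 0 <= x -> 1 + n%:R * x <= (1 + x) ^+ n.
Proof.
move=> x0; elim: n => [|n IH]; first by rewrite mul0r addr0 expr0.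
rewrite exprS; have := ler_wpM2l (addr_ge0 ler01 x0) IH; apply: le_trans.
rewrite -natr1; have : 0 <= n%:R * x * x by rewrite !mulr_ge0.
lra.
Qed.

(** At level n there are 2^n d increments, each rough with probability at most 2 exp(- z lam^n), z =
    K^2 / (2 tau), lam = 2 rho^2. As lam^n >= 1 + n (lam - 1), the last hypothesis turns this into 2
    exp(- z) 4^-n; against 2^n increments a series in 2^-n remains. *)
Lemma rough_le a tau K rho : 0 <= a -> 0 < tau -> 0 < K -> 0 < rho ->
  1 < 2 * rho ^+ 2 ->
  expR (- (K ^+ 2 / (2 * tau) * (2 * rho ^+ 2 - 1))) <= 1 / 4 ->
  (PB (rough a tau K rho) <= (4 * d%:R * expR (- (K ^+ 2 / (2 * tau))))%:E)%E.
Proof.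
move=> a0 tau0 K0 rho0; set lam := 2 * rho ^+ 2; set z := K ^+ 2 / _ => lam1 zle.
have z0 : 0 < z by rewrite divr_gt0 ?exprn_gt0 ?mulr_gt0.
have level n : (PB (\bigcup_ji rough_level a tau K rho (n := n) ji) <=
    (2 * d%:R * expR (- z) * 2^-1 ^+ n)%:E)%E.
  have hn : 0 < 2^-1 ^+ n :> R by rewrite exprn_gt0// invr_gt0.
  have one (ji : 'I_(2 ^ n) * 'I_d) : (PB (rough_level a tau K rho ji) <=
      (2 * expR (- (z * lam ^+ n)))%:E)%E.
    case: ji => j i.
    pose s1 := a + tau * (j%:R * 2^-1 ^+ n).
    pose s2 := a + tau * (j.+1%:R * 2^-1 ^+ n).
    have s10 : 0 <= s1.
      by rewrite addr_ge0// mulr_ge0 ?mulr_ge0 ?(ltW tau0) ?(ltW hn).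
    have s12 : s2 - s1 = tau * 2^-1 ^+ n.
      by rewrite /s1 /s2 -natr1; set x := j%:R; ring.
    have s12' : s1 <= s2 by rewrite -subr_ge0 s12 mulr_ge0 ?ltW.
    have nX := sbm_normal HB i s10 s12'; rewrite s12 in nX.
    have sg : 0 < Num.sqrt (tau * 2^-1 ^+ n) by rewrite sqrtr_gt0 mulr_gt0.
    have Kn : 0 < K * rho ^+ n by rewrite mulr_gt0// exprn_gt0.
    have := @normal_rv_tail_le _ _ _ PB (B i s2 \- B i s1) _ _ sg Kn nX.
    congr (_ <= _)%E; congr (_%:E); congr (_ * expR (- _)).
    rewrite sqr_sqrtr; last by rewrite mulr_ge0 ?ltW.
    rewrite /z /lam exprMn exprMn exprVn -exprM mulnC exprM.
    by field; rewrite gt_eqF //= expf_neq0.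
  apply: (le_trans (@fin_union_bound _ _ _ PB _ (rough_level a tau K rho (n := n)) _ _ _ _)).
  - exact: measurable_rough_level.
  - exact: measurable_rough_fin.
  - by [].
  apply: (@le_trans _ _ (\sum_(ji : 'I_(2 ^ n) * 'I_d) (2 * expR (- (z * lam ^+ n)))%:E)%E).
    by apply: lee_sum => ji _; exact: one.
  rewrite sumEFin lee_fin sumr_const card_prod !card_ord -[_ *+ (_ * _)]mulr_natl natrM natrX.
  have e1 : expR (- (z * lam ^+ n)) <= expR (- z) * (1 / 4) ^+ n.
    apply: (@le_trans _ _ (expR (- z) * expR (- (z * (lam - 1))) ^+ n)).
      rewrite -expRM_natl -expRD ler_expR.
      have : 0 <= lam - 1 by rewrite subr_ge0 ltW.
      move=> /(bernoulli_ineq n); rewrite (addrC 1 (lam - 1)) subrK => h.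
      have := ler_wpM2l (ltW z0) h; rewrite mulrDr mulr1 => h2.
      rewrite -mulr_natl; move: h2; lra.
    rewrite ler_wpM2l ?expR_ge0// lerXn2r ?nnegrE ?expR_ge0//.
  have -> : 2 * d%:R * expR (- z) * 2^-1 ^+ n =
      2 ^+ n * d%:R * (2 * (expR (- z) * (1 / 4) ^+ n)).
    have -> : 2^-1 ^+ n = 2 ^+ n * (1 / 4) ^+ n :> R.
      by rewrite -exprMn; congr (_ ^+ _); field.
    ring.
  by rewrite ler_wpM2l ?mulr_ge0 ?exprn_ge0// ler_wpM2l.
apply: (@le_trans _ _ (\sum_(n <oo) PB (\bigcup_ji rough_level a tau K rho (n := n) ji))%E).
  apply: measure_sigma_subadditive => //.
  - by move=> n; exact: measurable_rough_fin.
  - exact: measurable_rough.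
apply: (@le_trans _ _ (\sum_(n <oo) (2 * d%:R * expR (- z) * 2^-1 ^+ n)%:E)%E).
  by apply: lee_nneseries => // n _; exact: level.
apply: le_trans.
  apply: geometric_nneseries_le; rewrite ?mulr_ge0 ?expR_ge0 ?invr_gt0//.
  by rewrite invf_lt1// ltr1n.
by rewrite lee_fin le_eqVlt; apply/orP; left; apply/eqP; field.
Qed.

Lemma smooth_modulus a tau K rho w (i : 'I_d) n (u v : R) :
  0 <= a -> 0 < tau -> 0 <= K -> 0 < rho -> rho < 1 -> ~ rough a tau K rho w ->
  0 <= u <= 1 -> 0 <= v <= 1 -> `|v - u| <= 2^-1 ^+ n ->
  `|B i (a + tau * v) w - B i (a + tau * u) w| <= 3 * K * (1 - rho)^-1 * rho ^+ n.
Proof.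
move=> a0 tau0 K0 rho0 rho1 wr u01 v01 uv.
pose g r := B i (Num.max 0 (a + tau * r)) w.
have cg : continuous g.
  have main (r : R) : g @ r --> g r.
    have c1 : (fun r : R => a + tau * r) @ r --> a + tau * r.
      by apply: cvgD; [exact: cvg_cst|apply: cvgM; [exact: cvg_cst|exact: cvg_id]].
    have c2 := continuous_max0 (@sbm_continuous _ _ _ _ _ _ HB i w).
    exact: (continuous_cvg _ (c2 (a + tau * r)) c1).
  exact: main.
have gE r : 0 <= r -> g r = B i (a + tau * r) w.
  by move=> r0; rewrite /g max_r// addr_ge0// mulr_ge0// ltW.
have incr m j : (j < 2 ^ m)%N ->
    `|g (j.+1%:R * 2^-1 ^+ m) - g (j%:R * 2^-1 ^+ m)| <= K * rho ^+ m.
  move=> jm; have hm : 0 <= 2^-1 ^+ m :> R by rewrite exprn_ge0// invr_ge0.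
  rewrite !gE ?mulr_ge0// leNgt; apply/negP => h; apply: wr.
  by exists m => //; exists (Ordinal jm, i).
have := chaining cg K0 rho0 rho1 incr u01 v01 uv.
by rewrite !gE//; [case/andP: u01|case/andP: v01].
Qed.

End BrownianPaths.

Lemma cvg_row (R : realType) (d : nat) (I : Type) (F : set_system I)
    (FF : Filter F) (f : I -> 'rV[R]_d) (x : 'rV[R]_d) :
  (forall j, f i 0 j @[i --> F] --> x 0 j) -> f @ F --> x.
Proof.
move=> h; apply/cvg_ballP => e e0.
have : \forall i \near F, forall j, ball (x 0 j) e (f i 0 j).
  by apply: filter_forall => j; have /cvg_ballP := h j; apply.
by apply: filterS => i hi; split=> // k j; rewrite !ord1.
Qed.

(** * Joint measurability of the field along random points *)

Section JointMeasurability.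
Context (R : realType) (dO dB : measure_display).
Context (Omega : measurableType dO) (OmegaB : measurableType dB).
Context (P : probability Omega R) (d : nat) (H : R).
Context (Q : 'rV[R]_d -> 'rV[R]_d -> R) (W : R -> 'rV[R]_d -> {RV P >-> R}).
Hypothesis HW : gaussian_field H Q W.

Lemma continuous_field (s : R) (w : Omega) : continuous (fun y => W s y w).
Proof.
move=> y; have c2 : (fun y' : 'rV[R]_d => y') @ y --> y by exact: cvg_id.
exact: (@continuous2_cvg _ _ _ _ _ _ (fun=> s) (fun y' => y')
    (fun r y => W r y w) _ _ (@gf_continuous _ _ _ _ _ _ _ _ HW w (s, y)) (cvg_cst s) c2).
Qed.

(* The field is continuous in space: it is the limit of its values at the grid points
   [grid m (fl m b)], which take countably many values. *)
Lemma measurable_field_comp (s : R) (psi : OmegaB -> 'rV[R]_d) :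
  (forall i, measurable_fun setT (fun b => psi b 0 i)) ->
  measurable_fun setT (fun z : Omega * OmegaB => W s (psi z.2) z.1).
Proof.
move=> mpsi.
pose fl (m : nat) (b : OmegaB) : {ffun 'I_d -> int} :=
  [ffun i => Num.floor (psi b 0 i * m.+1%:R)].
pose grid (m : nat) (k : {ffun 'I_d -> int}) : 'rV[R]_d :=
  \row_i ((k i)%:~R / m.+1%:R).
apply: (@measurable_fun_cvg _ _ _ setT (fun m z => W s (grid m (fl m z.2)) z.1)); last first.
  move=> z _.
  have gc : grid m (fl m z.2) @[m --> \oo] --> psi z.2.
    apply: cvg_row => j; apply/cvgrPdist_le => e e0.
    exists (Num.truncn e^-1) => // m /= em.
    rewrite mxE ffunE.
    have m0 : 0 < m.+1%:R :> R by rewrite ltr0n.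
    have /andP[f1 f2] := floor_itv (psi z.2 0 j * m.+1%:R).
    set y := psi z.2 0 j in f1 f2 *; set k := Num.floor _ in f1 f2 *.
    have -> : y - k%:~R / m.+1%:R = (y * m.+1%:R - k%:~R) / m.+1%:R.
      by rewrite mulrBl mulfK// gt_eqF.
    rewrite ger0_norm; last by rewrite divr_ge0 ?subr_ge0// ltW.
    rewrite ler_pdivrMr//; apply: (@le_trans _ _ 1).
      by rewrite lerBlDl ltW//; move: f2; rewrite intrD.
    rewrite -ler_pdivrMl// mulr1 ltW//.
    have ei : 0 < e^-1 by rewrite invr_gt0.
    have /andP[_ tr] := truncn_itv (ltW ei).
    by apply: (lt_le_trans tr); rewrite ler_nat.
  exact: (continuous_cvg _ (@continuous_field s z.1 (psi z.2)) gc).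
move=> m _ Y mY; rewrite setTI.
pose cell (k : {ffun 'I_d -> int}) : set OmegaB := [set b | fl m b = k].
have mcell k : measurable (cell k).
  rewrite (_ : cell k = \bigcap_i ((fun b => psi b 0 i) @^-1`
      `[(k i)%:~R / m.+1%:R, (k i + 1)%:~R / m.+1%:R[)).
    apply: fin_bigcap_measurable => // i _.
    rewrite -[X in measurable X]setTI; apply: mpsi => //; exact: measurable_itv.
  have m0 : 0 < m.+1%:R :> R by rewrite ltr0n.
  apply/seteqP; split=> b.
    move=> kb i _ /=; rewrite -kb ffunE in_itv /=.
    by rewrite ler_pdivrMr// ltr_pdivlMr//; exact: floor_itv.
  move=> h; apply/ffunP => i; rewrite ffunE; apply: floor_def.
  have := h i I; rewrite /= in_itv /= => /andP[h1 h2].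
  by rewrite -ler_pdivrMr// -ltr_pdivlMr// h1 h2.
rewrite (_ : _ @^-1` Y = \bigcup_k ((W s (grid m k) @^-1` Y) `*` cell k)).
  apply: countable_bigcupT_measurable; first exact: countableP.
  move=> k; apply: measurableX => //.
  rewrite -[X in measurable X]setTI.
  exact: (@measurable_funPT _ _ _ _ (W s (grid m k))).
apply/seteqP; split=> [z /= h|z [k _ [/= h1 h2]]].
  by exists (fl m z.2).
by rewrite /= h2.
Qed.

End JointMeasurability.

(** The weights 1 - s and s replace the factor 2 of [msqD], which would be lost anew at each step of
    the next induction. *)
Lemma msqD_weighted (R : realType) (dT : measure_display) (T : measurableType dT)
    (P : probability T R) (s a b : R) (X Y : T -> R) : 0 < s -> s < 1 ->
  measurable_fun setT X -> measurable_fun setT Y ->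
  (msq P X <= ((1 - s) * a)%:E)%E -> (msq P Y <= (s * b)%:E)%E ->
  (msq P (fun w => X w + Y w)%R <= (a + b)%:E)%E.
Proof.
move=> s0 s1 mX mY Xa Yb.
have r0 : 0 < 1 - s by rewrite subr_gt0.
have i0 : 0 <= (1 - s)^-1 by rewrite invr_ge0 ltW.
have i1 : 0 <= s^-1 by rewrite invr_ge0 ltW.
have m2 := @measurable_sqr R _ T.
have m2X : measurable_fun setT (fun w => ((1 - s)^-1%:E * (X w ^+ 2)%:E)%E).
  by apply: emeasurable_funM => //; exact: m2.
have m2Y : measurable_fun setT (fun w => (s^-1%:E * (Y w ^+ 2)%:E)%E).
  by apply: emeasurable_funM => //; exact: m2.
apply: (@le_trans _ _ ((1 - s)^-1%:E * msq P X + s^-1%:E * msq P Y)%E).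
  rewrite /msq -!ge0_integralZl//; try exact: m2;
    try by move=> w _; rewrite lee_fin sqr_ge0.
  rewrite -ge0_integralD//;
    try by move=> w _; rewrite -EFinM lee_fin mulr_ge0// sqr_ge0.
  apply: le_integral_nonneg => w; first by rewrite lee_fin sqr_ge0.
  rewrite -!EFinM -EFinD lee_fin -subr_ge0.
  have -> : (1 - s)^-1 * X w ^+ 2 + s^-1 * Y w ^+ 2 - (X w + Y w) ^+ 2 =
     (s * X w - (1 - s) * Y w) ^+ 2 / (s * (1 - s)).
    by field; rewrite !gt_eqF.
  by rewrite divr_ge0 ?sqr_ge0// ltW// mulr_gt0.
rewrite EFinD; apply: leeD.
  by rewrite lee_pdivrMl// -EFinM.
by rewrite lee_pdivrMl// -EFinM.
Qed.

(** The first increment is split off. With C' = C / (1 - s)^2 the induction closes because C / (1 -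
    s) + s C' = C'. *)
Lemma msq_geometric (R : realType) (dT : measure_display) (T : measurableType dT)
    (P : probability T R) (s C : R) (X : nat -> T -> R) : 0 < s -> s < 1 -> 0 <= C ->
  (forall n, measurable_fun setT (X n)) ->
  (forall n, (msq P (fun w => X n.+1 w - X n w)%R <= (C * s ^+ n * s ^+ n)%:E)%E) ->
  forall m n, (msq P (fun w => X (n + m)%N w - X n w)%R <=
    (C / (1 - s) ^+ 2 * s ^+ n * s ^+ n)%:E)%E.
Proof.
move=> s0 s1 C0 mX hX.
have r0 : 0 < 1 - s by rewrite subr_gt0.
have sn n : 0 <= s ^+ n by rewrite exprn_ge0// ltW.
elim=> [|m IH] n.
  rewrite addn0 /msq; under eq_integral do rewrite subrr expr0n /=.
  by rewrite integral0 lee_fin !mulr_ge0// invr_ge0 exprn_ge0// ltW.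
rewrite (_ : (fun w => X (n + m.+1)%N w - X n w) =
  (fun w => (X n.+1 w - X n w) + (X (n.+1 + m)%N w - X n.+1 w))); last first.
  by apply/funext => w; rewrite addSnnS [RHS]addrC subrKA.
rewrite (_ : (C / (1 - s) ^+ 2 * s ^+ n * s ^+ n)%:E =
  (C / (1 - s) * s ^+ n * s ^+ n + C / (1 - s) ^+ 2 * s * s ^+ n * s ^+ n)%:E); last first.
  by congr EFin; field; rewrite gt_eqF.
apply: (msqD_weighted s0 s1).
- exact: measurable_funB.
- exact: measurable_funB.
- apply: (le_trans (hX n)); rewrite lee_fin le_eqVlt; apply/orP; left; apply/eqP.
  by field; rewrite gt_eqF.
- apply: (le_trans (IH n.+1)); rewrite lee_fin le_eqVlt; apply/orP; left; apply/eqP.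
  by rewrite !exprS; field; rewrite gt_eqF.
Qed.

Lemma is_nonlinear_integral_ext (R : realType) (dO : measure_display)
    (Omega : measurableType dO) (P : probability Omega R) (d : nat)
    (W : R -> 'rV[R]_d -> {RV P >-> R}) (t : R) (phi psi : R -> 'rV[R]_d) Z :
  (forall s, 0 <= s <= t -> phi s = psi s) ->
  is_nonlinear_integral W t phi Z -> is_nonlinear_integral W t psi Z.
Proof.
move=> e [Z2 hZ]; split=> //.
have E eps : integral_dotW W eps t phi = integral_dotW W eps t psi.
  apply/funext => w; apply: eq_Rintegral => s.
  by rewrite inE /= in_itv /= => st; rewrite e.
by under eq_fun do rewrite -E.
Qed.

Lemma enorm_le (R : realType) (d : nat) (x : 'rV[R]_d) (c : R) : 0 <= c ->
  (forall i, `|x 0 i| <= c) -> enorm x <= Num.sqrt d%:R * c.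
Proof.
move=> c0 xc; rewrite /enorm -[X in _ <= _ * X](ger0_norm c0) -sqrtr_sqr -sqrtrM//.
apply: ler_wsqrtr; apply: (@le_trans _ _ (\sum_(i < d) c ^+ 2)).
  by apply: ler_sum => i _; rewrite -[leLHS]real_normK ?num_real// lerXn2r// nnegrE.
by rewrite sumr_const card_ord -[_ *+ _]mulr_natl.
Qed.

(** * Jointly measurable versions of the integral *)

Section Versions.
Context (R : realType) (dO dB : measure_display).
Context (Omega : measurableType dO) (OmegaB : measurableType dB).
Context (P : probability Omega R) (PB : probability OmegaB R).
Context (d : nat) (H alpha C0 rho : R).
Context (Q : 'rV[R]_d -> 'rV[R]_d -> R) (W : R -> 'rV[R]_d -> {RV P >-> R}).
Context (B : 'I_d -> R -> {RV PB >-> R}).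
Hypotheses (H0 : 0 < H) (H1 : H < 1 / 2).
Hypotheses (HQ : covariance_function Q) (HW : gaussian_field H Q W).
Hypothesis HB : standard_brownian_motion B.
Hypotheses (alpha0 : 0 < alpha) (C00 : 0 < C0).
Hypothesis Qhoelder : forall x y,
  Q x x + Q y y - 2 * Q x y <= C0 * enorm (x - y) `^ (2 * alpha).
Hypotheses (rho0 : 0 < rho) (rho1 : rho < 1) (rho2 : 1 < 2 * rho ^+ 2).
Hypothesis rhoH : rho `^ (2 * alpha) * (2 * half_pow H) < 1.
Variables (t : R) (x : 'rV[R]_d).
Hypothesis t0 : 0 < t.

Local Notation kap := (rho `^ (2 * alpha)).

(* The path is extended by a constant beyond time [t], as [B] is only continuous for
   nonnegative times. *)
Definition bpath (b : OmegaB) (s : R) : 'rV[R]_d :=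
  shiftedB B x (Num.max 0 (t - s)) b.

Lemma bpathE b s : 0 <= s <= t -> bpath b s = shiftedB B x (t - s) b.
Proof. by move=> /andP[_ st]; rewrite /bpath max_r// subr_ge0. Qed.

Lemma continuous_bpath b : continuous (bpath b).
Proof.
have main (s : R) : bpath b @ s --> bpath b s.
  apply: cvg_row => j; rewrite /bpath /shiftedB.
  under eq_fun do rewrite !mxE; rewrite !mxE.
  apply: cvgD; first exact: cvg_cst.
  have c1 : (fun r : R => t - r) @ s --> t - s.
    by apply: cvgB; [exact: cvg_cst|exact: cvg_id].
  have c2 := continuous_max0 (@sbm_continuous _ _ _ _ _ _ HB j b).
  exact: (continuous_cvg _ (c2 (t - s)) c1).
exact: main.
Qed.

(** The factor 3 K / (1 - rho) is that of [chaining]. Times at distance 2 [mesh t n] are close only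
    at level n - 1, which costs 1 / rho; sqrt d passes from coordinates to the Euclidean norm. *)
Definition modulus_cst (K : R) : R :=
  C0 * (Num.sqrt d%:R * (3 * K * (1 - rho)^-1 / rho)) `^ (2 * alpha).

Lemma modulus_cst_ge0 K : 0 <= modulus_cst K.
Proof. by rewrite mulr_ge0 ?powR_ge0// ltW. Qed.

Lemma kap_gt0 : 0 < kap. Proof. by rewrite powR_gt0. Qed.

Lemma bpath_modulus K b : 0 <= K -> ~ rough B 0 t K rho b ->
  forall n s r, 0 <= s <= t -> 0 <= r <= t -> `|s - r| <= 2 * mesh t n ->
  cov_dist Q (bpath b s) (bpath b r) <= modulus_cst K * kap ^+ n.
Proof.
move=> K0 brough n s r st rt sr.
pose c := 3 * K * (1 - rho)^-1 / rho.
have c0 : 0 <= c by rewrite divr_ge0 ?(ltW rho0)// !mulr_ge0// invr_ge0 subr_ge0 ltW.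
have rn : 0 <= rho ^+ n by rewrite exprn_ge0// ltW.
have coord i : `|(bpath b s - bpath b r) 0 i| <= c * rho ^+ n.
  rewrite !bpathE// /shiftedB !mxE opprD addrACA subrr add0r.
  pose u := (t - s) / t; pose v := (t - r) / t.
  have tu : t - s = 0 + t * u by rewrite add0r /u mulrC divfK// gt_eqF.
  have tv : t - r = 0 + t * v by rewrite add0r /v mulrC divfK// gt_eqF.
  have u01 : 0 <= u <= 1.
    by case/andP: st => s0 s1; rewrite divr_ge0 ?subr_ge0 ?(ltW t0)//= ler_pdivrMr// mul1r gerBl.
  have v01 : 0 <= v <= 1.
    by case/andP: rt => s0 s1; rewrite divr_ge0 ?subr_ge0 ?(ltW t0)//= ler_pdivrMr// mul1r gerBl.
  have uv : `|u - v| = `|s - r| / t.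
    rewrite /u /v -mulrBl normrM [X in _ * X]ger0_norm; last by rewrite invr_ge0 ltW.
    by rewrite opprB addrC subrKA distrC.
  rewrite tu tv.
  (* Level 0 has no predecessor, but there the rescaled times differ by at most 1 anyway. *)
  case: n sr rn => [|n] sr rn.
    have uv0 : `|u - v| <= 2^-1 ^+ 0.
      by rewrite expr0 ler_norml; move: u01 v01; lra.
    apply: (le_trans (smooth_modulus HB i (lexx 0) t0 K0 rho0 rho1 brough v01 u01 uv0)).
    rewrite !expr0 !mulr1 /c ler_peMr ?invf_ge1 ?(ltW rho1)//.
    by rewrite !mulr_ge0// invr_ge0 subr_ge0 ltW.
  have uvn : `|u - v| <= 2^-1 ^+ n.
    rewrite uv ler_pdivrMr//; apply: (le_trans sr).
    by rewrite /mesh exprS le_eqVlt; apply/orP; left; apply/eqP; field.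
  apply: (le_trans (smooth_modulus HB i (lexx 0) t0 K0 rho0 rho1 brough v01 u01 uvn)).
  rewrite /c exprS le_eqVlt; apply/orP; left; apply/eqP.
  by field; rewrite !gt_eqF// subr_gt0.
apply: (le_trans (Qhoelder _ _)); rewrite /modulus_cst -/c -mulrA ler_wpM2l//; first exact: ltW.
have cn : 0 <= c * rho ^+ n by rewrite mulr_ge0.
have := enorm_le cn coord; rewrite mulrA => h.
have -> : kap ^+ n = (rho ^+ n) `^ (2 * alpha).
  by rewrite -(powR_mulrn n (ltW rho0)) powRAC powR_mulrn// powR_ge0.
have sc : 0 <= Num.sqrt d%:R * c by rewrite mulr_ge0 ?sqrtr_ge0.
rewrite -powRM//; apply: ge0_ler_powR => //.
- by rewrite mulr_ge0// ltW.
- by rewrite nnegrE sqrtr_ge0.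
- by rewrite nnegrE mulr_ge0.
Qed.

(** Paths rough for every K = k + 1 have probability O(1 / k) for all large k: exp(- y) <= 1 / y
    makes the bound of [rough_le] tend to 0, once k is large enough for its hypothesis. *)
Lemma ae_smooth : {ae PB, forall b, exists2 K, 0 <= K & ~ rough B 0 t K rho b}.
Proof.
pose N := \bigcap_(k : nat) rough B 0 t k.+1%:R rho.
have mN : measurable N by apply: bigcapT_measurable => k; exact: measurable_rough.
exists N; split=> //; last first.
  move=> b /= nb k _; apply: contrapT => kb; apply: nb.
  by exists k.+1%:R.
have l1 : 0 < 2 * rho ^+ 2 - 1 by rewrite subr_gt0.
have bnd (k : nat) : 4 * (2 * t) / (2 * rho ^+ 2 - 1) <= k.+1%:R ->
    (PB N <= (4 * d%:R * (2 * t) / k.+1%:R)%:E)%E.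
  move=> hk; set k1 := k.+1%:R.
  have k0 : 0 < k1 by rewrite ltr0n.
  have k11 : 1 <= k1 by rewrite ler1n.
  have z1 : k1 / (2 * t) <= k1 ^+ 2 / (2 * t).
    rewrite ler_pM2r ?invr_gt0 ?mulr_gt0//.
    by rewrite expr2 ler_peMr// ltW.
  have z0 : 0 < k1 / (2 * t) by rewrite divr_gt0// mulr_gt0.
  have ex_le (y : R) : 0 < y -> expR (- y) <= y^-1.
    move=> y0; rewrite expRN lef_pV2 ?posrE ?expR_gt0//.
    by have := expR_ge1Dx y; lra.
  apply: (@le_trans _ _ (PB (rough B 0 t k1 rho))).
    apply: le_measure; rewrite ?inE//; first exact: measurable_rough.
    by move=> b; apply.
  have y0 : 4 <= k1 ^+ 2 / (2 * t) * (2 * rho ^+ 2 - 1).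
    rewrite -ler_pdivrMr//; apply: le_trans z1.
    by rewrite ler_pdivlMr ?mulr_gt0// mulrAC.
  have hexp : expR (- (k1 ^+ 2 / (2 * t) * (2 * rho ^+ 2 - 1))) <= 1 / 4.
    have yp : 0 < k1 ^+ 2 / (2 * t) * (2 * rho ^+ 2 - 1) by exact: lt_le_trans y0.
    by apply: (le_trans (ex_le _ yp)); rewrite div1r lef_pV2 ?posrE.
  apply: (le_trans (rough_le HB (lexx 0) t0 k0 rho0 rho2 hexp)).
  have zp : 0 < k1 ^+ 2 / (2 * t) by exact: lt_le_trans z1.
  rewrite lee_fin -[leRHS]mulrA -[X in _ <= _ * X]invf_div ler_wpM2l ?mulr_ge0//.
  by apply: (le_trans (ex_le _ zp)); rewrite lef_pV2 ?posrE.
apply/eqP; rewrite eq_le measure_ge0 andbT; apply/lee_addgt0Pr => e e0.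
rewrite add0e.
have big (y : R) : exists m : nat, forall k : nat, (m <= k)%N -> y <= k.+1%:R.
  exists (Num.truncn y) => k yk; rewrite ltW//.
  by apply: (lt_le_trans (truncnS_gt y)); rewrite ler_nat.
have [m1 hm1] := big (4 * (2 * t) / (2 * rho ^+ 2 - 1)).
have [m2 hm2] := big (e^-1 * (4 * d%:R * (2 * t))).
apply: (le_trans (bnd (m1 + m2)%N (hm1 _ (leq_addr _ _)))).
rewrite lee_fin ler_pdivrMr// -ler_pdivrMl//.
exact: hm2 (leq_addl _ _).
Qed.

(* A limit superior, since it is jointly measurable in (w, b) without knowing where the
   sums converge. *)
Definition limit_version (z : Omega * OmegaB) : R :=
  fine (limn_esup (fun n => (dyadic_sum W t (bpath z.2) n z.1)%:E)).

Lemma measurable_limit_version : measurable_fun setT limit_version.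
Proof.
apply: measurableT_comp; first exact: fine_measurable.
apply: measurable_fun_limn_esup => n; apply/measurable_EFinP.
have mB (s : R) i : measurable_fun setT (fun b => bpath b s 0 i).
  rewrite /bpath /shiftedB; under eq_fun do rewrite !mxE.
  by apply: measurable_funD => //; exact: measurable_funPT.
apply: measurable_sum => j; apply: measurable_funB.
- exact: (measurable_field_comp HW _ (mB _)).
- exact: (measurable_field_comp HW _ (mB _)).
Qed.

Lemma limit_version_nonlinear K b : 0 <= K -> ~ rough B 0 t K rho b ->
  is_nonlinear_integral W t (bpath b) (fun w => limit_version (w, b)).
Proof.
move=> K0 brough.
have mod := bpath_modulus K0 brough.
have mJ n := measurable_dyadic_sum W t (bpath b) n.
set A := kap * (2 * half_pow H).
have hp0 : 0 < half_pow H by rewrite powR_gt0// invr_gt0.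
have A0 : 0 < A by rewrite mulr_gt0 ?kap_gt0// mulr_gt0.
(* Mean squares of the increments decay like A^n, so L^2 norms decay like s^n, the form used by
   [ae_cvg_of_msq] and [msq_geometric]. *)
pose s := Num.sqrt A.
have s0 : 0 < s by rewrite sqrtr_gt0.
have s1 : s < 1 by rewrite -[ltRHS]sqrtr1 ltr_sqrt.
have ss n : s ^+ n * s ^+ n = A ^+ n by rewrite -exprMn -expr2 sqr_sqrtr// ltW.
pose C := 7 * modulus_cst K * t `^ (2 * H).
have C0' : 0 <= C.
  by rewrite /C mulr_ge0 ?powR_ge0// mulr_ge0// modulus_cst_ge0.
have step n : (msq P (fun w => dyadic_sum W t (bpath b) n.+1 w -
    dyadic_sum W t (bpath b) n w)%R <= (C * s ^+ n * s ^+ n)%:E)%E.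
  apply: (le_trans (dyadic_sum_step H0 H1 HQ HW t0 (modulus_cst_ge0 K) kap_gt0 mod n)).
  by rewrite -(mulrA C) ss.
have mZ : measurable_fun setT (fun w => limit_version (w, b)).
  exact: (measurable_fun_pair1 b measurable_limit_version).
have Jcvg : {ae P, forall w, dyadic_sum W t (bpath b) n w @[n --> \oo] -->
    limit_version (w, b)}.
  have := ae_cvg_of_msq C0' s0 s1 mJ step; apply: filterS => w /cvg_ex[l hl].
  rewrite /limit_version /=.
  have [|_ ->] := @cvg_limn_einf_sup _
    (fun n => (dyadic_sum W t (bpath b) n w)%:E) l%:E; last by [].
  by apply: cvg_EFin => //; exact: nearW.
apply: (dyadic_nonlinear_integral H0 H1 HQ HW t0 (modulus_cst_ge0 K) kap_gt0 rhoH
  mod (@continuous_bpath b) (b := fun n => C / (1 - s) ^+ 2 * s ^+ n * s ^+ n)) => //.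
  under eq_fun => n do rewrite -(mulrA (C / (1 - s) ^+ 2)) ss.
  have : (C / (1 - s) ^+ 2 * A ^+ n) @[n --> \oo] --> C / (1 - s) ^+ 2 * 0.
    by apply: cvgZl_tmp; apply: cvg_expr; rewrite ger0_norm// ltW.
  by rewrite mulr0.
move=> n.
rewrite msqBC; apply: (@msq_fatou _ _ _ P
  (fun m w => dyadic_sum W t (bpath b) m w - dyadic_sum W t (bpath b) n w) _ _ n).
- by move=> m; exact: measurable_funB.
- exact: measurable_funB.
- by apply: filterS Jcvg => w hw; apply: cvgB => //; exact: cvg_cst.
- move=> m nm; rewrite -(subnKC nm).
  exact: (msq_geometric s0 s1 C0' mJ step).
Qed.

Lemma limit_version_is_version : is_integral_version W B t x limit_version.
Proof.
split; first exact: measurable_limit_version.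
apply: filterS ae_smooth => b [K K0 brough].
apply: is_nonlinear_integral_ext (limit_version_nonlinear K0 brough).
exact: bpathE.
Qed.

(** Since a version exists, the one picked by [xget] is one too; afterwards only this property of it
    is used. *)
Lemma integral_versionP : is_integral_version W B t x (integral_version W B t x).
Proof. exact: (xgetPex (cst 0) (ex_intro _ _ limit_version_is_version)). Qed.

Lemma version_dyadic K b Z (e : R) : 0 <= K -> ~ rough B 0 t K rho b ->
  is_nonlinear_integral W t (fun s => shiftedB B x (t - s) b) Z -> 0 < e ->
  \forall n \near \oo, (msq P (fun w => dyadic_sum W t (bpath b) n w - Z w)%R <= e%:E)%E.
Proof.
move=> K0 brough hZ e0.
apply: (nonlinear_integral_dyadic H0 H1 HQ HW t0 (modulus_cst_ge0 K) kap_gt0 rhoH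
  (bpath_modulus K0 brough) (@continuous_bpath b)) => //.
by apply: is_nonlinear_integral_ext hZ => s st; rewrite bpathE.
Qed.

End Versions.

(** * Exponential moments: limits and independent copies *)

Lemma exp_integral_lower (R : realType) (dT : measure_display) (T : measurableType dT)
    (P : probability T R) (X : T -> R) (Y : nat -> T -> R) (a b : R) :
  measurable_fun setT X -> (forall n, measurable_fun setT (Y n)) -> 0 <= b ->
  (forall e : R, 0 < e -> \forall n \near \oo, (msq P (fun w => Y n w - X w)%R <= e%:E)%E) ->
  (\forall n \near \oo, (a%:E <= \int[P]_w (expR (Y n w))%:E)%E) ->
  (\forall n \near \oo, (\int[P]_w (expR (2 * Y n w))%:E <= b%:E)%E) ->
  (a%:E <= \int[P]_w (expR (X w))%:E)%E.
Proof.
move=> mX mY b0 hXY ha hb.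
apply/lee_addgt0Pr => e e0.
(* Chosen so that dl b / 2 <= e / 2, while a mean square of at most e dl, weighted by 1 / (2 dl),
   gives the other e / 2. *)
pose dl := e / (b + 1).
have dl0 : 0 < dl by rewrite divr_gt0// ltr_wpDl.
have ed0 : 0 < e * dl by rewrite mulr_gt0.
have [n [h1 [h2 h3]]] : exists n, (msq P (fun w => Y n w - X w)%R <= (e * dl)%:E)%E /\
   (a%:E <= \int[P]_w (expR (Y n w))%:E)%E /\
   (\int[P]_w (expR (2 * Y n w))%:E <= b%:E)%E.
  apply: (@filter_ex _ (\oo)); near=> n; repeat split; near: n => //.
  exact: hXY.
apply: (le_trans h2).
have mE (Z : T -> R) : measurable_fun setT Z ->
    measurable_fun setT (fun w => (expR (Z w))%:E).
  by move=> mZ; apply/measurable_EFinP; exact: measurableT_comp.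
have mYX : measurable_fun setT (fun w => Y n w - X w)%R by exact: measurable_funB.
have m1 : measurable_fun setT (fun w => ((dl / 2)%:E * (expR (2 * Y n w))%:E)%E).
  by apply: emeasurable_funM => //; apply: mE; exact: measurable_funM.
have m2 : measurable_fun setT (fun w => ((2 * dl)^-1%:E * ((Y n w - X w) ^+ 2)%:E)%E).
  by apply: emeasurable_funM => //; exact: measurable_sqr.
have dh : 0 <= dl / 2 by rewrite divr_ge0// ltW.
have di : 0 <= (2 * dl)^-1 by rewrite invr_ge0 mulr_ge0// ltW.
have p1 w : (0 <= (dl / 2)%:E * (expR (2 * Y n w))%:E)%E.
  by rewrite -EFinM lee_fin mulr_ge0// expR_ge0.
have p2 w : (0 <= (2 * dl)^-1%:E * ((Y n w - X w) ^+ 2)%:E)%E.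
  by rewrite -EFinM lee_fin mulr_ge0// sqr_ge0.
apply: (@le_trans _ _ (\int[P]_w ((expR (X w))%:E +
   ((dl / 2)%:E * (expR (2 * Y n w))%:E + (2 * dl)^-1%:E * ((Y n w - X w) ^+ 2)%:E)))%E).
  apply: le_integral_nonneg => w; first by rewrite lee_fin expR_ge0.
  rewrite -!EFinM -!EFinD lee_fin.
  (* e^x + dl/2 e^(2y) + (y - x)^2 / (2 dl) >= e^y: bound e^x below by
     e^y (1 + x - y) and complete the square. *)
  set x := X w; set y := Y n w.
  have ex : expR y * (1 + (x - y)) <= expR x.
    rewrite -{2}(subrK y x) expRD mulrC ler_wpM2r ?expR_ge0//.
    exact: expR_ge1Dx.
  have -> : expR (2 * y) = expR y ^+ 2 by rewrite mulr_natl mulr2n expRD expr2.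
  have : 0 <= (dl * expR y - (y - x)) ^+ 2 / (2 * dl).
    by rewrite divr_ge0 ?sqr_ge0// mulr_ge0// ltW.
  have -> : (dl * expR y - (y - x)) ^+ 2 / (2 * dl) =
     dl / 2 * expR y ^+ 2 - expR y * (y - x) + (2 * dl)^-1 * (y - x) ^+ 2.
    by field; rewrite gt_eqF.
  lra.
have p3 w : (0 <= (expR (X w))%:E)%E by rewrite lee_fin expR_ge0.
have p4 w : (0 <= (expR (2 * Y n w))%:E)%E by rewrite lee_fin expR_ge0.
have p5 w : (0 <= ((Y n w - X w) ^+ 2)%:E)%E by rewrite lee_fin sqr_ge0.
have m3 := mE _ mX.
have m4 : measurable_fun setT (fun w => (expR (2 * Y n w))%:E).
  by apply: mE; exact: measurable_funM.
have m5 := measurable_sqr mYX.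
rewrite (ge0_integralD P measurableT (fun w _ => p3 w) m3 (fun w _ => adde_ge0 (p1 w) (p2 w))
  (emeasurable_funD m1 m2)).
apply: leeD => //; rewrite (ge0_integralD P measurableT (fun w _ => p1 w) m1 (fun w _ => p2 w) m2).
rewrite (ge0_integralZl P measurableT m4)// (ge0_integralZl P measurableT m5)//.
rewrite [e]splitr EFinD; apply: leeD.
  apply: (@le_trans _ _ ((dl / 2)%:E * b%:E)%E); first by rewrite lee_wpmul2l// lee_fin.
  rewrite -EFinM lee_fin /dl -(ler_pM2l (_ : 0 < 2 * (b + 1))); last first.
    by rewrite mulr_gt0// ltr_wpDl.
  have b1 : b + 1 != 0 by rewrite gt_eqF// ltr_wpDl.
  have -> : 2 * (b + 1) * (e / (b + 1) / 2 * b) = e * b by field.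
  have -> : 2 * (b + 1) * (e / 2) = e * b + e by field.
  by rewrite lerDl ltW.
apply: (@le_trans _ _ ((2 * dl)^-1%:E * (e * dl)%:E)%E).
  by rewrite lee_wpmul2l// lee_fin.
rewrite -EFinM lee_fin le_eqVlt; apply/orP; left; apply/eqP.
by field; rewrite gt_eqF.
Unshelve. all: by end_near. Qed.

(** The list s holds the paths already drawn, so no k-fold product of T2 has to be formed;
    integrating over G alone lets the hypothesis concern good paths only. *)
Lemma integral_power_ge (R : realType) (d1 d2 : measure_display)
    (T1 : measurableType d1) (T2 : measurableType d2)
    (P1 : probability T1 R) (P2 : probability T2 R) (J : T1 * T2 -> R)
    (G : set T2) (a : nat -> R) :
  measurable_fun setT J -> measurable G -> (forall n, 0 <= a n) ->
  (forall s : seq T2, (forall b, b \in s -> G b) ->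
    ((a (size s))%:E <= \int[P1]_w (expR (\sum_(b <- s) J (w, b)))%:E)%E) ->
  forall k (s : seq T2), (forall b, b \in s -> G b) ->
  (P2 G ^+ k * (a (size s + k)%N)%:E <= \int[P1]_w ((expR (\sum_(b <- s) J (w, b)))%:E *
    (\int[P2]_b (expR (J (w, b)) * \1_G b)%:E) ^+ k))%E.
Proof.
move=> mJ mG a0 hV.
have mI : measurable_fun setT (fun z : T1 * T2 => (expR (J z) * \1_G z.2)%:E).
  apply/measurable_EFinP; apply: measurable_funM; first exact: measurableT_comp.
  exact: (measurableT_comp (measurable_indic mG) measurable_snd).
have I0 z : (0 <= (expR (J z) * \1_G z.2)%:E)%E.
  by rewrite lee_fin mulr_ge0 ?expR_ge0.
pose F w : \bar R := (\int[P2]_b (expR (J (w, b)) * \1_G b)%:E)%E.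
have F0 w : (0 <= F w)%E by apply: integral_ge0 => b _; exact: (I0 (w, b)).
have mF : measurable_fun setT F by exact: (measurable_fun_fubini_tonelli_F _ mI I0).
have mFk k : measurable_fun setT (fun w => (F w ^+ k)%E).
  elim: k => [|k IH]; first exact: measurable_cst.
  under eq_fun do rewrite expeS.
  exact: emeasurable_funM.
have Fk0 w k : (0 <= F w ^+ k)%E by exact: expe_ge0.
have mS (s : seq T2) : measurable_fun setT (fun w => (expR (\sum_(b <- s) J (w, b)))%:E).
  apply/measurable_EFinP; apply: measurableT_comp => //.
  by apply: measurable_sum => b; exact: (measurable_fun_pair1 b mJ).
(* Tonelli's theorem trades one power of the inner integral for one more path in s. *)
elim=> [|k IH] s sG.
  rewrite expe0 mul1e addn0; under eq_integral do rewrite expe0 mule1.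
  exact: hV.
pose h (z : T1 * T2) := ((expR (\sum_(b <- s) J (z.1, b)))%:E * F z.1 ^+ k *
  (expR (J z) * \1_G z.2)%:E)%E.
have h0 z : (0 <= h z)%E by rewrite !mule_ge0// lee_fin expR_ge0.
have mh : measurable_fun setT h.
  apply: emeasurable_funM => //.
  exact: (measurableT_comp (emeasurable_funM (mS s) (mFk k)) measurable_fst).
have -> : (\int[P1]_w ((expR (\sum_(b <- s) J (w, b)))%:E * F w ^+ k.+1) =
    \int[P1]_w \int[P2]_b h (w, b))%E.
  apply: eq_integral => w _; rewrite expeS /h /= ge0_integralZl//.
  - by rewrite -/(F w) (muleC (F w)) muleA.
  - exact: (measurable_fun_pair2 w mI).
  - by rewrite mule_ge0// lee_fin expR_ge0.
rewrite (fubini_tonelli _ mh h0) addnS.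
apply: (@le_trans _ _ (\int[P2]_b (P2 G ^+ k * (a (size s + k).+1)%:E * (\1_G b)%:E))%E).
  rewrite ge0_integralZl//; last 2 first.
  - by apply/measurable_EFinP; exact: measurable_indic.
  - by rewrite mule_ge0 ?expe_ge0 ?measure_ge0// lee_fin.
  by rewrite integral_indic// setIT expeS (muleC (P2 G)) -!muleA (muleC (P2 G)).
apply: le_integral_nonneg => b.
  by rewrite !mule_ge0 ?expe_ge0 ?measure_ge0// lee_fin.
rewrite indicE; case: (boolP (b \in G)) => [bG|bG] /=; last first.
  by rewrite mule0; apply: integral_ge0 => w _; exact: h0.
rewrite mule1 -addSn; apply: (le_trans (IH (b :: s) _)).
  by move=> c; rewrite inE => /orP[/eqP ->|]; [exact: set_mem|exact: sG].
rewrite le_eqVlt; apply/orP; left; apply/eqP; apply: eq_integral => w _.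
rewrite /h /= indicE bG mulr1 big_cons expRD EFinM -/(F w).
by rewrite -muleA muleC.
Qed.

Lemma ler_sum_size (R : realDomainType) (T : eqType) (s : seq T) (f : T -> R) (c : R) :
  (forall b, b \in s -> c <= f b) -> (size s)%:R * c <= \sum_(b <- s) f b.
Proof.
elim: s => [|b s IH] h; first by rewrite mul0r big_nil.
rewrite big_cons /= -natr1 mulrDl mul1r addrC lerD ?h ?mem_head//.
by apply: IH => b' b's; rewrite h// inE b's orbT.
Qed.

Lemma lee_expe (R : realType) (a b : \bar R) k : (0 <= a)%E -> (a <= b)%E ->
  (a ^+ k <= b ^+ k)%E.
Proof.
move=> a0 ab; elim: k => [|k IH]; first by rewrite !expe0.
by rewrite !expeS lee_pmul// expe_ge0.
Qed.

(** * Moment lower bound *)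

Section Moments.
Context (R : realType) (dO dB : measure_display).
Context (Omega : measurableType dO) (OmegaB : measurableType dB).
Context (P : probability Omega R) (PB : probability OmegaB R).
Context (d : nat) (H alpha C0 rho : R).
Context (Q : 'rV[R]_d -> 'rV[R]_d -> R) (W : R -> 'rV[R]_d -> {RV P >-> R}).
Context (B : 'I_d -> R -> {RV PB >-> R}).
Hypotheses (H0 : 0 < H) (H1 : H < 1 / 2).
Hypotheses (HQ : covariance_function Q) (HW : gaussian_field H Q W).
Hypothesis HB : standard_brownian_motion B.
Hypotheses (alpha0 : 0 < alpha) (C00 : 0 < C0).
Hypothesis Qhoelder : forall x y,
  Q x x + Q y y - 2 * Q x y <= C0 * enorm (x - y) `^ (2 * alpha).
Hypotheses (rho0 : 0 < rho) (rho1 : rho < 1) (rho2 : 1 < 2 * rho ^+ 2).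
Hypothesis rhoH : rho `^ (2 * alpha) * (2 * half_pow H) < 1.
Variables (t : R) (x : 'rV[R]_d).
Hypothesis t0 : 0 < t.

Local Notation path := (bpath B t x).

Section Version.
Variable J : Omega * OmegaB -> R.
Hypothesis mJ : measurable_fun setT J.

Definition good_path (b : OmegaB) : Prop :=
  (exists2 K, 0 <= K & ~ rough B 0 t K rho b) /\
  is_nonlinear_integral W t (fun s => shiftedB B x (t - s) b) (fun w => J (w, b)).

Definition paths_sum (s : seq OmegaB) (n : nat) (w : Omega) : R :=
  \sum_(b <- s) dyadic_sum W t (path b) n w.

Lemma paths_sum_comb s n : paths_sum s n = comb W (steps
  (fun j : 'I_(2 ^ n) => j%:R * mesh t n) (fun j => j.+1%:R * mesh t n)
  (fun j => [seq (1, path b (j%:R * mesh t n)) | b <- s])).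
Proof.
apply/funext => w; rewrite comb_steps.
under [RHS]eq_bigr do rewrite big_map.
rewrite exchange_big /=; apply: eq_bigr => b _.
by apply: eq_bigr => j _; rewrite mul1r.
Qed.

Lemma measurable_paths_sum s n : measurable_fun setT (paths_sum s n).
Proof. by apply: measurable_sum => b; exact: measurable_dyadic_sum. Qed.

Lemma measurable_version_sum (s : seq OmegaB) :
  measurable_fun setT (fun w => \sum_(b <- s) J (w, b)).
Proof. by apply: measurable_sum => b; exact: (measurable_fun_pair1 b mJ). Qed.

Lemma paths_sum_cvg s : (forall b, b \in s -> good_path b) -> forall e : R, 0 < e ->
  \forall n \near \oo,
    (msq P (fun w => paths_sum s n w - \sum_(b <- s) J (w, b))%R <= e%:E)%E.
Proof.
elim: s => [|b s IH] sg e e0.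
  apply: nearW => n; rewrite /msq /paths_sum.
  under eq_integral do rewrite !big_nil subrr expr0n /=.
  by rewrite integral0 lee_fin ltW.
have e4 : 0 < e / 4 by rewrite divr_gt0.
have [[K K0 bK] bJ] := sg b (mem_head _ _).
have h1 := version_dyadic H0 H1 HQ HW HB alpha0 C00 Qhoelder rho0 rho1 rhoH t0 K0 bK bJ e4.
have sg' b' : b' \in s -> good_path b' by move=> b's; apply: sg; rewrite inE b's orbT.
apply: filterS2 h1 (IH sg' _ e4) => n hb hs.
rewrite (_ : (fun w => _) = (fun w => (dyadic_sum W t (path b) n w - J (w, b)) +
    (paths_sum s n w - \sum_(b <- s) J (w, b)))); last first.
  by apply/funext => w; rewrite /paths_sum !big_cons; ring.
apply: (le_trans (msqD _ _ _)).
- apply: measurable_funB; first exact: measurable_dyadic_sum.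
  exact: (measurable_fun_pair1 b mJ).
- apply: measurable_funB; first exact: measurable_paths_sum.
  exact: measurable_version_sum.
apply: (@le_trans _ _ (2%:E * (e / 4)%:E + 2%:E * (e / 4)%:E)%E).
  by apply: leeD; rewrite lee_wpmul2l// lee_fin.
by rewrite -!EFinM -EFinD lee_fin; lra.
Qed.

(** For n >= q the time [mesh t q] is a grid point of level n, so [bil_steps_ge] applies; all pairs
    of paths contribute to the form of Q, whence the square of the size. [exp_integral_lower] passes
    to the limit. *)
Lemma exp_version_sum_ge (s : seq OmegaB) (q : nat) (g : R) : 0 <= g ->
  (forall b, b \in s -> good_path b) ->
  (forall b b', b \in s -> b' \in s -> forall r, 0 <= r <= mesh t q ->
     g <= Q (path b r) (path b' r)) ->
  ((expR ((size s)%:R ^+ 2 * g * (2^-1 * mesh t q `^ (2 * H)) / 8))%:E <=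
    \int[P]_w (expR (\sum_(b <- s) J (w, b)))%:E)%E.
Proof.
move=> g0 sg Qg.
have cvg := paths_sum_cvg sg.
have [n0 _ hn0] := cvg 1 ltr01.
pose l n := steps (fun j : 'I_(2 ^ n) => j%:R * mesh t n) (fun j => j.+1%:R * mesh t n)
  (fun j => [seq (1, path b (j%:R * mesh t n)) | b <- s]).
pose V n := bil (field_cov H Q) (l n) (l n).
have mY := measurable_paths_sum s; have mX := measurable_version_sum s.
(* Beyond n0 the sums differ from the one at n0 by at most 4 in mean square. This bounds their
   variances, and so their second exponential moments, uniformly in n. *)
have hV n : (n0 <= n)%N -> V n <= 8 + 2 * V n0.
  move=> nn; rewrite -lee_fin -(msq_comb HW) -paths_sum_comb.
  rewrite (_ : paths_sum s n =
    (fun w => (paths_sum s n w - paths_sum s n0 w) + paths_sum s n0 w)); last first.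
    by apply/funext => w; rewrite subrK.
  apply: (le_trans (msqD _ _ _)) => //; first exact: measurable_funB.
  rewrite [leRHS]EFinD (EFinM 2 (V n0)) -(msq_comb HW) -paths_sum_comb.
  apply: leeD => //.
  apply: (@le_trans _ _ (2%:E * (2 * 1 + 2 * 1)%:E)%E); last first.
    by rewrite -EFinM lee_fin; lra.
  rewrite lee_wpmul2l//; apply: (msqB_trans (mY n) mX (mY n0)); first exact: hn0.
  by rewrite msqBC; apply: hn0 => /=.
apply: (@exp_integral_lower _ _ _ P _ (paths_sum s) _ (expR (16 * (8 + 2 * V n0)))) => //.
- exists q => // n /= qn; rewrite paths_sum_comb.
  apply: (le_trans _ (comb_exp_ge HW _)); rewrite lee_fin ler_expR ler_pM2r//.
  have m0 : 0 < mesh t n by rewrite mulr_gt0// exprn_gt0// invr_gt0.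
  have e : mesh t q = (2 ^ (n - q))%:R * mesh t n.
    have en : 2^-1 ^+ n = 2^-1 ^+ (n - q) * 2^-1 ^+ q :> R by rewrite -exprD subnK.
    rewrite /mesh en natrX !exprVn; field.
    by rewrite !expf_neq0// pnatr_eq0.
  rewrite e.
  apply: (bil_steps_ge H0 H1 HQ (p := fun j => j%:R * mesh t n) (T := t)).
  + by move=> j; rewrite ler_pM2r// ler_nat.
  + by rewrite mul0r.
  + rewrite /mesh natrX exprVn mulrCA mulfV ?mulr1//.
  + by rewrite leq_exp2l// leq_subr.
  + by rewrite mulr_ge0// exprn_ge0.
  + move=> j jn; rewrite /bil big_map expr2 -mulrA.
    apply: ler_sum_size => b bs; rewrite big_map /=.
    apply: ler_sum_size => b' b's; rewrite !mul1r.
    apply: Qg => //; apply/andP; split; first by rewrite mulr_ge0// ltW.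
    by rewrite e ler_pM2r// ler_nat ltnW.
- exists n0 => // n /= nn; rewrite paths_sum_comb.
  apply: (le_trans (comb_exp2_le HW _)); rewrite lee_fin ler_expR ler_pM2l//.
  exact: hV.
Qed.

End Version.

Lemma moment_lower (A : set OmegaB) (q : nat) (g c : R) (u0 : 'rV[R]_d -> R) (k : nat) :
  measurable A -> 0 <= g -> 0 < c -> (forall y, c <= u0 y) ->
  (forall b b', A b -> A b' -> forall r, 0 <= r <= mesh t q ->
     g <= Q (path b r) (path b' r)) ->
  (PB A ^+ k * (c ^+ k * expR (k%:R ^+ 2 * g * (2^-1 * mesh t q `^ (2 * H)) / 8))%:E <=
    \int[P]_w (feynman_kac W B u0 t x w ^+ k))%E.
Proof.
move=> mA g0 c0 u0c AQ.
set J := integral_version W B t x.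
have [mJ vJ] : is_integral_version W B t x J.
  exact: (integral_versionP H0 H1 HQ HW HB alpha0 C00 Qhoelder rho0 rho1 rho2 rhoH x t0).
have [N [mN N0 hN]] : {ae PB, forall b, good_path J b}.
  apply: filterS2 vJ (ae_smooth HB rho0 rho2 t0) => b; split=> //.
pose G := A `\` N.
have mG : measurable G by exact: measurableD.
have Ggood b : G b -> good_path J b.
  by move=> [_ Nb]; apply: contrapT => ng; apply: Nb; apply: hN.
have AG : (PB A <= PB G)%E.
  apply: (@le_trans _ _ (PB (G `|` N))).
    apply: le_measure; rewrite ?inE//; first exact: measurableU.
    by move=> b Ab; case: (pselect (N b)) => Nb; [right|left].
  apply: (le_trans (measureU2 _ mG mN)).
  by rewrite -[leRHS]adde0 leeD2l// le_eqVlt; apply/orP; left; apply/eqP.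
(* Shifting the exponent absorbs the lower bound c of u0, one factor per path. *)
pose J' z := J z + ln c.
have cE (y : R) : expR (y + ln c) = c * expR y by rewrite expRD lnK ?posrE// mulrC.
pose a n := c ^+ n * expR (n%:R ^+ 2 * g * (2^-1 * mesh t q `^ (2 * H)) / 8).
have mJ' : measurable_fun setT J' by exact: measurable_funD.
have := @integral_power_ge _ _ _ _ _ P PB J' G a mJ' mG.
move=> /(_ _ _ k [::]) h.
apply: (@le_trans _ _ (PB G ^+ k * (a k)%:E)%E).
  rewrite lee_wpmul2r ?lee_expe//; last by rewrite lee_fin mulr_ge0 ?expR_ge0// exprn_ge0// ltW.
apply: (le_trans (h _ _ _)).
- by move=> n; rewrite mulr_ge0 ?expR_ge0// exprn_ge0// ltW.
- move=> s sG.
  have sgood b : b \in s -> good_path J b by move=> /sG; exact: Ggood.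
  have sQ b b' : b \in s -> b' \in s -> forall r, 0 <= r <= mesh t q ->
      g <= Q (path b r) (path b' r).
    by move=> /sG[Ab _] /sG[Ab' _]; exact: AQ.
  have key := exp_version_sum_ge mJ g0 sgood sQ.
  rewrite (_ : (fun w => _) = (fun w => (c ^+ size s)%:E *
     (expR (\sum_(b <- s) J (w, b)))%:E)%E); last first.
    apply/funext => w; rewrite -EFinM; congr EFin; rewrite /J'.
    elim: (s) => [|b s' IH]; first by rewrite !big_nil mul1r.
    rewrite !big_cons expRD IH cE expRD /= exprS; ring.
  rewrite ge0_integralZl//.
  + by rewrite /a EFinM lee_wpmul2l// lee_fin exprn_ge0// ltW.
  + apply/measurable_EFinP; apply: measurableT_comp => //.
    exact: measurable_version_sum.
  + by rewrite lee_fin exprn_ge0// ltW.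
- by [].
apply: le_integral_nonneg => w.
  rewrite big_nil expR0 mul1e expe_ge0//; apply: integral_ge0 => b _.
  by rewrite lee_fin mulr_ge0// expR_ge0.
rewrite big_nil expR0 mul1e; apply: lee_expe.
  by apply: integral_ge0 => b _; rewrite lee_fin mulr_ge0// expR_ge0.
rewrite /feynman_kac unlock; apply: le_integral_nonneg => b.
  by rewrite lee_fin mulr_ge0// expR_ge0.
rewrite lee_fin /J' cE -/J.
apply: (@le_trans _ _ (c * expR (J (w, b)))).
  rewrite ler_piMr ?mulr_ge0 ?expR_ge0 ?(ltW c0)// indicE lern1 leq_b1.
by rewrite ler_wpM2r// expR_ge0.
Qed.

End Moments.

Lemma lee_prod_cst (R : realType) (I : finType) (f : I -> \bar R) (c : R) : 0 <= c ->
  (forall i, (c%:E <= f i)%E) -> ((c ^+ #|I|)%:E <= \prod_i f i)%E.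
Proof.
move=> c0 cf; rewrite -prodr_const -prodEFin.
have : (0%:E <= \prod_(i : I) c%:E)%E /\ (\prod_(i : I) c%:E <= \prod_i f i)%E.
  elim/big_rec2: _ => [|i y1 y2 _ [IH0 IH]]; first by rewrite lee_fin.
  by split; [rewrite mule_ge0|rewrite lee_pmul].
by case.
Qed.

(** * Probability that a Brownian path is high near time t *)

Section GoodEvent.
Context (R : realType) (dB : measure_display) (OmegaB : measurableType dB).
Context (PB : probability OmegaB R) (d : nat) (B : 'I_d -> R -> {RV PB >-> R}).
Hypothesis HB : standard_brownian_motion B.

Definition high (s a : R) : set OmegaB := [set b | forall i, a <= B i s b].

Lemma high_bigcap s a : high s a = \bigcap_i (B i s @^-1` `[a, +oo[).
Proof.
apply/seteqP; split=> b h i; first by rewrite /= in_itv /= andbT; move=> _; exact: h.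
by have := h i I; rewrite /= in_itv /= andbT.
Qed.

Lemma measurable_high s a : measurable (high s a).
Proof.
rewrite high_bigcap; apply: fin_bigcap_measurable => // i _.
rewrite -[X in measurable X]setTI.
have mI : measurable (`[a, +oo[%classic : set R) by exact: measurable_itv.
exact: (@measurable_funPT _ _ _ _ (B i s)).
Qed.

(** Independence reduces this to one coordinate, where [normal_rv_tail] applies: (a + r)^2 / (2 s)
    <= a^2 / s + 1 with r^2 = s, and sqrt(2 pi) <= exp 2, whence 3 = 1 + 2. *)
Lemma high_ge (s a : R) : 0 < s -> 0 <= a ->
  ((expR (- (a ^+ 2 / s + 3)) ^+ d)%:E <= PB (high s a))%E.
Proof.
move=> s0 a0.
pose g (n : nat) : R := if n is 0%N then 0 else s.
have gm j : g j <= g j.+1 by case: j => //=; exact: ltW.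
have ind := @sbm_independent _ _ _ _ _ _ HB 1 g (lexx 0) gm.
have -> : high s a = \bigcap_(ij : 'I_d * 'I_1)
    ((fun w => B ij.1 (g ij.2.+1) w - B ij.1 (g ij.2) w) @^-1` `[a, +oo[).
  rewrite high_bigcap; apply/seteqP; split=> b h.
    move=> [i j] _; rewrite /= ord1 /= (sbm0 HB) subr0; exact: h.
  by move=> i _; have := h (i, ord0) I; rewrite /= (sbm0 HB) subr0.
rewrite (ind (fun=> `[a, +oo[%classic)); last by move=> i; exact: measurable_itv.
rewrite -[X in _ ^+ X](_ : #|{: 'I_d * 'I_1}| = d); last by rewrite card_prod !card_ord muln1.
apply: lee_prod_cst; first exact: expR_ge0.
move=> [i j]; rewrite ord1 /=.
have rs : 0 < Num.sqrt (s - 0) by rewrite subr0 sqrtr_gt0.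
apply: (le_trans _ (@normal_rv_tail _ _ _ PB _ (B i s \- B i 0)%R _ rs a0
  (sbm_normal HB i (lexx 0) (ltW s0)))).
rewrite lee_fin subr0 sqr_sqrtr ?(ltW s0)//.
set r := Num.sqrt s; have r2 : r ^+ 2 = s by rewrite sqr_sqrtr// ltW.
have p0 : 0 < Num.sqrt (pi *+ 2 : R) by rewrite sqrtr_gt0 mulrn_wgt0// pi_gt0.
have p3 : Num.sqrt (pi *+ 2) <= expR 2 :> R.
  apply: (@le_trans _ _ 3); last by have := expR_ge1Dx (2 : R); lra.
  rewrite -[leRHS](ger0_norm (_ : 0 <= 3))// -sqrtr_sqr ler_wsqrtr//.
  have := pihalf_lt2 R; rewrite -[_ *+ 2]mulr_natl expr2; lra.
rewrite ler_pdivlMr//.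
apply: (@le_trans _ _ (expR (- (a ^+ 2 / s + 3)) * expR 2)).
  by rewrite ler_pM2l ?expR_gt0.
rewrite -expRD ler_expR opprD -addrA.
have -> : (a + r) ^+ 2 / (s *+ 2) = a ^+ 2 / s + 1 - (a - r) ^+ 2 / (s *+ 2).
  rewrite -[s *+ 2]mulr_natl -r2; field.
  by rewrite sqrtr_eq0 -ltNge.
have : 0 <= (a - r) ^+ 2 / (s *+ 2) by rewrite divr_ge0 ?sqr_ge0// mulrn_wge0// ltW.
lra.
Qed.

Variable rho : R.
Hypotheses (rho0 : 0 < rho) (rho1 : rho < 1) (rho2 : 1 < 2 * rho ^+ 2).

(* With this threshold the oscillation allowed by [smooth_modulus] over the last
   [mesh t q] units of time is a / 2. *)
Definition good_event (t : R) (q : nat) (a : R) : set OmegaB :=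
  high (t - mesh t q) a `\` rough B (t - mesh t q) (mesh t q) (a * (1 - rho) / 6) rho.

Lemma measurable_good_event t q a : measurable (good_event t q a).
Proof. by apply: measurableD; [exact: measurable_high|exact: measurable_rough]. Qed.

Lemma mesh_bounds (t : R) q : 0 < t -> (0 < q)%N -> 0 < mesh t q <= t / 2.
Proof.
move=> t0 q0; rewrite mulr_gt0 ?exprn_gt0 ?invr_gt0//= ler_pM2l//.
case: q q0 => // q _; rewrite exprS ler_piMr// exprn_ile1 ?invr_ge0//.
by rewrite invf_le1// ler1n.
Qed.

Lemma good_event_lower t q a b i r : 0 < t -> (0 < q)%N -> 0 < a -> good_event t q a b ->
  0 <= r <= mesh t q -> a / 2 <= B i (t - r) b.
Proof.
move=> t0 q0 a0 [hb sb] /andP[r0 rq].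
have /andP[m0 m1] := mesh_bounds t0 q0.
have tm0 : 0 <= t - mesh t q by lra.
have K0 : 0 <= a * (1 - rho) / 6.
  by rewrite divr_ge0// mulr_ge0 ?(ltW a0)// subr_ge0 ltW.
pose v := (mesh t q - r) / mesh t q.
have v01 : 0 <= v <= 1.
  by rewrite divr_ge0 ?subr_ge0 ?(ltW m0)//= ler_pdivrMr// mul1r gerBl.
have vu : `|v - 0| <= 2^-1 ^+ 0 by rewrite subr0 expr0 ger0_norm; case/andP: v01.
have := smooth_modulus HB i tm0 m0 K0 rho0 rho1 sb (introT andP (conj (lexx 0) ler01)) v01 vu.
have -> : t - mesh t q + mesh t q * v = t - r by rewrite /v; field; rewrite gt_eqF.
rewrite mulr0 addr0 expr0 mulr1.
have -> : 3 * (a * (1 - rho) / 6) * (1 - rho)^-1 = a / 2.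
  by field; rewrite subr_eq0 gt_eqF.
rewrite ler_distl => /andP[h _].
have := hb i; lra.
Qed.

Lemma good_event_ge : exists2 q : nat, (0 < q)%N & forall t a : R, 0 < t -> 0 < a ->
  1 <= a ^+ 2 / t -> ((expR (- ((5 * d%:R + 1) * (a ^+ 2 / t))))%:E <= PB (good_event t q a))%E.
Proof.
have l0 : 0 < 2 * rho ^+ 2 - 1 by rewrite subr_gt0.
(* With y = a^2 / t, being high has probability at least exp(-5 d y) whatever q, while
   being rough has probability at most 4 d exp(-lam 2^q y): take q large. *)
pose lam := (1 - rho) ^+ 2 / 72.
have lam0 : 0 < lam by rewrite divr_gt0// exprn_gt0// subr_gt0.
(* 13 d leaves mu - 5 d >= 8 d, enough for 4 d exp(- mu y) <= exp(- 5 d y) / 2; the other summand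
   gives mu (2 rho^2 - 1) >= 3, and exp(- 3) <= 1/4 is what [rough_le] asks for. *)
pose z := (13 * d%:R + 3 / (2 * rho ^+ 2 - 1)) / lam.
have [q q0 zq] : exists2 q, (0 < q)%N & z <= 2 ^+ q.
  exists (Num.truncn z).+1 => //; apply: ltW; apply: (lt_le_trans (truncnS_gt z)).
  by rewrite -natrX ler_nat ltnW// ltn_expl.
exists q => // t a t0 a0; set y := a ^+ 2 / t => y1.
have y0 : 0 < y by exact: lt_le_trans y1.
have /andP[m0 m1] := mesh_bounds t0 q0.
have s0 : 0 < t - mesh t q by lra.
pose mu := lam * 2 ^+ q.
have muz : 13 * d%:R + 3 / (2 * rho ^+ 2 - 1) <= mu.
  by rewrite /mu -ler_pdivrMl// mulrC.
have d0 : 0 <= d%:R :> R by [].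
have r3 : 0 <= 3 / (2 * rho ^+ 2 - 1) by rewrite divr_ge0// ltW.
have mu_d : 13 * d%:R <= mu by lra.
have mu_r : 3 <= mu * (2 * rho ^+ 2 - 1).
  by rewrite -ler_pdivrMr//; apply: le_trans muz; rewrite lerDr mulr_ge0.
set E := high (t - mesh t q) a.
set N := rough B (t - mesh t q) (mesh t q) (a * (1 - rho) / 6) rho.
have K0 : 0 < a * (1 - rho) / 6 by rewrite divr_gt0// mulr_gt0// subr_gt0.
have Ky : (a * (1 - rho) / 6) ^+ 2 / (2 * mesh t q) = mu * y.
  rewrite /mu /lam /y /mesh exprVn; field.
  by rewrite gt_eqF// expf_neq0// pnatr_eq0.
have PN : (PB N <= (4 * d%:R * expR (- (mu * y)))%:E)%E.
  have := rough_le HB (ltW s0) m0 K0 rho0 rho2; rewrite Ky; apply.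
  apply: (@le_trans _ _ (expR (- 3))).
    rewrite ler_expR lerN2 mulrAC -[leLHS]mulr1.
    by apply: ler_pM => //; exact: ltW.
  rewrite expRN div1r lef_pV2 ?posrE ?expR_gt0//.
  by have := expR_ge1Dx (3 : R); lra.
(* Since t - [mesh t q] >= t / 2, the exponent a^2 / (t - [mesh t q]) is at most 2 y, and 3 <= 3 y
   because y >= 1: hence 5. *)
have PE : ((expR (- (5 * d%:R * y)))%:E <= PB E)%E.
  apply: (le_trans _ (high_ge s0 (ltW a0))).
  rewrite -expRM_natl lee_fin ler_expR mulrN lerN2.
  have : a ^+ 2 / (t - mesh t q) <= 2 * y.
    rewrite /y mulrCA ler_pM2l ?exprn_gt0// -invf_div lef_pV2 ?posrE ?divr_gt0//.
    lra.
  move=> h; rewrite -mulrA mulrCA ler_wpM2l//.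
  lra.
have mE := measurable_high (t - mesh t q) a.
have mA := measurable_good_event t q a.
have mN : measurable N by exact: measurable_rough.
have sub : (PB E <= PB (good_event t q a) + PB N)%E.
  apply: (le_trans _ (measureU2 _ mA mN)); apply: le_measure; rewrite ?inE//.
    exact: measurableU.
  by move=> b Eb; case: (pselect (N b)) => Nb; [right|left].
have := le_trans PE (le_trans sub (leeD (lexx _) PN)).
have : (PB (good_event t q a) \is a fin_num)%E by exact: fin_num_measure.
move=> /fineK <-; rewrite -EFinD !lee_fin.
set p := fine _ => h.
have e1 : expR (- ((5 * d%:R + 1) * y)) <= expR (- (5 * d%:R * y)) / 2.
  rewrite mulrDl mul1r opprD expRD ler_wpM2l ?expR_ge0//.
  rewrite expRN lef_pV2 ?posrE ?expR_gt0//.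
  by have := expR_ge1Dx y; lra.
have e2 : 4 * d%:R * expR (- (mu * y)) <= expR (- (5 * d%:R * y)) / 2.
  have -> : - (mu * y) = - (5 * d%:R * y) + - ((mu - 5 * d%:R) * y) by ring.
  rewrite expRD mulrCA ler_wpM2l ?expR_ge0//.
  rewrite expRN ler_pdivrMr ?expR_gt0// ler_pdivlMl//.
  have := expR_ge1Dx ((mu - 5 * d%:R) * y).
  have : (8 * d%:R) * 1 <= (mu - 5 * d%:R) * y by apply: ler_pM => //; lra.
  lra.
lra.
Qed.

End GoodEvent.

Lemma scaling_ratio_exists (R : realType) (H alpha : R) : 0 < H -> H < 1 / 2 ->
  0 < alpha -> 1 < 2 * H + alpha ->
  exists rho : R, [/\ 0 < rho, rho < 1, 1 < 2 * rho ^+ 2 &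
    rho `^ (2 * alpha) * (2 * half_pow H) < 1].
Proof.
move=> H0 H1 al0 Hal.
(* rho = 2^-gam; the two conditions on the right require gam < 1/2 and
   gam > (1 - 2 H) / (2 alpha), compatible because 2 H + alpha > 1. *)
pose gam := ((1 - 2 * H) / (2 * alpha) + 1 / 2) / 2.
have g1 : (1 - 2 * H) / (2 * alpha) < 1 / 2.
  by rewrite ltr_pdivrMr ?mulr_gt0//; lra.
have g0 : 0 < (1 - 2 * H) / (2 * alpha) by rewrite divr_gt0 ?mulr_gt0//; lra.
have gl : (1 - 2 * H) / (2 * alpha) < gam by rewrite /gam; lra.
have gu : gam < 1 / 2 by rewrite /gam; lra.
have gt1 (r : R) : 0 < r -> 1 < 2 `^ r.
  move=> r0; have one : 1 `^ r = 1 :> R by rewrite powR1.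
  by rewrite -[ltLHS]one gt0_ltr_powR ?nnegrE// ltr1n.
have lt1 (r : R) : r < 0 -> 2 `^ r < 1.
  by move=> r0; rewrite -[r]opprK powRN invf_lt1 ?powR_gt0// gt1// oppr_gt0.
exists (2 `^ (- gam)); split; first by rewrite powR_gt0.
- by apply: lt1; lra.
- rewrite -[X in 1 < X * _](powRr1 (_ : 0 <= 2))// -powR_mulrn ?powR_ge0//.
  rewrite -powRrM -powRD ?pnatr_eq0 ?implybT//.
  by apply: gt1; lra.
- have -> : half_pow H = 2 `^ (- (2 * H)).
    by rewrite /half_pow -powR_inv1// -powRrM mulN1r.
  rewrite -[X in _ * (X * _)](powRr1 (_ : 0 <= 2))// -powRrM.
  rewrite -!powRD ?pnatr_eq0 ?implybT//.
  apply: lt1; move: gl; rewrite ltr_pdivrMr ?mulr_gt0//; lra.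
Qed.

Lemma near_powR_ge (R : realType) (A p L : R) : 0 < A -> 0 < p ->
  \forall z \near +oo, L <= A * z `^ p.
Proof.
move=> A0 p0; exists ((`|L| / A) `^ p^-1); split; first exact: num_real.
move=> z hz; apply: (le_trans (ler_norm L)); rewrite -ler_pdivrMl// mulrC.
have y0 : 0 <= `|L| / A by rewrite divr_ge0// ltW.
rewrite -[leLHS](powRr1 y0) -[in leLHS](mulVf (negbT (gt_eqF p0))) powRrM.
apply: ge0_ler_powR; rewrite ?nnegrE ?powR_ge0//; try exact: ltW.
by apply: le_trans (ltW hz); exact: powR_ge0.
Qed.

(** * Balancing the level of the paths against its probability *)

Section MomentGrowth.
Context (R : realType) (dO dB : measure_display).
Context (Omega : measurableType dO) (OmegaB : measurableType dB).
Context (P : probability Omega R) (PB : probability OmegaB R).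
Context (d : nat) (H alpha beta : R).
Context (Q : 'rV[R]_d -> 'rV[R]_d -> R) (W : R -> 'rV[R]_d -> {RV P >-> R}).
Context (B : 'I_d -> R -> {RV PB >-> R}) (u0 : 'rV[R]_d -> R).

Local Notation e := (1 - beta)^-1.

Lemma moment_growth : 0 < H -> H < 1 / 2 -> 0 < alpha -> 1 < 2 * H + alpha ->
  0 <= beta -> beta < 1 -> covariance_function Q ->
  (exists2 C0 : R, 0 < C0 & forall x y,
     Q x x + Q y y - 2 * Q x y <= C0 * enorm (x - y) `^ (2 * alpha)) ->
  (exists2 C2 : R, 0 < C2 & forall M : R, 0 < M -> forall x y : 'rV[R]_d,
     (forall i, M <= x 0 i) -> (forall i, M <= y 0 i) ->
     C2 * M `^ (2 * beta) <= Q x y) ->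
  gaussian_field H Q W -> standard_brownian_motion B -> 0 < inf (range u0) ->
  exists A1 A2 L : R, [/\ 0 < A1, 0 < A2 &
    forall (x : 'rV[R]_d) (k : nat) (t : R), (0 < k)%N -> 0 < t ->
    L <= A1 * k%:R `^ e * t `^ ((2 * H + beta) / (1 - beta)) ->
    (forall i, - x 0 i <= A2 * k%:R `^ (e / 2) * t `^ ((2 * H + 1) * (e / 2))) ->
    ((expR (A1 * k%:R `^ ((2 - beta) / (1 - beta)) *
        t `^ ((2 * H + beta) / (1 - beta))))%:E
      <= \int[P]_w (feynman_kac W B u0 t x w ^+ k))%E].
Proof.
move=> H0 H1 al0 Hal b0 b1 HQ [C0 C00 Qh] [C2 C20 Q2] HW HB u0inf.
have [rho [rho0 rho1 rho2 rhoH]] := scaling_ratio_exists H0 H1 al0 Hal.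
have [q q0 evt] := good_event_ge HB rho0 rho1 rho2.
pose c := inf (range u0).
have u0c y : c <= u0 y.
  have [hi|hi] := pselect (has_inf (range u0)).
    by apply: ge_inf; [exact: (proj2 hi)|exists y].
  by move: u0inf; rewrite inf_out// ltxx.
have e0 : 0 < e by rewrite invr_gt0 subr_gt0.
pose theta : R := 2^-1 ^+ q.
have theta0 : 0 < theta by rewrite exprn_gt0// invr_gt0.
pose C : R := 5 * d%:R + 1.
have C1 : 0 <= C by rewrite addr_ge0// mulr_ge0.
(* The exponent in [moment_lower] is D k^2 M^(2 beta) t^(2 H): the factor 1/16 combines 1/2 from the
   variance bound with 1/8 from [comb_exp_ge]. *)
pose D := C2 * theta `^ (2 * H) / 16.
have D0 : 0 < D by rewrite divr_gt0// mulr_gt0// powR_gt0.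
pose kap := D / (16 * (C + 2)).
have kap0 : 0 < kap by rewrite divr_gt0// mulr_gt0// ltr_wpDl.
(* M below solves M^(2 - 2 beta) = kap k t^(2 H + 1), and y = 16 M^2 / t.  The Gaussian
   exponent is then k (C + 2) y, against a cost C y per path for the event a = 4 M. *)
exists (16 * kap `^ e), (kap `^ (e / 2)), (Num.max 1 (- ln c)).
split; [by rewrite mulr_gt0// powR_gt0|by rewrite powR_gt0|].
move=> x k t k0 t0.
have kr0 : 0 < k%:R :> R by rewrite ltr0n.
set f := (2 * H + beta) / (1 - beta).
set y := 16 * kap `^ e * k%:R `^ e * t `^ f.
(* y >= 1 is required by [good_event_ge], and y >= - ln c makes the surplus in the exponent cover
   the factor c^k. *)
rewrite ge_max => /andP[y1 yc].
set M := kap `^ (e / 2) * k%:R `^ (e / 2) * t `^ ((2 * H + 1) * (e / 2)) => xM.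
have M0 : 0 < M by rewrite !mulr_gt0 ?powR_gt0.
have ME (r : R) : M `^ r = kap `^ (e / 2 * r) * k%:R `^ (e / 2 * r) *
    t `^ ((2 * H + 1) * (e / 2 * r)).
  rewrite /M powRM; [|by rewrite mulr_ge0 ?powR_ge0|exact: powR_ge0].
  by rewrite powRM ?powR_ge0// -!powRrM -(mulrA (2 * H + 1)).
have tD (r s : R) : t `^ (r + s) = t `^ r * t `^ s.
  by rewrite powRD// (gt_eqF t0) implybT.
have MM : M `^ (2 * (1 - beta)) = kap * k%:R * t `^ (2 * H) * t.
  rewrite ME (_ : e / 2 * (2 * (1 - beta)) = 1); last first.
    by field; rewrite subr_eq0 gt_eqF.
  by rewrite !powRr1 ?(ltW kap0) ?(ltW kr0)// mulr1 tD powRr1 ?(ltW t0)// !mulrA.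
have M2 : M ^+ 2 * 16 / t = y.
  rewrite -powR_mulrn ?(ltW M0)// ME divfK ?pnatr_eq0// /y.
  have -> : (2 * H + 1) * e = f + 1.
    by rewrite /f; field; rewrite subr_eq0 gt_eqF.
  rewrite tD powRr1 ?(ltW t0)//; field.
  by rewrite gt_eqF.
have M4 : (4 * M) ^+ 2 / t = y by rewrite -M2; field; rewrite gt_eqF.
have a0 : 0 < 4 * M by rewrite mulr_gt0.
have PE : ((expR (- (C * y)))%:E <= PB (good_event B rho t q (4 * M)))%E.
  by have := evt t (4 * M) t0 a0; rewrite M4; apply.
have g0 : 0 <= C2 * M `^ (2 * beta) by rewrite mulr_ge0 ?powR_ge0// ltW.
have cov b b' : good_event B rho t q (4 * M) b -> good_event B rho t q (4 * M) b' ->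
    forall r, 0 <= r <= mesh t q ->
    C2 * M `^ (2 * beta) <= Q (bpath B t x b r) (bpath B t x b' r).
  (* Of the level 4 M, half may be lost to oscillation and at most M to the starting point, so at
     least M remains. *)
  have hi z r i : good_event B rho t q (4 * M) z -> 0 <= r <= mesh t q ->
      M <= bpath B t x z r 0 i.
    move=> gz rq.
    have := good_event_lower HB rho0 rho1 i t0 q0 a0 gz rq.
    have rt : 0 <= r <= t.
      have /andP[_ m1] := mesh_bounds t0 q0; case/andP: rq => -> /= rq; lra.
    rewrite bpathE// /shiftedB !mxE; have := xM i; lra.
  by move=> gb gb' r rq; apply: Q2 => // i; exact: hi.
have key := moment_lower H0 H1 HQ HW HB al0 C00 Qh rho0 rho1 rho2 rhoH t0 k
  (measurable_good_event _ _ _ _ _) g0 u0inf u0c cov.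
apply: (le_trans _ key).
apply: (@le_trans _ _ ((expR (- (C * y)))%:E ^+ k *
  (c ^+ k * expR (k%:R ^+ 2 * (C2 * M `^ (2 * beta)) * (2^-1 * mesh t q `^ (2 * H)) / 8))%:E)%E);
  last first.
  by rewrite lee_wpmul2r ?lee_expe// lee_fin mulr_ge0 ?expR_ge0// exprn_ge0// ltW.
have -> : k%:R ^+ 2 * (C2 * M `^ (2 * beta)) * (2^-1 * mesh t q `^ (2 * H)) / 8 =
    k%:R * ((C + 2) * y).
  have E : k%:R * t `^ (2 * H) * M `^ (2 * beta) = M ^+ 2 / (kap * t).
    rewrite -[M ^+ 2]powR_mulrn ?(ltW M0)//.
    have -> : M `^ 2%:R = M `^ (2 * (1 - beta)) * M `^ (2 * beta).
      by rewrite -powRD ?(gt_eqF M0) ?implybT//; congr powR; ring.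
    by rewrite MM; field; rewrite !gt_eqF.
  rewrite /mesh powRM ?(ltW t0)// ?(ltW theta0)// -/theta -M2.
  transitivity (k%:R * (D * (k%:R * t `^ (2 * H) * M `^ (2 * beta)))).
    by rewrite /D; field.
  rewrite E /kap; field.
  by rewrite !gt_eqF// ltr_wpDl.
rewrite -EFin_expe -EFinM lee_fin.
have -> : c ^+ k = expR (k%:R * ln c) by rewrite expRM_natl lnK// posrE.
rewrite -expRM_natl -!expRD ler_expR.
have -> : 16 * kap `^ e * k%:R `^ ((2 - beta) / (1 - beta)) * t `^ f = k%:R * y.
  have -> : (2 - beta) / (1 - beta) = 1 + e by field; rewrite subr_eq0 gt_eqF.
  by rewrite powRD ?(gt_eqF kr0) ?implybT// powRr1 ?(ltW kr0)// /y; ring.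
(* Per path, (C + 2) y is gained, C y is spent on the event and at most y on c; a net y is left. *)
rewrite -!mulrDr ler_wpM2l ?(ltW kr0)//; lra.
Qed.

End MomentGrowth.

Theorem theorem4p1 (R : realType) (d : nat) (H alpha beta : R)
  (Q : 'rV[R]_d -> 'rV[R]_d -> R)
  (dO dB : measure_display)
  (Omega : measurableType dO) (OmegaB : measurableType dB)
  (P : probability Omega R) (PB : probability OmegaB R)
  (W : R -> 'rV[R]_d -> {RV P >-> R})
  (B : 'I_d -> R -> {RV PB >-> R})
  (u0 : 'rV[R]_d -> R) :
  (1 <= d)%N ->
  0 < H -> H < 1 / 2 ->
  0 < alpha -> alpha <= 1 ->
  1 < 2 * H + alpha ->
  0 <= beta -> beta < 1 ->
  covariance_function Q ->
  (exists2 C0 : R, 0 < C0 & forall x y,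
     Q x x + Q y y - 2 * Q x y <= C0 * enorm (x - y) `^ (2 * alpha)) ->
  (exists2 C2 : R, 0 < C2 & forall M : R, 0 < M -> forall x y : 'rV[R]_d,
     (forall i, M <= x 0 i) -> (forall i, M <= y 0 i) ->
     C2 * M `^ (2 * beta) <= Q x y) ->
  gaussian_field H Q W ->
  standard_brownian_motion B ->
  measurable_fun setT (u0 : g_sigma_algebraType (@open 'rV[R]_d) -> R) ->
  [bounded u0 x | x in [set: 'rV[R]_d]] ->
  0 < inf (range u0) ->
  let moment_bound (C : R) (x : 'rV[R]_d) (k : nat) (t : R) :=
    ((C * expR (C * k%:R `^ ((2 - beta) / (1 - beta))
                  * t `^ ((2 * H + beta) / (1 - beta))))%:E
     <= \int[P]_w (feynman_kac W B u0 t x w ^+ k))%E in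
  exists2 C : R, 0 < C & forall x : 'rV[R]_d,
    (forall k : nat, (1 <= k)%N -> \forall t \near +oo, moment_bound C x k t) /\
    (forall t : R, 0 < t -> \forall k \near \oo, moment_bound C x k t).
Proof.
move=> _ H0 H1 al0 _ Hal b0 b1 HQ Q1 Q2 HW HB _ _ u0inf mb.
have [A1 [A2 [L [A10 A20 growth]]]] :=
  moment_growth H0 H1 al0 Hal b0 b1 HQ Q1 Q2 HW HB u0inf.
have e0 : 0 < (1 - beta)^-1 by rewrite invr_gt0 subr_gt0.
have e20 : 0 < (1 - beta)^-1 / 2 by rewrite divr_gt0.
(* The same constant has to serve as prefactor and as rate. *)
pose C := Num.min 1 A1.
have C0 : 0 < C by rewrite lt_min ltr01.
exists C => // x.
(* The starting point only affects how large k or t must be, not the constant C. *)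
pose m := \sum_i `|x 0 i|.
have xm i : - x 0 i <= m.
  apply: (le_trans (ler_norm _)); rewrite normrN /m (bigD1 i)//= lerDl.
  exact: sumr_ge0.
have fin k t : (0 < k)%N -> 0 < t ->
    L <= A1 * k%:R `^ (1 - beta)^-1 * t `^ ((2 * H + beta) / (1 - beta)) ->
    m <= A2 * k%:R `^ ((1 - beta)^-1 / 2) * t `^ ((2 * H + 1) * ((1 - beta)^-1 / 2)) ->
    mb C x k t.
  move=> k0 t0 hL hm; apply: (le_trans _ (growth x k t k0 t0 hL _)); last first.
    by move=> i; exact: le_trans (xm i) hm.
  rewrite lee_fin -[leRHS]mul1r; apply: ler_pM; rewrite ?expR_ge0 ?(ltW C0)//.
    by rewrite ge_min lexx.
  rewrite ler_expR -!mulrA ler_wpM2r ?mulr_ge0 ?powR_ge0//.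
  by rewrite ge_min lexx orbT.
split=> [k k0|t t0].
  have kr0 : 0 < k%:R :> R by rewrite ltr0n.
  have h1 := @near_powR_ge R (A1 * k%:R `^ (1 - beta)^-1) ((2 * H + beta) / (1 - beta)) L.
  have h2 := @near_powR_ge R (A2 * k%:R `^ ((1 - beta)^-1 / 2))
    ((2 * H + 1) * ((1 - beta)^-1 / 2)) m.
  apply: filterS3 (nbhs_pinfty_gt (num_real 0)) (h1 _ _) (h2 _ _) => [t t0 ? ?|||| ].
  - exact: fin.
  - by rewrite mulr_gt0// powR_gt0.
  - by rewrite mulr_gt0// ltr_pwDl// mulr_gt0.
  - by rewrite mulr_gt0// powR_gt0.
  - by rewrite mulr_gt0// addr_gt0// mulr_gt0.
have h1 := @near_powR_ge R (A1 * t `^ ((2 * H + beta) / (1 - beta))) (1 - beta)^-1 L.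
have h2 := @near_powR_ge R (A2 * t `^ ((2 * H + 1) * ((1 - beta)^-1 / 2)))
  ((1 - beta)^-1 / 2) m.
have h0 : \forall k \near \oo, (0 < k)%N by exact: nbhs_infty_gt.
apply: filterS3 h0 (cvgr_idn (h1 _ e0)) (cvgr_idn (h2 _ e20)) => [k k0 hk1 hk2||].
- by apply: fin => //; rewrite mulrAC.
- by rewrite mulr_gt0// powR_gt0.
- by rewrite mulr_gt0// powR_gt0.
Qed.
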